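(* Let $R\in\mathcal{E}^d(\Omega)$. Then $R\in\mathcal{E}^d_M(\Omega)$ if and only if the following holds: for every compact $K\subset\Omega$, every $\alpha\in\mathbb{N}_0^s$ and every $k\in\mathbb{N}_0$ there exists $N\in\mathbb{N}$ such that for every bounded subset $B\subseteq\mathcal{D}(\mathbb{R}^s)$ there exist $\varepsilon_0\in(0,1]$ and $C>0$ such that for all $\varepsilon\in(0,\varepsilon_0)$, all $x\in K$, all $\varphi\in B\cap\mathcal{A}_0(\mathbb{R}^s)$ and all $\psi_1,\dots,\psi_k\in B\cap\mathcal{A}_{00}(\mathbb{R}^s)$, the quantity below is defined and $$\big|\partial_x^\alpha\, \mathrm{d}_1^k(R\circ S^{(\varepsilon)})(\varphi,x)(\psi_1,\dots,\psi_k)\big|\le C\varepsilon^{-N}.$$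
   Context: Fix $s\ge1$ and an open set $\Omega\subseteq\mathbb{R}^s$. $\mathcal{D}(\mathbb{R}^s)$ is the space of compactly supported smooth complex functions with its usual (LF) topology. Define $\mathcal{A}_0(\mathbb{R}^s)=\{\varphi\in\mathcal{D}(\mathbb{R}^s):\int\varphi(\xi)\,d\xi=1\}$, $\mathcal{A}_{00}(\mathbb{R}^s)=\{\varphi\in\mathcal{D}(\mathbb{R}^s):\int\varphi=0\}$, and for $q\in\mathbb{N}$, $\mathcal{A}_q(\mathbb{R}^s)=\{\varphi\in\mathcal{A}_0(\mathbb{R}^s):\int\xi^\beta\varphi(\xi)\,d\xi=0\text{ for }1\le|\beta|\le q\}$. Let $U(\Omega)=\{(\varphi,x)\in\mathcal{A}_0(\mathbb{R}^s)\times\Omega:\ \mathrm{supp}\,\varphi\subseteq\Omega-x\}$, and $\mathcal{E}^d(\Omega)=C^\infty(U(\Omega))$, the complex-valued functions on $U(\Omega)$ that are smooth in the sense of convenient calculus (Kriegl–Michor: maps sending smooth curves to smooth curves), $U(\Omega)$ being viewed as a subset of the affine space $\mathcal{A}_0(\mathbb{R}^s)\times\mathbb{R}^s$. For $\varepsilon>0$ put $(S_\varepsilon\varphi)(\xi)=\varepsilon^{-s}\varphi(\xi/\varepsilon)$ and $S^{(\varepsilon)}(\varphi,x)=(S_\varepsilon\varphi,x)$; $R\circ S^{(\varepsilon)}$ is defined at those $(\varphi,x)$ with $(S_\varepsilon\varphi,x)\in U(\Omega)$. $\mathrm{d}_1^k$ denotes the $k$-th differential with respect to the first (test-function) variable,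 evaluated in directions $\psi_1,\dots,\psi_k\in\mathcal{A}_{00}(\mathbb{R}^s)$, and $\partial_x^\alpha$ denotes partial differentiation in $x$. $C^\infty_b((0,1]\times\Omega,\mathcal{A}_q(\mathbb{R}^s))$ ($q\in\mathbb{N}_0$) denotes the set of smooth maps $\phi:(0,1]\times\Omega\to\mathcal{A}_q(\mathbb{R}^s)$ such that for every compact $K\subset\Omega$ and every $\alpha\in\mathbb{N}_0^s$ the set $\{\partial_x^\alpha\phi(\varepsilon,x):\varepsilon\in(0,1],x\in K\}$ is bounded in $\mathcal{D}(\mathbb{R}^s)$ (for such $\phi$ and compact $K$, $(S_\varepsilon\phi(\varepsilon,x),x)\in U(\Omega)$ for $x\in K$ and all small $\varepsilon$). $R\in\mathcal{E}^d(\Omega)$ is moderate, written $R\in\mathcal{E}^d_M(\Omega)$, if for every compact $K\subset\Omega$ and every $\alpha\in\mathbb{N}_0^s$ there is $N\in\mathbb{N}$ such that for every $\phi\in C^\infty_b((0,1]\times\Omega,\mathcal{A}_0(\mathbb{R}^s))$: $\sup_{x\in K}|\partial_x^\alpha(R(S_\varepsilon\phi(\varepsilon,x),x))|=O(\varepsilon^{-N})$ as $\varepsilon\to0$. *)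

(* Defs.v *)
From mathcomp Require Import all_boot all_order all_algebra.
From mathcomp Require Import all_classical all_reals all_analysis.
Import Order.TTheory GRing.Theory Num.Theory.
Import numFieldNormedType.Exports.

Set Implicit Arguments.
Unset Strict Implicit.
Unset Printing Implicit Defensive.

Local Open Scope ring_scope.
Local Open Scope classical_set_scope.

Section ColombeauDefs.
Context {R : realType}.

(* Complex numbers are represented as pairs (real part, imaginary part). *)
Definition cabs (z : R * R) : R := Num.sqrt (z.1 ^+ 2 + z.2 ^+ 2).

Definition tfun (s : nat) := 'rV[R]_s -> R * R.

Definition evec {n : nat} (i : 'I_n) : 'rV[R]_n := delta_mx 0 i.

Definition partial {n : nat} {W : normedModType R} (i : 'I_n)
  (f : 'rV[R]_n -> W) : 'rV[R]_n -> W := fun x => derive f x (evec i).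

Fixpoint pders {n : nat} {W : normedModType R} (l : seq 'I_n)
  (f : 'rV[R]_n -> W) : 'rV[R]_n -> W :=
  match l with
  | [::] => f
  | i :: l' => partial i (pders l' f)
  end.

Definition mlist {n : nat} (alpha : 'I_n -> nat) : seq 'I_n :=
  flatten [seq nseq (alpha i) i | i <- enum 'I_n].

Definition pder {n : nat} {W : normedModType R} (alpha : 'I_n -> nat)
  (f : 'rV[R]_n -> W) : 'rV[R]_n -> W := pders (mlist alpha) f.

Definition smooth_on {n : nat} {W : normedModType R} (A : set 'rV[R]_n)
  (f : 'rV[R]_n -> W) : Prop :=
  open A /\
  forall (l : seq 'I_n) (x : 'rV[R]_n), A x ->
    (forall i : 'I_n, derivable (pders l f) x (evec i)) /\
    {for x, continuous (pders l f)}.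

Definition scurve {W : normedModType R} (c : R -> W) : Prop :=
  smooth_on setT (fun p : 'rV[R]_1 => c (p ord0 ord0)).

Definition supp {s : nat} (f : tfun s) : set 'rV[R]_s :=
  closure [set xi | f xi != 0].

Definition testfun {s : nat} (f : tfun s) : Prop :=
  smooth_on setT f /\ compact (supp f).

Definition setc {s : nat} (xi : 'rV[R]_s) (i : 'I_s) (t : R) : 'rV[R]_s :=
  \row_j (if j == i then t else xi ord0 j).

Fixpoint iint {s : nat} (l : seq 'I_s) (f : 'rV[R]_s -> R) (xi : 'rV[R]_s) : R :=
  match l with
  | [::] => f xi
  | i :: l' => Rintegral (@lebesgue_measure R) setT (fun t => iint l' f (setc xi i t))
  end.

Definition intRs {s : nat} (f : 'rV[R]_s -> R) : R := iint (enum 'I_s) f 0.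

Definition cint {s : nat} (f : tfun s) : R * R :=
  (intRs (fun xi => (f xi).1), intRs (fun xi => (f xi).2)).

Definition A0 {s : nat} (f : tfun s) : Prop := testfun f /\ cint f = (1, 0).
Definition A00 {s : nat} (f : tfun s) : Prop := testfun f /\ cint f = (0, 0).

Definition Uset {s : nat} (Om : set 'rV[R]_s) (phi : tfun s) (x : 'rV[R]_s) : Prop :=
  A0 phi /\ Om x /\ supp phi `<=` [set xi | Om (xi + x)].

Definition Seps {s : nat} (eps : R) (phi : tfun s) : tfun s :=
  fun xi => (eps ^- s) *: phi (eps^-1 *: xi).

(* Smooth curves in D(R^s) (Kriegl-Michor characterization): jointly smooth
   in (t, xi), with supports locally uniformly in a compact set. *)
Definition dcurve {s : nat} (c : R -> tfun s) : Prop :=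
  (forall t, testfun (c t)) /\
  smooth_on setT (fun p : 'rV[R]_(1 + s) => c (p ord0 (lshift s ord0)) (rsubmx p)) /\
  (forall a b : R, exists L : set 'rV[R]_s,
      compact L /\ forall t, a <= t <= b -> supp (c t) `<=` L).

(* E^d(Omega) = C^infty(U(Omega)) in the convenient sense: smooth curves in
   U(Omega) (as a subset of the affine space A_0 x R^s) are mapped to smooth
   curves.  Elements are represented by total functions; only their values
   on U(Omega) matter. *)
Definition Ed {s : nat} (Om : set 'rV[R]_s) (Rd : tfun s -> 'rV[R]_s -> R * R) : Prop :=
  forall (c : R -> tfun s) (g : R -> 'rV[R]_s),
    dcurve c -> scurve g -> (forall t, Uset Om (c t) (g t)) ->
    scurve (fun t => Rd (c t) (g t)).

Definition boundedD {s : nat} (B : set (tfun s)) : Prop :=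
  (forall f, B f -> testfun f) /\
  exists L : set 'rV[R]_s, compact L /\ (forall f, B f -> supp f `<=` L) /\
    forall beta : 'I_s -> nat, exists M : R,
      forall f xi, B f -> cabs (pder beta f xi) <= M.

Definition jointmap {s : nat} (phi : R -> 'rV[R]_s -> tfun s) :
  'rV[R]_(1 + s + s) -> R * R :=
  fun p => let q := lsubmx p in phi (q ord0 (lshift s ord0)) (rsubmx q) (rsubmx p).

Definition Cb {s : nat} (Om : set 'rV[R]_s) (phi : R -> 'rV[R]_s -> tfun s) : Prop :=
  (forall eps x, 0 < eps <= 1 -> Om x -> A0 (phi eps x)) /\
  (exists W : set 'rV[R]_(1 + s + s),
      (forall (eps : R) (x xi : 'rV[R]_s), 0 < eps <= 1 -> Om x ->
         W (row_mx (row_mx (const_mx eps : 'rV[R]_1) x) xi)) /\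
      smooth_on W (jointmap phi)) /\
  (forall K : set 'rV[R]_s, compact K -> K `<=` Om ->
    forall alpha : 'I_s -> nat,
      boundedD [set f | exists eps x, 0 < eps <= 1 /\ K x /\
                 f = (fun xi => pder alpha (fun y => phi eps y xi) x)]).

Definition moderate {s : nat} (Om : set 'rV[R]_s)
  (Rd : tfun s -> 'rV[R]_s -> R * R) : Prop :=
  forall K : set 'rV[R]_s, compact K -> K `<=` Om ->
  forall alpha : 'I_s -> nat,
  exists N : nat, (0 < N)%N /\
  forall phi : R -> 'rV[R]_s -> tfun s, Cb Om phi ->
  exists eps0 C : R, 0 < eps0 /\ 0 < C /\
  forall (eps : R) (x : 'rV[R]_s), 0 < eps < eps0 -> K x ->
    cabs (pder alpha (fun y => Rd (Seps eps (phi eps y)) y) x) <= C * eps ^- N.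

Definition affcomb {s k : nat} (phi : tfun s) (psi : 'I_k -> tfun s)
  (t : 'rV[R]_k) : tfun s :=
  fun xi => phi xi + \sum_(i < k) t ord0 i *: psi i xi.

(* partial_x^alpha d_1^k (R o S^(eps)) (phi, x) (psi_1, ..., psi_k), with
   d_1^k f(phi)(psi) = d^k/dt_1...dt_k f(phi + sum t_i psi_i) |_{t = 0}. *)
Definition dquant {s k : nat} (Rd : tfun s -> 'rV[R]_s -> R * R) (eps : R)
  (alpha : 'I_s -> nat) (phi : tfun s) (psi : 'I_k -> tfun s) (x : 'rV[R]_s) : R * R :=
  pder alpha (fun y => pders (enum 'I_k)
                         (fun t => Rd (Seps eps (affcomb phi psi t)) y) 0) x.

(* "the quantity is defined": (R o S^(eps)) is defined on a neighbourhood of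
   (phi, x) in the finite-dimensional slice {(phi + sum t_i psi_i, y)}. *)
Definition dquant_defined {s k : nat} (Om : set 'rV[R]_s) (eps : R)
  (phi : tfun s) (psi : 'I_k -> tfun s) (x : 'rV[R]_s) : Prop :=
  \forall p \near ((0 : 'rV[R]_k), x), Uset Om (Seps eps (affcomb phi psi p.1)) p.2.

Definition moderate_char {s : nat} (Om : set 'rV[R]_s)
  (Rd : tfun s -> 'rV[R]_s -> R * R) : Prop :=
  forall K : set 'rV[R]_s, compact K -> K `<=` Om ->
  forall (alpha : 'I_s -> nat) (k : nat),
  exists N : nat, (0 < N)%N /\
  forall B : set (tfun s), boundedD B ->
  exists eps0 C : R, 0 < eps0 <= 1 /\ 0 < C /\
  forall (eps : R) (x : 'rV[R]_s) (phi : tfun s) (psi : 'I_k -> tfun s),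
    0 < eps < eps0 -> K x -> B phi -> A0 phi ->
    (forall i, B (psi i) /\ A00 (psi i)) ->
    dquant_defined Om eps phi psi x /\
    cabs (dquant Rd eps alpha phi psi x) <= C * eps ^- N.

End ColombeauDefs.

(* Main.v *)
Require Import Defs.
From mathcomp Require Import all_boot all_order all_algebra.
From mathcomp Require Import all_classical all_reals all_analysis.
From mathcomp Require Import ring lra zify.
Import Order.TTheory GRing.Theory Num.Theory.
Import numFieldNormedType.Exports.

Set Implicit Arguments.
Unset Strict Implicit.
Unset Printing Implicit Defensive.

Local Open Scope ring_scope.
Local Open Scope classical_set_scope.

(** The space of pairs (test function, point) carries the bounded absolutely
convex sets [Bd rho M mv]. Along a sequence converging fast enough (Mackey), Kriegl's special
curve lemma glues countably many line segments into one smooth curve, so a function smooth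
along smooth curves has locally uniform Taylor expansions with respect to every [Bd]
(predicate [tay]). From [tay] alone one gets symmetric multilinear derivatives [Wf], the chain
rule along plots, and polarisation, and the quantity of the theorem is
[Wf] at [(S_eps phi, x)] in the directions [(0, e_i)] and [(S_eps psi_j, 0)].

Moderate implies the estimate: polarising with base direction [(0, e_0)], every direction has
a nonzero component in [R^s], so each pure derivative is an [x]-derivative of
[y |-> R (S_eps (phi + (y_0 - x_0) psi), y)]. Were these not uniformly bounded for [phi, psi]
in a bounded set, a violating sequence with [eps_m -> 0] could be glued, by bump functions of
[eps], into a single element of [C_b] contradicting moderateness. For [s = 0] there is nothing to
differentiate.

Conversely, the derivatives of [y |-> R (S_eps (phi (eps, y)), y)] are, by Faa di Bruno, fixed finite
sums of [Wf] in the directions [d_x^l (S_eps phi (eps, x), x)], which the estimate bounds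
because the derivatives [d_x^l phi (eps, x)] stay in a bounded subset of [A_00]. *)

(** * Taylor expansions relative to an absolutely convex set *)

Section AbsConvex.
Context {R : realType} {X : lmodType R}.
Implicit Types (B : set X) (c u v : X).

(** Convenient smoothness only speaks of curves, so at the outset [Rd] has no differential, no
    linearity and no joint continuity. The substitute [tay] asks nothing of its coefficients; its
    strength is uniformity in base point and direction together. Iterated differences can then be
    compared at neighbouring base points, and identities that are exact for differences pass to the
    limit. With the unit ball as [B], [tay] also holds for smooth functions on open subsets of R^n,
    so the same machinery yields the symmetry of mixed partials.

    The quantifier order in moderateness is essential: [N] precedes the family, the constant follows
    it. Therefore violations with growing constants, collected in one family, refute the bound. All
    choices over orders of differentiation range over finite types, so a common [N] exists.

    Uniformity in eps is carried by the sets [vbnd] alone. The calculus runs at one fixed eps, in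
    sets [Bd] whose bounds may degenerate as eps tends to 0: they guarantee that expansions exist
    but do not enter the final constants. *)

Definition absconvex B := B 0 /\
  forall b b' (l m : R), B b -> B b' -> `|l| + `|m| <= 1 -> B (l *: b + m *: b').

Definition dil (k : R) B : set X := [set u | exists2 b, B b & u = k *: b].

(** Nearness is measured by multiples of [B] only; [X] carries no topology. *)
Definition around B (a : X) (d : R) : set X := [set c | dil d B (c - a)].

Variable B : set X.
Hypothesis cB : absconvex B.

Lemma absconvex_scale (l : R) b : `|l| <= 1 -> B b -> B (l *: b).
Proof.
move=> hl Bb; have := cB.2 b 0 l 0 Bb cB.1.
by rewrite scale0r addr0 normr0 addr0; exact.
Qed.

Lemma dil0 (k : R) : dil k B 0.
Proof. by exists 0; [exact: cB.1|rewrite scaler0]. Qed.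

Lemma dilS (k l : R) u : `|k| <= `|l| -> dil k B u -> dil l B u.
Proof.
move=> kl [b Bb ->]; have [l0|l0] := eqVneq l 0.
  by move: kl; rewrite l0 normr0 normr_le0 => /eqP ->; exists b; rewrite ?scale0r.
exists ((k / l) *: b).
  by apply: absconvex_scale => //; rewrite normrM normfV ler_pdivrMr ?mul1r ?normr_gt0.
by rewrite scalerA mulrCA divff// mulr1.
Qed.

Lemma dilZ (k l : R) u : dil k B u -> dil (l * k) B (l *: u).
Proof. by move=> [b Bb ->]; exists b => //; rewrite scalerA. Qed.

Lemma dilD (k l : R) u v : 0 <= k -> 0 <= l ->
  dil k B u -> dil l B v -> dil (k + l) B (u + v).
Proof.
move=> k0 l0 [b Bb ->] [b' Bb' ->]; have [kl|kl] := eqVneq (k + l) 0.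
  have -> : k = 0 by lra. have -> : l = 0 by lra.
  by rewrite !scale0r !addr0; exists b => //; rewrite scale0r.
have kl0 : 0 < k + l by rewrite lt_neqAle eq_sym kl addr_ge0.
exists ((k / (k + l)) *: b + (l / (k + l)) *: b').
  by apply: cB.2 => //; rewrite !ger0_norm ?divr_ge0 ?(ltW kl0)// -mulrDl divff.
by rewrite scalerDr !scalerA ![(k + l) * _]mulrC !mulfVK.
Qed.

Lemma around0 a (d : R) : around B a d a.
Proof. by rewrite /around /= subrr; exact: dil0. Qed.

Lemma aroundS a (d d' : R) c : 0 <= d -> d <= d' -> around B a d c -> around B a d' c.
Proof. by move=> d0 dd; apply: dilS; rewrite !ger0_norm// (le_trans d0). Qed.

Lemma around_shift a (d d' k h : R) c u : 0 <= d -> 0 <= k -> `|h| * k <= d' ->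
  around B a d c -> dil k B u -> around B a (d + d') (c + h *: u).
Proof.
move=> d0 k0 hk cd uk; rewrite /around /= addrAC.
have d'0 : 0 <= d' by apply: le_trans hk; rewrite mulr_ge0.
apply: dilD => //; apply: (@dilS (h * k)); last exact: dilZ.
by rewrite normrM (ger0_norm k0) (ger0_norm d'0).
Qed.

End AbsConvex.

(** * Iterated differences and their polarised coefficients *)

Section Differences.
Context {R : realType} {X : lmodType R} {W : normedModType R}.
Implicit Types (B : set X) (us : seq X) (f : X -> W).

(* Signed partial sums of [us]: the nodes of the iterated difference [Df]. *)
Fixpoint nodes us : seq (R * X) :=
  match us with
  | [::] => [:: (1, 0)]
  | u :: us' => [seq (e.1, e.2 + u) | e <- nodes us'] ++ [seq (- e.1, e.2) | e <- nodes us']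
  end.

Fixpoint Df f us c : W :=
  match us with
  | [::] => f c
  | u :: us' => Df f us' (c + u) - Df f us' c
  end.

Lemma DfE f us (h : R) c :
  Df f [seq h *: u | u <- us] c = \sum_(e <- nodes us) e.1 *: f (c + h *: e.2).
Proof.
elim: us c => [|u us IH] c /=; first by rewrite big_seq1 /= scale1r scaler0 addr0.
rewrite !IH big_cat /= !big_map; congr (_ + _).
  by apply: eq_bigr => e _ /=; rewrite scalerDr [h *: e.2 + _]addrC addrA.
by rewrite -sumrN; apply: eq_bigr => e _ /=; rewrite scaleNr.
Qed.

Lemma nodes_norm us e : e \in nodes us -> `|e.1| = 1.
Proof.
elim: us e => [|u us IH] e /=; first by rewrite inE => /eqP -> /=; rewrite normr1.
by rewrite mem_cat => /orP[] /mapP[e' /IH he' ->] //=; rewrite normrN.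
Qed.

Lemma nodes_dil B us (k : R) : absconvex B -> 0 <= k -> {in us, forall u, dil k B u} ->
  {in nodes us, forall e, dil ((size us).+1%:R * k) B e.2}.
Proof.
move=> cB k0; elim: us => [|u us IH] Hu e /=.
  by rewrite inE => /eqP -> /=; exact: dil0.
have {}IH := IH (fun v hv => Hu v (mem_behead (s := u :: us) hv)).
rewrite mem_cat => /orP[] /mapP[e' /IH he' ->] /=.
  rewrite mulrSr mulrDl mul1r; apply: dilD => //; first by rewrite mulr_ge0.
  by apply: Hu; rewrite inE eqxx.
by apply: dilS he' => //; rewrite !ger0_norm ?mulr_ge0// ler_wpM2r// ler_nat.
Qed.

Lemma size_nodes us : size (nodes us) = (2 ^ size us)%N.
Proof. by elim: us => [//|u us IH] /=; rewrite size_cat !size_map IH expnS mul2n addnn. Qed.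

Lemma Df_swap f us u v c : Df f (u :: v :: us) c = Df f (v :: u :: us) c.
Proof.
rewrite /= [c + u + v]addrAC !opprB addrACA [in RHS]addrACA.
by congr (_ + _); rewrite addrC.
Qed.

Lemma Df_rem f us u c : u \in us -> Df f (u :: rem u us) c = Df f us c.
Proof.
elim: us c => [//|w us IH] c; rewrite inE /=; have [->//|/= uw uus] := eqVneq u w.
have := Df_swap f (rem u us) u w c => /= ->.
by congr (_ - _); exact: IH.
Qed.

Lemma Df_perm f us vs c : perm_eq us vs -> Df f us c = Df f vs c.
Proof.
elim: us vs c => [|u us IH] vs c; first by move=> /perm_size /esym/size0nil ->.
move=> p; have uv : u \in vs by rewrite -(perm_mem p) inE eqxx.
have := perm_trans p (perm_to_rem uv); rewrite perm_cons => p'.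
by rewrite -(Df_rem _ _ uv) /= !(IH _ _ p').
Qed.

(** The polarisation formula: if [d n c] is the Taylor term of degree n, its iterated difference at
    the origin is the symmetric n-linear derivative, with no factorial left over. The formula makes
    sense before [d n c] is known to be homogeneous. *)
Definition Wf (d : nat -> X -> X -> W) us c : W :=
  \sum_(e <- nodes us) e.1 *: d (size us) c e.2.

Definition tay B f (d : nat -> X -> X -> W) a := forall (n : nat) (k : R), 0 < k ->
  exists2 r : R, 0 < r & exists2 C, 0 <= C & forall c u (h : R),
    around B a r c -> dil k B u -> `|h| <= r ->
    `|f (c + h *: u) - \sum_(j < n.+1) h ^+ j *: d j c u| <= C * `|h| ^+ n.+1.

End Differences.

(** * Coefficients of small polynomials, choice of small steps *)

Section SmallPoly.
Context {R : realType} {W : normedModType R}.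

Lemma norm_sum_le n (F : 'I_n -> W) (G : 'I_n -> R) :
  (forall i, `|F i| <= G i) -> `|\sum_(i < n) F i| <= \sum_(i < n) G i.
Proof. by move=> FG; apply: le_trans (ler_norm_sum _ _ _) _; exact: ler_sum. Qed.

Lemma norm_le_eps0 (w : W) : (forall e : R, 0 < e -> `|w| <= e) -> w = 0.
Proof.
move=> H; apply/eqP; rewrite -normr_le0; apply/ler_addgt0Pr => e e0.
by rewrite add0r; exact: H.
Qed.

(** The constant term is at most [e] plus O(h), hence 0; dividing by [h] lowers the degree. *)
Lemma small_poly0 n (A : nat -> W) :
  (forall e : R, 0 < e -> exists2 r : R, 0 < r & forall h, 0 < h <= r ->
     `|\sum_(j < n.+1) h ^+ j *: A j| <= e * h ^+ n) ->
  forall j, (j < n.+1)%N -> A j = 0.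
Proof.
elim: n A => [|n IH] A H.
  case=> // _; apply: norm_le_eps0 => e e0; have [r r0] := H e e0.
  move=> /(_ r); rewrite r0 lexx => /(_ isT).
  by rewrite big_ord1 expr0 scale1r mulr1.
have A0 : A 0%N = 0.
  apply: norm_le_eps0 => e e0.
  pose M := \sum_(j < n.+1) `|A j.+1| + 1.
  have M0 : 0 < M by rewrite ltr_wpDl// sumr_ge0.
  have [r r0 Hr] := H 1 ltr01.
  pose h := Num.min (Num.min r 1) (e / (M + 1)).
  have h0 : 0 < h by rewrite !lt_min r0 ltr01 divr_gt0// addr_gt0.
  have h0' := ltW h0.
  have h1 : h <= 1 by rewrite /h !ge_min lexx orbT.
  have hr : h <= r by rewrite /h !ge_min lexx.
  have he : h * (M + 1) <= e.
    by rewrite -ler_pdivlMr; [rewrite /h ge_min lexx orbT|rewrite addr_gt0].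
  have := Hr h; rewrite h0 hr mul1r => /(_ isT).
  rewrite big_ord_recl expr0 scale1r => Hh.
  set S := \sum_(i < _) _ in Hh.
  have -> : A 0%N = (A 0%N + S) - S by rewrite addrK.
  apply: le_trans (ler_normB _ _) _; apply: le_trans he.
  rewrite mulrDr mulr1 addrC; apply: lerD; last first.
    by apply: le_trans Hh _; rewrite exprS ler_piMr// exprn_ile1.
  rewrite /M mulrDr mulr1; apply: (@le_trans _ _ (h * \sum_(j < n.+1) `|A j.+1|)); last by rewrite lerDl.
  rewrite mulr_sumr; apply: norm_sum_le => i.
  rewrite normrZ normrX (ger0_norm (ltW h0)) /= /bump leq0n add1n exprS.
  by rewrite -mulrA ler_wpM2l// ler_piMl// exprn_ile1.
move=> [_|j jn]; first exact: A0.
apply: (IH (fun j => A j.+1)) => // e e0.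
have [r r0 Hr] := H e e0; exists r => // h /andP[h0 hr].
have := Hr h; rewrite h0 hr => /(_ isT).
rewrite big_ord_recl A0 scaler0 add0r.
under eq_bigr do rewrite /= /bump leq0n add1n exprS -scalerA.
by rewrite -scaler_sumr normrZ (ger0_norm (ltW h0)) exprS mulrCA ler_pM2l.
Qed.

End SmallPoly.

Section Pick.
Context {R : realType}.

(** Packages the recurrent choice of a step below finitely many thresholds: a pair [(K, e)] asks for
    [x * K <= e]. *)
Lemma pick_small (l : seq (R * R)) : all (fun p => (0 <= p.1) && (0 < p.2)) l ->
  exists2 z : R, 0 < z & forall x, 0 <= x <= z -> all (fun p => x * p.1 <= p.2) l.
Proof.
elim: l => [|[K e] l IH] /=; first by exists 1.
move=> /andP[/andP[K0 e0] /IH[z z0 Hz]].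
have K10 : 0 < K + 1 by rewrite ltr_wpDl.
exists (Num.min z (e / (K + 1))); first by rewrite lt_min z0 divr_gt0.
move=> x /andP[x0]; rewrite le_min => /andP[xz xe]; rewrite Hz ?x0 ?xz// andbT.
by rewrite ler_pdivlMr// in xe; apply: le_trans xe; rewrite ler_wpM2l// lerDl.
Qed.

End Pick.

Lemma norm_sum_seq {R : realType} {W : normedModType R} (I : eqType) (l : seq I)
    (F : I -> W) (C : R) :
  {in l, forall e, `|F e| <= C} -> `|\sum_(e <- l) F e| <= (size l)%:R * C.
Proof.
elim: l => [|x l IH] H; first by rewrite big_nil normr0 mul0r.
rewrite big_cons /= mulrSr mulrDl mul1r addrC; apply: le_trans (ler_normD _ _) _.
apply: lerD; last by apply: H; rewrite inE eqxx.
by apply: IH => e el; apply: H; rewrite inE el orbT.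
Qed.

Section NormTools.
Context {R : realType} {W : normedModType R}.
Implicit Types x y z w : W.

Lemma norm_le_sub x y : `|x| <= `|x - y| + `|y|.
Proof. by rewrite -{1}(subrK y x) ler_normD. Qed.

Lemma norm_le_sub' x y : `|y| <= `|x - y| + `|x|.
Proof. by rewrite distrC; exact: norm_le_sub. Qed.

Lemma norm_sub_sub x y z w : `|x - z| <= `|x - y| + `|z - w| + `|y - w|.
Proof.
rewrite (distrC z w); have := ler_distD y x z; have := ler_distD w y z; lra.
Qed.

Lemma norm_sub_add x y z w : `|x + y - (z + w)| <= `|x - z| + `|y - w|.
Proof. by rewrite opprD addrACA ler_normD. Qed.

Lemma norm_sub_opp x y z w : `|x - y - (z - w)| <= `|x - z| + `|y - w|.
Proof. by apply: le_trans (norm_sub_add x (- y) z (- w)) _; rewrite lerD2l -opprD normrN. Qed.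

End NormTools.

(** * The polarised forms as limits of iterated differences *)

Section Mackey.
Context {R : realType} {X : lmodType R} {W : normedModType R}.
Variables (B : set X) (f : X -> W) (d : nat -> X -> X -> W) (a : X).
Hypotheses (cB : absconvex B) (T : tay B f d a).

Lemma tay_lip (k : R) : 0 < k -> exists2 r : R, 0 < r & exists2 C, 0 <= C &
  forall c u (h : R), around B a r c -> dil k B u -> `|h| <= r ->
    `|f (c + h *: u) - f c| <= C * `|h|.
Proof.
move=> k0; have [r r0 [C C0 H]] := T 0 k0.
exists r => //; exists C => // c u h cr uk hr.
(* The value [h = 0] identifies the coefficient [d 0 c u] with [f c]. *)
have := H c u 0 cr uk; rewrite normr0 ltW// => /(_ isT).
rewrite scale0r addr0 big_ord1 expr0 scale1r expr0n mulr0 normr_le0 subr_eq0 => /eqP fc.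
by have := H c u h cr uk hr; rewrite big_ord1 expr0 scale1r -fc expr1.
Qed.

Lemma Df_taylor n (k : R) : 0 < k -> exists2 r : R, 0 < r & exists2 C, 0 <= C &
  forall c us (h : R), around B a r c -> size us = n -> {in us, forall u, dil k B u} ->
    `|h| <= r ->
    `|Df f [seq h *: u | u <- us] c -
      \sum_(j < n.+1) h ^+ j *: (\sum_(e <- nodes us) e.1 *: d j c e.2)| <= C * `|h| ^+ n.+1.
Proof.
move=> k0; have nk0 : 0 < n.+1%:R * k by rewrite mulr_gt0.
have [r r0 [C C0 H]] := T n nk0; exists r => //; exists ((2 ^ n)%:R * C).
  by rewrite mulr_ge0.
move=> c us h cr sus uk hr; rewrite DfE.
under [X in _ - X]eq_bigr do rewrite scaler_sumr.
rewrite exchange_big /= -sumrB -mulrA -sus -size_nodes.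
have Hn := nodes_dil cB (ltW k0) uk; have H1 := @nodes_norm R X us.
apply: norm_sum_seq => e eus.
under eq_bigr do rewrite scalerA mulrC -scalerA.
rewrite -scaler_sumr -scalerBr normrZ H1// mul1r sus; apply: H => //.
by rewrite -sus; exact: Hn.
Qed.

Let approx n := forall k : R, 0 < k -> exists2 r : R, 0 < r & exists2 C, 0 <= C &
  forall c us (h : R), around B a r c -> size us = n -> {in us, forall u, dil k B u} ->
    `|h| <= r ->
    `|Df f [seq h *: u | u <- us] c - h ^+ n *: Wf d us c| <= C * `|h| ^+ n.+1.

Let Wcont n := forall k : R, 0 < k -> exists2 r : R, 0 < r &
  forall e : R, 0 < e -> exists2 r' : R, 0 < r' &
  forall c us v (h : R), around B a r c -> size us = n -> {in us, forall u, dil k B u} ->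
    dil k B v -> `|h| <= r' -> `|Wf d us (c + h *: v) - Wf d us c| <= e.

(** At a fixed step [t] the difference is Lipschitz in the base point by [tay_lip], and divided by
    [t ^+ n] it is within O(t) of [Wf]. So [t] is fixed first, according to [e], and the
    displacement [h] is then taken small against [t ^+ n]. *)
Let approx_cont n : approx n -> Wcont n.
Proof.
move=> An k k0; have [r1 r10 [C1 C10 H1]] := An k k0.
have k0' := ltW k0; have nk0 : 0 < n.+1%:R * k by rewrite mulr_gt0.
have nk0' := ltW nk0; have kn : k <= n.+1%:R * k by rewrite ler_peMl ?ler1n.
have [r2 r20 [C2 C20 H2]] := tay_lip nk0.
have [r r0 Hr] := @pick_small R [:: (2, r1); (3, r2)] ltac:(by rewrite /= r10 r20 !ler0n).
have := Hr r; rewrite lexx (ltW r0) => /(_ isT); rewrite /= andbT => /andP[rr1 rr2].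
have r0' := ltW r0.
exists r => // e e0.
have [t t0 Ht] := @pick_small R [:: (1, r); (n.+1%:R * k, r); (4 * C1, e)]
  ltac:(by rewrite /= ?ler01 ?nk0' ?r0 ?e0 mulr_ge0).
have t0' := ltW t0.
have := Ht t; rewrite lexx t0' => /(_ isT); rewrite /= mulr1 andbT => /and3P[tr tr2 tC].
have tn0 : 0 < t ^+ n by rewrite exprn_gt0.
have [q q0 Hq] := @pick_small R [:: (1, r); (k, r); (2 * (2 ^ n)%:R * C2, e * t ^+ n)]
  ltac:(by rewrite /= ?ler01 ?k0' ?r0 ?mulr_gt0// !mulr_ge0).
exists q => // c us v h cr sus uk vk hq.
have := Hq `|h|; rewrite hq normr_ge0 => /(_ isT); rewrite /= mulr1 andbT => /and3P[hr hk hC].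
have ck : around B a (r + r) (c + h *: v) by apply: (around_shift cB (k := k)).
have ch1 : around B a r1 (c + h *: v) by apply: aroundS ck => //; lra.
have c1 : around B a r1 c by apply: aroundS cr => //; lra.
have tt : `|t| = t by rewrite ger0_norm.
have tr1 : t <= r1 by lra.
have E1 := H1 _ us t ch1 sus uk; have E0 := H1 _ us t c1 sus uk; rewrite tt in E1 E0.
move/(_ tr1) : E1 => E1; move/(_ tr1) : E0 => E0.
have E2 : `|Df f [seq t *: u | u <- us] (c + h *: v) - Df f [seq t *: u | u <- us] c|
    <= (2 ^ n)%:R * (C2 * `|h|).
  rewrite !DfE -sumrB -sus -size_nodes; apply: norm_sum_seq => w wus.
  rewrite -scalerBr normrZ (nodes_norm wus) mul1r [c + h *: v + _]addrAC.
  apply: H2; last by apply: (le_trans hr); lra.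
    apply: (@aroundS _ _ _ cB _ (r + r)); [lra|lra|].
    apply: (around_shift cB (k := n.+1%:R * k)); rewrite ?tt//.
    by rewrite -sus; apply: (nodes_dil cB k0' uk).
  by apply: dilS vk => //; rewrite !ger0_norm.
set D1 := Df f _ _ in E1 E2; set D0 := Df f _ _ in E0 E2.
have : `|t ^+ n *: (Wf d us (c + h *: v) - Wf d us c)| <= e * t ^+ n.
  have -> : t ^+ n *: (Wf d us (c + h *: v) - Wf d us c) =
    - (D1 - t ^+ n *: Wf d us (c + h *: v)) + (D1 - D0) + (D0 - t ^+ n *: Wf d us c).
    by rewrite scalerBr opprB !addrA !subrK.
  apply: le_trans (ler_normD _ _) _; apply: le_trans (lerD (ler_normD _ _) (lexx _)) _.
  rewrite normrN.
  have e3 : 4 * (C1 * t ^+ n.+1) <= e * t ^+ n.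
    by rewrite exprS (_ : 4 * (C1 * (t * t ^+ n)) = t * (4 * C1) * t ^+ n); [rewrite ler_pM2r|ring].
  have e4 : 2 * ((2 ^ n)%:R * (C2 * `|h|)) <= e * t ^+ n.
    by apply: le_trans hC; rewrite le_eqVlt; apply/orP; left; apply/eqP; ring.
  lra.
by rewrite normrZ ger0_norm ?(ltW tn0)// mulrC ler_pM2r.
Qed.

(** By [Df_taylor] a difference of order n+1 is a polynomial in the step plus O(h^(n+2)); its terms
    below degree n+1 have to vanish. It is also the increment of a difference of order n between [c]
    and [c + s *: u]; the induction hypothesis and the continuity of the form of order n make it
    o(s^n), so [small_poly0] applies. *)
Lemma Wf_approx n : approx n.
Proof.
elim: n => [|n IH] k k0.
  have [r r0 [C C0 H]] := Df_taylor 0 k0; exists r => //; exists C => // c us h cr sus uk hr.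
  have := H c us h cr sus uk hr; rewrite big_ord1.
  by rewrite (size0nil sus).
have [r r0 [C C0 H]] := Df_taylor n.+1 k0.
have [r1 r10 [C1 C10 H1]] := IH _ k0.
have [r2 r20 H2] := approx_cont IH k0.
have [q q0 Hq] := @pick_small R [:: (1, r); (2, r1); (1, r2)]
  ltac:(by rewrite /= r0 r10 r20 ?ler01 ?ler0n).
have k0' := ltW k0; have q0' := ltW q0.
have := Hq q; rewrite lexx q0' => /(_ isT); rewrite /= mulr1 andbT => /and3P[qr qr1 qr2].
exists q => //; exists C => // c us h cq sus uk hq.
have cr : around B a r c by apply: aroundS cq.
have := H c us h cr sus uk (le_trans hq qr).
rewrite big_ord_recr /=; have <- : Wf d us c = \sum_(e <- nodes us) e.1 *: d n.+1 c e.2.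
  by rewrite /Wf sus.
rewrite big1 ?add0r// => j _.
suff H0 : forall j, (j < n.+1)%N -> \sum_(e <- nodes us) e.1 *: d j c e.2 = 0.
  by rewrite H0 ?scaler0.
apply: small_poly0 => e e0.
have e20 : 0 < e / 2 by lra.
case: us sus uk => // u us [sus] uk.
have uu : dil k B u by apply: uk; rewrite inE eqxx.
have usk : {in us, forall u, dil k B u} by move=> v vus; apply: uk; rewrite inE vus orbT.
have [r3 r30 H3] := H2 _ e20.
set Q : W := \sum_(e <- nodes (u :: us)) e.1 *: d n.+1 c e.2.
have [t t0 Ht] := @pick_small R [:: (1, r); (1, r1); (1, r3); (k, q); (1, 1); (4 * (C1 + C + `|Q|), e)]
  ltac:(by rewrite /= ?k0' ?r0 ?r10 ?r30 ?q0 ?e0 ?ltr01 ?ler01 mulr_ge0// !addr_ge0).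
exists t => // s /andP[s0 st]; have s0' := ltW s0.
have := Ht s; rewrite st s0' => /(_ isT) /=; rewrite !mulr1 andbT.
move=> /and5P[sr sr1 sr3 sq /andP[s1 sC]].
have ss : `|s| = s by rewrite ger0_norm.
have c1 : around B a r1 c by apply: aroundS cq => //; lra.
have cs1 : around B a r1 (c + s *: u).
  apply: (@aroundS _ _ _ cB _ (q + q)); [lra|lra|].
  by apply: (around_shift cB (k := k)); rewrite ?ss.
have c2 : around B a r2 c by apply: aroundS cq.
have := H c (u :: us) s cr; rewrite /= sus ss => /(_ erefl uk sr).
rewrite big_ord_recr -[\sum_(e <- _) _ *: d (Ordinal _) _ _]/Q /=.
set S := \sum_(j < n.+1) _ => HS.
have := H1 _ us s cs1 sus usk; rewrite ss => /(_ sr1) HA.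
have := H1 _ us s c1 sus usk; rewrite ss => /(_ sr1) HB.
have := H3 c us u s c2 sus usk uu; rewrite ss => /(_ sr3) HC.
set D1 := Df f _ (c + _) in HS HA; set D0 := Df f _ c in HS HB.
set W1 := Wf d us (c + _) in HA HC; set W0 := Wf d us c in HB HC.
set x := _ *: Q in HS; set y := _ *: W1 in HA; set z := _ *: W0 in HB.
have h1 : `|S| <= `|S + x| + `|x| by have := norm_le_sub' (S + x) S; rewrite addrAC subrr add0r addrC.
have h2 := norm_le_sub' (D1 - D0) (S + x).
have h3 := norm_sub_sub D1 y D0 z.
have h4 : `|x| = s * `|Q| * s ^+ n by rewrite normrZ normrX ss exprS mulrAC.
have h5 : `|y - z| <= s ^+ n * (e / 2).
  by rewrite /y /z -scalerBr normrZ normrX ss ler_wpM2l// exprn_ge0.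
have h6 : (s * `|Q| + C * s ^+ 2 + 2 * C1 * s) * s ^+ n <= (e / 2) * s ^+ n.
  rewrite ler_wpM2r ?exprn_ge0//.
  have : C * s ^+ 2 <= C * s by rewrite ler_wpM2l// expr2 ler_piMr.
  have := mulr_ge0 s0' (normr_ge0 Q); have := mulr_ge0 C0 s0'; lra.
rewrite !exprS in HS HA HB h6; rewrite expr0 mulr1 in h6; lra.
Qed.

Lemma Wf_cont n : Wcont n.
Proof. exact/approx_cont/Wf_approx. Qed.

End Mackey.

Lemma expn_bound0 {R : realType} {W : normedModType R} (w : W) n :
  (forall e : R, 0 < e -> exists2 r : R, 0 < r & forall h, 0 < h <= r ->
     `|h ^+ n *: w| <= e * h ^+ n) -> w = 0.
Proof.
move=> H; apply: norm_le_eps0 => e e0; have [r r0 /(_ r)] := H e e0.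
rewrite r0 lexx normrZ ger0_norm ?exprn_ge0 ?(ltW r0)// => /(_ isT).
by rewrite mulrC ler_pM2r ?exprn_gt0.
Qed.

Lemma Df_telescope {R : realType} {X : lmodType R} {W : normedModType R} (f : X -> W)
    us u c (N : nat) :
  Df f us (c + N%:R *: u) - Df f us c = \sum_(i < N) Df f (u :: us) (c + i%:R *: u).
Proof.
elim: N => [|N IH]; first by rewrite scale0r addr0 subrr big_ord0.
rewrite big_ord_recr -IH /= mulrSr scalerDl scale1r addrA.
by rewrite [RHS]addrC addrA subrK.
Qed.

(** * Symmetry, multilinearity and polarisation at the base point *)

Section MackeyAt.
Context {R : realType} {X : lmodType R} {W : normedModType R}.
Variables (B : set X) (f : X -> W) (d : nat -> X -> X -> W) (a : X).
Hypotheses (cB : absconvex B) (T : tay B f d a).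
Variable k : R.
Hypothesis k0 : 0 < k.
Implicit Types us vs : seq X.

(** At a fixed step [t] the form is within O(t) of [t ^- n] times a signed sum of values of [f], and
    these are bounded near [a]. *)
Lemma Wf_bound n : exists2 r : R, 0 < r & exists2 C, 0 <= C &
  forall c us, around B a r c -> size us = n -> {in us, forall u, dil k B u} ->
    `|Wf d us c| <= C.
Proof.
have nk0 : 0 < n.+1%:R * k by rewrite mulr_gt0.
have [r1 r10 [C1 C10 H1]] := Wf_approx cB T n k0.
have [r2 r20 [C2 C20 H2]] := tay_lip T ltr01.
have k0' := ltW k0; have nk0' := ltW nk0.
have [t t0 Ht] := @pick_small R [:: (1, r1); (2, r2); (2 * (n.+1%:R * k), r2)]
  ltac:(by rewrite /= r10 r20 ?ler0n ?ler01 !mulr_ge0).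
have := Ht t; rewrite lexx (ltW t0) => /(_ isT); rewrite /= mulr1 andbT => /and3P[t1 t2 t3].
have t0' := ltW t0; have tt : `|t| = t by rewrite ger0_norm.
have r20' := ltW r20.
exists t => //; exists (((2 ^ n)%:R * (`|f a| + C2 * r2) + C1 * t ^+ n.+1) / t ^+ n).
  by rewrite divr_ge0 ?addr_ge0 ?mulr_ge0 ?addr_ge0 ?mulr_ge0 ?exprn_ge0.
move=> c us ct sus uk.
have c1 : around B a r1 c by apply: aroundS ct.
have := H1 _ us t c1 sus uk; rewrite tt => /(_ t1) H.
rewrite ler_pdivlMr ?exprn_gt0// mulrC -{1}[t ^+ n]ger0_norm ?exprn_ge0// -normrZ.
apply: le_trans (norm_le_sub' (Df f [seq t *: u | u <- us] c) _) _.
rewrite addrC; apply: lerD => //.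
rewrite DfE -sus -size_nodes; apply: norm_sum_seq => w wus.
rewrite normrZ (nodes_norm wus) mul1r.
(* Each node is reached from [a] by one step of length [r2] along some [b] in [B], so [tay_lip]
   bounds [f] there. *)
have [b Bb] : around B a r2 (c + t *: w.2).
  apply: (@aroundS _ _ _ cB _ (t + t * (n.+1%:R * k))); [by rewrite addr_ge0// mulr_ge0|lra|].
  apply: (around_shift cB (k := n.+1%:R * k)); rewrite ?tt//.
  by rewrite -sus; apply: (nodes_dil cB k0' uk).
move=> /eqP; rewrite subr_eq [_ + a]addrC => /eqP ->.
have b1 : dil 1 B b by exists b; rewrite ?scale1r.
have := H2 a b r2 (around0 cB a r2) b1; rewrite (ger0_norm r20') lexx => /(_ isT) Hb.
by apply: le_trans (norm_le_sub _ (f a)) _; rewrite [leRHS]addrC lerD2r.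
Qed.

Lemma approx_at us : {in us, forall u, dil k B u} ->
  exists2 r : R, 0 < r & exists2 C, 0 <= C & forall h : R, `|h| <= r ->
    `|Df f [seq h *: u | u <- us] a - h ^+ size us *: Wf d us a| <= C * `|h| ^+ (size us).+1.
Proof.
move=> uk; have [r r0 [C C0 H]] := Wf_approx cB T (size us) k0.
by exists r => //; exists C => // h hr; apply: H => //; exact: around0.
Qed.

Lemma Wf_perm us vs : {in us, forall u, dil k B u} -> perm_eq us vs -> Wf d us a = Wf d vs a.
Proof.
move=> uk p; have sz := perm_size p.
have vk : {in vs, forall u, dil k B u} by move=> v; rewrite -(perm_mem p); exact: uk.
have [r1 r10 [C1 C10 H1]] := approx_at uk; have [r2 r20 [C2 C20 H2]] := approx_at vk.
apply/eqP; rewrite -subr_eq0; apply/eqP; apply: (@expn_bound0 _ _ _ (size us)) => e e0.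
have [r r0 Hr] := @pick_small R [:: (1, r1); (1, r2); (C1 + C2, e)]
  ltac:(by rewrite /= r10 r20 e0 ?ler01 addr_ge0).
exists r => // h /andP[h0 hr]; have h0' := ltW h0.
have := Hr h; rewrite h0' hr => /(_ isT); rewrite /= !mulr1 andbT => /and3P[h1 h2 h3].
have hh : `|h| = h by rewrite ger0_norm.
have := H1 h; rewrite hh => /(_ h1) E1.
have := H2 h; rewrite hh -sz => /(_ h2) E2.
have E : Df f [seq h *: u | u <- us] a = Df f [seq h *: u | u <- vs] a.
  by apply: Df_perm; exact: perm_map.
rewrite scalerBr; apply: le_trans (ler_distD (Df f [seq h *: u | u <- us] a) _ _) _.
rewrite distrC {2}E; apply: le_trans (lerD E1 E2) _.
rewrite -mulrDl exprS mulrA ler_wpM2r ?exprn_ge0//. by rewrite mulrC.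
Qed.

(** The identity [Df (u + v :: us) a = Df (u :: us) (a + v) + Df (v :: us) a] is exact; continuity
    of the form brings the base point [a + h *: v] back to [a]. *)
Lemma Wf_add u v us : dil k B u -> dil k B v -> {in us, forall u, dil k B u} ->
  Wf d (u + v :: us) a = Wf d (u :: us) a + Wf d (v :: us) a.
Proof.
move=> uk vk usk; pose n := size us; have k20 : 0 < 2 * k by rewrite mulr_gt0.
have kk : `|k| <= `|2 * k| by rewrite !ger0_norm ?(ltW k20) ?(ltW k0)//; lra.
have [r1 r10 [C1 C10 H1]] := Wf_approx cB T n.+1 k20.
have [r2 r20 H2] := Wf_cont cB T n.+1 k0.
apply/eqP; rewrite -subr_eq0; apply/eqP; apply: (@expn_bound0 _ _ _ n.+1) => e e0.
have [r3 r30 H3] := H2 (e / 2) (divr_gt0 e0 (ltr0n _ 2)).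
have [r r0 Hr] := @pick_small R [:: (1, r1); (k, r1); (1, r3); (6 * C1, e)]
  ltac:(by rewrite /= r10 (ltW k0) r30 e0 ?ler01 mulr_ge0).
exists r => // h /andP[h0 hr]; have h0' := ltW h0.
have := Hr h; rewrite h0' hr => /(_ isT); rewrite /= !mulr1 andbT => /and4P[h1 h2 h3 h4].
have hh : `|h| = h by rewrite ger0_norm.
have a0 r' := around0 cB a r'.
have mk u' : dil k B u' -> {in u' :: us, forall u, dil (2 * k) B u}.
  by move=> u'k w; rewrite inE => /predU1P[->|/usk]; exact: (dilS cB kk).
have uvk : {in u + v :: us, forall u, dil (2 * k) B u}.
  move=> w; rewrite inE => /predU1P[->|/usk]; last exact: (dilS cB kk).
  by rewrite mulrDl mul1r; apply: dilD => //; exact: ltW.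
have av : around B a r1 (a + h *: v).
  by rewrite -[r1]add0r; apply: (around_shift cB (k := k)) => //; rewrite ?hh// ltW.
have := H1 a (u + v :: us) h (a0 _) erefl uvk; rewrite hh => /(_ h1) E1.
have := H1 _ (u :: us) h av erefl (mk _ uk); rewrite hh => /(_ h1) E2.
have := H1 a (v :: us) h (a0 _) erefl (mk _ vk); rewrite hh => /(_ h1) E3.
have uk' : {in u :: us, forall u, dil k B u} by move=> w; rewrite inE => /predU1P[->|/usk].
have := H3 a (u :: us) v h (a0 _) erefl uk' vk; rewrite hh => /(_ h3) E4.
move: E1 E2 E3 => /=; rewrite scalerDr addrA [a + _ + h *: v]addrAC.
set x := Df f _ (a + h *: v + h *: u); set y := Df f _ (a + h *: v); set z := Df f _ a.
set w1 := Wf d (u + v :: us) a; set w2 := Wf d (u :: us) _ in E4 *.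
set w2' := Wf d (u :: us) a in E4 *; set w3 := Wf d (v :: us) a => E1 E2 E3.
rewrite scalerBr scalerDr; set p := _ *: w1 in E1 *; set q' := _ *: w2'.
set s := _ *: w3 in E3 *; set q := _ *: w2 in E2.
have E5 : `|q - q'| <= h ^+ n.+1 * (e / 2).
  by rewrite -scalerBr normrZ ger0_norm ?exprn_ge0// ler_wpM2l ?exprn_ge0.
have E6 : C1 * h ^+ n.+2 * 6 <= e * h ^+ n.+1.
  by rewrite exprS (_ : C1 * _ * 6 = (h * (6 * C1)) * h ^+ n.+1) ?ler_wpM2r ?exprn_ge0//; ring.
have := norm_sub_add (x - y) (y - z) q' s; rewrite addrA subrK => E7.
have := ler_distD (x - z) p (q' + s); rewrite (distrC p (x - z)).
have := ler_distD q (x - y) q'; lra.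
Qed.

(** Approximating [Wf us] by differences of step [h] leaves an error O(h), as large as the increment
    sought. The displacement [h *: u] is therefore cut into equal steps [t]: the differences
    telescope, each contributes [t ^+ n.+1] times the form of order n+1 at a nearby point, and [t]
    can be made small against [h]. *)
Lemma Wf_der us u : dil k B u -> {in us, forall u, dil k B u} ->
  forall e : R, 0 < e -> exists2 r : R, 0 < r & forall h, `|h| <= r ->
    `|Wf d us (a + h *: u) - Wf d us a - h *: Wf d (u :: us) a| <= e * `|h|.
Proof.
move=> uk usk e e0; pose n := size us.
have [r1 r10 [C1 C10 H1]] := Wf_approx cB T n k0.
have [r2 r20 [C2 C20 H2]] := Wf_approx cB T n.+1 k0.
have [r3 r30 H3] := Wf_cont cB T n.+1 k0.
have [r4 r40 H4] := H3 (e / 2) (divr_gt0 e0 (ltr0n _ 2)).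
have k0' := ltW k0.
have [r r0 Hr] := @pick_small R [:: (1, r1); (1, r2); (k, r1); (k, r2); (1, r4)]
  ltac:(by rewrite /= r10 r20 r40 k0' ?ler01).
exists r => // h hr; have [->|hn0] := eqVneq h 0.
  by rewrite !scale0r addr0 subrr subr0 !normr0 mulr0.
have := Hr `|h|; rewrite normr_ge0 hr => /(_ isT) /=; rewrite !mulr1 andbT.
move=> /and5P[h1 h2 h3 h4 h5]; have ah0 : 0 < `|h| by rewrite normr_gt0.
(* The error of order n+1 is summed over a length [h] and must beat [e]; that of order n occurs only
   at the two ends and must beat [e] times the length of [h]. *)
have [q q0 Hq] := @pick_small R [:: (4 * C2, e); (8 * C1, e * `|h|)]
  ltac:(by rewrite /= !mulr_ge0 ?e0 ?mulr_gt0).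
have [N Nq] : exists N, `|h| / N.+1%:R <= q.
  exists (Num.truncn (`|h| / q)); rewrite ler_pdivrMr ?ltr0n// mulrC -ler_pdivrMr//.
  exact/ltW/truncnS_gt.
pose t : R := h / N.+1%:R; have N0 : (N.+1%:R : R) != 0 by rewrite pnatr_eq0.
have Nt : N.+1%:R * t = h by rewrite /t mulrC divfK.
have at_ : `|t| = `|h| / N.+1%:R by rewrite normrM normfV (ger0_norm (ler0n _ _)).
clearbody t.
have at0 : 0 < `|t| by rewrite at_ divr_gt0// ltr0n.
have Nat : N.+1%:R * `|t| = `|h| by rewrite -[in RHS]Nt normrM normr_nat.
have th : `|t| <= `|h| by rewrite -Nat ler_peMl// ler1n.
have := Hq `|t|; rewrite normr_ge0 at_ Nq -at_ => /(_ isT) /=; rewrite andbT => /andP[q1 q2].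
have a0 r' := around0 cB a r'.
have uk' : {in u :: us, forall u, dil k B u} by move=> w; rewrite inE => /predU1P[->|/usk].
have ar1 : around B a r1 (a + h *: u).
  by rewrite -[r1]add0r; apply: (around_shift cB (k := k)).
have E1 := H1 _ us t ar1 erefl usk (le_trans th h1).
have E2 := H1 a us t (a0 _) erefl usk (le_trans th h1).
set w := Wf d (u :: us) a; set w1 := Wf d us (a + h *: u) in E1 *; set w0 := Wf d us a in E2 *.
set D1 := Df f _ (a + _) in E1; set D0 := Df f _ a in E2.
have E3 : `|D1 - D0 - h *: (t ^+ n *: w)| <= `|h| * (`|t| ^+ n * (C2 * `|t| + e / 2)).
  rewrite /D1 /D0 -{1}Nt -scalerA Df_telescope -{1}Nt -scalerA scaler_nat.
  have sumc (Y : zmodType) (y : Y) : y *+ N.+1 = \sum_(i < N.+1) y by rewrite sumr_const card_ord.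
  rewrite sumc -sumrB; apply: le_trans (ler_norm_sum _ _ _) _.
  rewrite -{1}Nat -mulrA mulr_natl sumc; apply: ler_sum => i _.
  have it : `|i%:R * t| <= `|h|.
    by rewrite normrM normr_nat -Nat ler_wpM2r// ler_nat ltnW.
  have ari : around B a r2 (a + i%:R *: (t *: u)).
    rewrite scalerA -[r2]add0r; apply: (around_shift cB (k := k)) => //.
    by apply: le_trans h4; rewrite ler_wpM2r.
  have F1 := H2 _ (u :: us) t ari erefl uk' (le_trans th h2).
  have F2 := H4 a (u :: us) u (i%:R * t) (a0 _) erefl uk' uk (le_trans it h5).
  have -> : t *: (t ^+ n *: w) = t ^+ n.+1 *: w by rewrite scalerA exprS.
  apply: le_trans (ler_distD (t ^+ n.+1 *: Wf d (u :: us) (a + i%:R *: (t *: u))) _ _) _.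
  rewrite -scalerBr normrZ normrX.
  have -> : `|t| * (`|t| ^+ n * (C2 * `|t| + e / 2)) = C2 * `|t| ^+ n.+2 + `|t| ^+ n.+1 * (e / 2).
    by rewrite !exprS; ring.
  by rewrite -scalerA in F2; apply: lerD; [exact: F1|rewrite ler_wpM2l ?exprn_ge0].
have tn0 : 0 < `|t| ^+ n by rewrite exprn_gt0.
rewrite -(ler_pM2l tn0) -normrX -normrZ !scalerBr scalerA mulrC -scalerA.
have E4 := norm_sub_opp (t ^+ n *: w1) (t ^+ n *: w0) D1 D0.
have E5 := ler_distD (D1 - D0) (t ^+ n *: w1 - t ^+ n *: w0) (h *: (t ^+ n *: w)).
rewrite (distrC _ D1) (distrC _ D0) in E4.
have E6 : `|h| * (`|t| * (4 * C2)) * `|t| ^+ n <= `|h| * e * `|t| ^+ n.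
  by rewrite ler_wpM2r ?ler_wpM2l// ltW.
have E7 : `|t| * (8 * C1) * `|t| ^+ n <= e * `|h| * `|t| ^+ n by rewrite ler_wpM2r// ltW.
rewrite !exprS in E1 E2; rewrite [`|t ^+ n|]normrX; lra.
Qed.

(** Differences are not homogeneous, so the claim is read off [Wf_der]: both sides are the
    derivative of [Wf us] along one line, run at speed [l]. *)
Lemma Wf_scale us u (l : R) : dil k B u -> dil k B (l *: u) ->
  {in us, forall u, dil k B u} -> Wf d (l *: u :: us) a = l *: Wf d (u :: us) a.
Proof.
move=> uk luk usk; apply/eqP; rewrite -subr_eq0; apply/eqP.
apply: (@expn_bound0 _ _ _ 1) => e e0; have l1 : 0 < `|l| + 1 by rewrite ltr_wpDl.
have e2 : 0 < e / (`|l| + 1) by rewrite divr_gt0.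
have [r1 r10 H1] := Wf_der uk usk e2; have [r2 r20 H2] := Wf_der luk usk e2.
have [r r0 Hr] := @pick_small R [:: (1, r2); (`|l|, r1)] ltac:(by rewrite /= r10 r20 normr_ge0 ler01).
exists r => // h /andP[h0 hr]; have h0' := ltW h0; have hh : `|h| = h by rewrite ger0_norm.
have := Hr h; rewrite h0' hr => /(_ isT) /=; rewrite mulr1 andbT => /andP[h2 h1].
have := H1 (h * l); rewrite normrM hh => /(_ h1) E1.
have := H2 h; rewrite hh scalerA => /(_ h2) E2.
rewrite expr1 scalerBr scalerA distrC; set w := Wf d us (a + _) - Wf d us a in E1 E2.
apply: le_trans (ler_distD w _ _) _; rewrite distrC; apply: le_trans (lerD E1 E2) _.
by rewrite [h * `|l|]mulrC mulrA -mulrDl -[X in _ * _ + X]mulr1 -mulrDr divfK// gt_eqF.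
Qed.

(* Any centre [a + h *: w0] of the difference may be used, hence the free shift [w0]. *)
Lemma Wf_polar us w0 : {in us, forall u, dil k B u} -> dil k B w0 ->
  Wf d us a = \sum_(e <- nodes us) e.1 *: d (size us) a (w0 + e.2).
Proof.
move=> usk w0k; pose n := size us; have k0' := ltW k0.
have nk0 : 0 < n.+2%:R * k by rewrite mulr_gt0.
have [r1 r10 [C1 C10 H1]] := Wf_approx cB T n k0.
have [r2 r20 [C2 C20 H2]] := T n nk0.
have [r3 r30 H3] := Wf_cont cB T n k0.
(* Coefficients of the difference centred at [a + h *: w0], expanded at [a]; subtracting the known
   leading term in degree n leaves a polynomial that is o(h^n). *)
pose A j := if j == n then \sum_(e <- nodes us) e.1 *: d n a (w0 + e.2) - Wf d us a
            else \sum_(e <- nodes us) e.1 *: d j a (w0 + e.2).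
suff : A n = 0 by rewrite /A eqxx => /eqP; rewrite subr_eq0 => /eqP.
apply: (@small_poly0 _ _ n) => // e e0.
have [r4 r40 H4] := H3 (e / 2) (divr_gt0 e0 (ltr0n _ 2)).
have [r r0 Hr] := @pick_small R [:: (1, r1); (k, r1); (1, r2); (1, r4); (2 * ((2 ^ n)%:R * C2 + C1), e)]
  ltac:(by rewrite /= r10 r20 r40 k0' e0 ?ler01 !mulr_ge0 ?addr_ge0 ?mulr_ge0).
exists r => // h /andP[h0 hr]; have h0' := ltW h0; have hh : `|h| = h by rewrite ger0_norm.
have := Hr h; rewrite h0' hr => /(_ isT) /=; rewrite !mulr1 andbT.
move=> /and5P[h1 h2 h3 h4 h5].
have a0 r' := around0 cB a r'.
have ar1 : around B a r1 (a + h *: w0).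
  by rewrite -[r1]add0r; apply: (around_shift cB (k := k)) => //; rewrite hh.
have := H1 _ us h ar1 erefl usk; rewrite hh => /(_ h1) E1.
have := H4 a us w0 h (a0 _) erefl usk w0k; rewrite hh => /(_ h4) E2.
set D := Df f _ _ in E1; set w1 := Wf d us (a + _) in E1 E2; set w := Wf d us a in E2.
set S := \sum_(j < n.+1) _.
have E3 : `|D - (S + h ^+ n *: w)| <= (2 ^ n)%:R * (C2 * h ^+ n.+1).
  have -> : S + h ^+ n *: w = \sum_(e <- nodes us) e.1 *: \sum_(j < n.+1) h ^+ j *: d j a (w0 + e.2).
    rewrite /S big_ord_recr /= /A eqxx scalerBr addrA subrK.
    under [RHS]eq_bigr do rewrite scaler_sumr.
    rewrite exchange_big big_ord_recr /=; congr (_ + _); last first.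
      by rewrite scaler_sumr; apply: eq_bigr => x _; rewrite !scalerA mulrC.
    apply: eq_bigr => j _; rewrite ltn_eqF// scaler_sumr.
    by apply: eq_bigr => x _; rewrite !scalerA mulrC.
  rewrite /D DfE -sumrB -size_nodes; apply: norm_sum_seq => x xus.
  rewrite -scalerBr normrZ (nodes_norm xus) mul1r -addrA -scalerDr.
  have := H2 a (w0 + x.2) h (a0 _); rewrite hh; apply => //.
  rewrite mulrSr mulrDl mul1r addrC; apply: dilD => //; first by rewrite mulr_ge0.
  by apply: (nodes_dil cB k0' usk).
have E4 : `|h ^+ n *: w1 - h ^+ n *: w| <= h ^+ n * (e / 2).
  by rewrite -scalerBr normrZ ger0_norm ?exprn_ge0// ler_wpM2l ?exprn_ge0.
have E5 := ler_distD D (S + h ^+ n *: w) (h ^+ n *: w); rewrite addrK (distrC _ D) in E5.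
have E6 := ler_distD (h ^+ n *: w1) D (h ^+ n *: w).
have E7 : h * (2 * ((2 ^ n)%:R * C2 + C1)) * h ^+ n <= e * h ^+ n.
  by rewrite ler_wpM2r ?exprn_ge0.
rewrite !exprS in E1 E3; lra.
Qed.

End MackeyAt.

(** * Plots and smooth functions of several variables *)

Section DeriveEps.
Context {R : realType} {V W : normedModType R}.

(** With its converse below, this trades filters for explicit radii, the form in which [Wf_der] and
    the Taylor estimates deliver derivatives. *)
Lemma is_derive_small (f : V -> W) x v w :
  (forall e : R, 0 < e -> exists2 r : R, 0 < r & forall h : R, `|h| <= r ->
    `|f (x + h *: v) - f x - h *: w| <= e * `|h|) -> is_derive x v f w.
Proof.
move=> H.
suff L : h^-1 *: ((f \o shift x) (h *: v) - f x) @[h --> (0:R)^'] --> w.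
  by split; [apply/cvg_ex; exists w|exact: cvg_lim].
apply/cvgrPdist_le => e e0; have [r r0 Hr] := H e e0.
near=> h.
have h0 : h != 0 by near: h; exact: nbhs_dnbhs_neq.
have hr : `|h| <= r.
  by near: h; apply: nbhs_dnbhs; exact: (@nbhs0_le _ R^o _ r0).
have Hh := Hr h hr; rewrite /= [h *: v + x]addrC distrC.
rewrite -[w](scalerK h0) -scalerBr normrZ normfV.
by rewrite ler_pdivrMl ?normr_gt0// mulrC.
Unshelve. all: by end_near. Qed.

Lemma is_derive_smallP (f : V -> W) x v w : is_derive x v f w ->
  forall e : R, 0 < e -> exists2 r : R, 0 < r & forall h : R, `|h| <= r ->
    `|f (x + h *: v) - f x - h *: w| <= e * `|h|.
Proof.
move=> [D <-] e e0; have /cvgrPdist_le /(_ e e0) := D.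
rewrite near_withinE => /nbhs_normP[r /= r0 Hr].
exists (r / 2) => [|h hr]; first by rewrite divr_gt0.
have [->|h0] := eqVneq h 0; first by rewrite !scale0r addr0 subrr subr0 !normr0 mulr0.
have : `|0 - h| < r by rewrite sub0r normrN; apply: (le_lt_trans hr); lra.
move=> /Hr /(_ h0) /=; rewrite [h *: v + x]addrC.
rewrite -{1}[lim _](scalerK h0) -scalerBr normrZ normfV distrC.
by rewrite ler_pdivrMl ?normr_gt0// mulrC.
Qed.

End DeriveEps.

Lemma rV_nbhsP {R : realType} n (z : 'rV[R]_n) (P : set 'rV[R]_n) :
  nbhs z P <-> exists2 r : R, 0 < r & forall y, `|y - z| < r -> P y.
Proof.
split=> [/(@nbhs_normP R 'rV[R]_n z P)[r /= r0 H]|[r r0 H]].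
  by exists r => // y yz; apply: H => /=; rewrite distrC.
by apply/(@nbhs_normP R 'rV[R]_n z P); exists r => // y /=; rewrite distrC; exact: H.
Qed.

(** * Smoothness from an explicit family of derivatives *)

Section SmoothFamily.
Context {R : realType} {n : nat} {W : normedModType R}.

(** The recurring way to compute partials: all candidates are exhibited at once, indexed by words,
    and only one differentiation step has to be checked. *)
Lemma pders_family (O : set 'rV[R]_n) (F : seq 'I_n -> 'rV[R]_n -> W) : open O ->
  (forall l i z, O z -> is_derive z (evec i) (F l) (F (i :: l) z)) ->
  forall l z, O z -> pders l (F [::]) z = F l z.
Proof.
move=> oO H; elim=> [//|i l IH] z Oz /=.
rewrite /partial (near_eq_derive (g := F l)); first by case: (H l i z Oz).
by apply: filterS (open_nbhs_nbhs (conj oO Oz)) => y /IH.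
Qed.

Lemma smooth_family (O : set 'rV[R]_n) (F : seq 'I_n -> 'rV[R]_n -> W) : open O ->
  (forall l i z, O z -> is_derive z (evec i) (F l) (F (i :: l) z)) ->
  (forall l z, O z -> {for z, continuous (F l)}) -> smooth_on O (F [::]).
Proof.
move=> oO H C; split=> // l z Oz; have E := pders_family oO H.
have nE : \forall y \near z, pders l (F [::]) y = F l y.
  by apply: filterS (open_nbhs_nbhs (conj oO Oz)) => y /E.
split=> [i|].
  apply: (near_eq_derivable (f := F l)); last by case: (H l i z Oz).
  by apply: (filterS _ nE) => y ->.
have /(_ _ _) := C l z Oz.
rewrite /prop_for /continuous_at (E _ _ Oz) => Cl.
by apply: cvg_trans Cl; apply: (@near_eq_cvg _ _ (nbhs z)); apply: (filterS _ nE) => y ->.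
Qed.

Lemma pders_local (O : set 'rV[R]_n) (f g : 'rV[R]_n -> W) l : open O ->
  (forall z, O z -> f z = g z) -> forall z, O z -> pders l f z = pders l g z.
Proof.
move=> oO fg; elim: l => [|i l IH] z Oz /=; first exact: fg.
apply: near_eq_derive; by apply: filterS (open_nbhs_nbhs (conj oO Oz)) => y /IH.
Qed.

Lemma smooth_onP (O : set 'rV[R]_n) (f : 'rV[R]_n -> W) : smooth_on O f ->
  (forall l i z, O z -> is_derive z (evec i) (pders l f) (pders (i :: l) f z)) /\
  (forall l z, O z -> {for z, continuous (pders l f)}).
Proof.
move=> [oO H]; split=> [l i z Oz|l z Oz]; last by case: (H l z Oz).
by split; [case: (H l z Oz)|].
Qed.

End SmoothFamily.

(** * Derivatives along affine plots *)

Section AffinePlot.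
Context {R : realType} {X : lmodType R} {W : normedModType R}.
Variables (B : set X) (f : X -> W) (d : nat -> X -> X -> W) (V : set X).
Hypotheses (cB : absconvex B) (T : forall a, V a -> tay B f d a).
Variables (n : nat) (O : set 'rV[R]_n) (p q : 'rV[R]_n -> X) (K : R).
Hypotheses (oO : open O) (OV : forall z, O z -> V (p z)) (K0 : 0 < K).
Hypothesis Hp : forall z h v, p (z + h *: v) = p z + h *: q v.
Hypothesis Hq : forall v, `|v| <= 1 -> dil K B (q v).
Variables us : seq X.
Hypothesis usk : {in us, forall u, dil K B u}.

Let evec1 (i : 'I_n) : `|evec i : 'rV[R]_n| <= 1.
Proof.
rewrite /Num.norm /= mx_normrE; apply: bigmax_le => //= ij _.
by rewrite /evec mxE; case: (_ && _); rewrite ?normr1 ?normr0.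
Qed.

Let Fam l z := Wf d ([seq q (evec i) | i <- l] ++ us) (p z).

Let Fam_dil l : {in [seq q (evec i) | i <- l] ++ us, forall u, dil K B u}.
Proof.
by move=> u; rewrite mem_cat => /orP[/mapP[i _ ->]|/usk//]; exact/Hq/evec1.
Qed.

Let Fam_derive l i z : O z -> is_derive z (evec i) (Fam l) (Fam (i :: l) z).
Proof.
move=> Oz; apply: is_derive_small => e e0.
have qi : dil K B (q (evec i)) by exact/Hq/evec1.
have [r r0 H] := Wf_der cB (T (OV Oz)) K0 qi (@Fam_dil l) e0.
by exists r => // h hr; rewrite /Fam Hp /=; exact: H.
Qed.

Let Fam_cont l z : O z -> {for z, continuous (Fam l)}.
Proof.
move=> Oz; apply/(@cvgrPdist_le _ _ _ (nbhs z)) => e e0.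
have [r r0 H] := Wf_cont cB (T (OV Oz)) (size ([seq q (evec i) | i <- l] ++ us)) K0.
have [r' r'0 H'] := H e e0.
apply/rV_nbhsP; exists r' => // y zy.
have yr : `|y - z| <= r' by exact: ltW.
have [->|yz] := eqVneq y z; first by rewrite subrr normr0 ltW.
have yz0 : `|y - z| != 0 by rewrite normr_eq0 subr_eq0.
have yE : y = z + `|y - z| *: (`|y - z|^-1 *: (y - z)).
  by rewrite scalerA divff// scale1r addrC subrK.
rewrite distrC {1}yE /Fam Hp; apply: H' => //; first exact: around0.
- by apply: Hq; rewrite normrZ normfV normr_id mulVf.
- by rewrite normr_id.
Qed.

(** An affine plot has constant velocities [q (evec i)], so each partial derivative only adds one
    argument to the form. *)
Lemma pders_plot l z : O z ->
  pders l (fun z => Wf d us (p z)) z = Wf d ([seq q (evec i) | i <- l] ++ us) (p z).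
Proof. exact: (pders_family oO Fam_derive). Qed.

Lemma smooth_plot : smooth_on O (fun z => Wf d us (p z)).
Proof. exact: (smooth_family oO Fam_derive Fam_cont). Qed.

End AffinePlot.

(** * Higher derivatives in one variable and Taylor's formula *)

Section Derive1n.
Context {R : realType} {W : normedModType R}.
Implicit Type G : nat -> R -> W.

(** Passes from the one-row matrices in [scurve] to ordinary derivatives of functions of a real
    variable. *)
Lemma scurve_derive1n (k : R -> W) : scurve k ->
  forall n r, is_derive r (1 : R) (k^`(n)) (k^`(n.+1) r).
Proof.
move=> [_ H] n r.
have E l : pders l (fun p : 'rV[R]_1 => k (p ord0 ord0)) = (fun p => k^`(size l) (p ord0 ord0)).
  elim: l => [//|i l IH]; rewrite /= IH; apply/funext => p.
  rewrite /partial /derive /derive1; apply: congr1; apply: (congr1 (fun F => F @ _)).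
  apply/funext => h /=.
  by rewrite !mxE [i]ord1 ?eqxx mulr1.
have := (H (nseq n ord0) (const_mx r) Logic.I).1 ord0.
rewrite E size_nseq => D; split; last by rewrite derive1nS derive1E.
move: D; rewrite /derivable.
have -> // : (fun h : R => h^-1 *: (((fun p : 'rV[R]_1 => derive1n n k (p ord0 ord0)) \o shift (const_mx r))
    (h *: evec ord0) - derive1n n k ((const_mx r : 'rV[R]_1) ord0 ord0))) =
  (fun h : R => h^-1 *: ((derive1n n k \o shift r) (h *: 1) - derive1n n k r)).
by apply/funext => h /=; rewrite !mxE eqxx.
Qed.

Lemma derive1n_witness G (d : R) :
  (forall n r, `|r| < d -> is_derive r (1 : R) (G n) (G n.+1 r)) ->
  forall n r, `|r| < d -> (G 0%N)^`(n) r = G n r.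
Proof.
move=> H; elim=> [//|n IH] r rd; rewrite derive1nS derive1E.
rewrite (near_eq_derive (g := G n)); first by case: (H n r rd).
apply/(@nbhs_normP R R^o); exists (d - `|r|) => /=; first by rewrite subr_gt0.
move=> y /= ry; apply: IH; have := ler_distD r y 0; rewrite !subr0 (distrC y).
by move=> yr; apply: (le_lt_trans yr); rewrite -ltrBrDr.
Qed.

Lemma derive1n_near (f g : R -> W) (d : R) :
  (forall r, `|r| < d -> f r = g r) -> forall n r, `|r| < d -> f^`(n) r = g^`(n) r.
Proof.
move=> fg; elim=> [|n IH] r rd; first exact: fg.
rewrite !derive1nS !derive1E; apply: near_eq_derive.
apply/(@nbhs_normP R R^o); exists (d - `|r|) => /=; first by rewrite subr_gt0.
move=> y /= ry; apply: IH; have := ler_distD r y 0; rewrite !subr0 (distrC y).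
by move=> yr; apply: (le_lt_trans yr); rewrite -ltrBrDr.
Qed.

Lemma is_derive_affine (F : R -> W) (l t x : R) (w : W) :
  is_derive (l * x + t) (1 : R) F w -> is_derive x (1 : R) (fun r => F (l * r + t)) (l *: w).
Proof.
move=> D; apply: is_derive_small => e e0.
have l1 : 0 < `|l| + 1 by rewrite ltr_wpDl.
have [r r0 H] := is_derive_smallP D (divr_gt0 e0 l1).
exists (r / (`|l| + 1)) => [|h]; first by rewrite divr_gt0.
rewrite ler_pdivlMr// => hr.
have := H (h * l); rewrite normrM; have -> : `|h| * `|l| <= r.
  by apply: le_trans hr; rewrite ler_wpM2l// lerDl.
move=> /(_ isT); rewrite scalerA -[(h * l) *: 1]/(h * l * 1) mulr1.
have -> : l * x + t + h * l = l * (x + h *: 1) + t by rewrite -[h *: 1]/(h * 1); ring.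
move=> Hh; apply: le_trans Hh _; rewrite mulrAC ler_pdivrMr//.
by rewrite (mulrC `|h|) mulrA [leRHS]mulrAC; rewrite ler_wpM2r// ler_wpM2l ?lerDl// ltW.
Qed.

End Derive1n.

Section PureDerivative.
Context {R : realType} {X : lmodType R} {W : normedModType R}.
Variables (B : set X) (f : X -> W) (d : nat -> X -> X -> W).
Hypotheses (cB : absconvex B).
Variables (a u : X) (r0 K : R).
Hypotheses (K0 : 0 < K) (uK : dil K B u).
Hypothesis T : forall r, `|r| < r0 -> tay B f d (a + r *: u).

(** The diagonal case, which ties Taylor coefficients defined by one-variable derivatives to the
    polarised form. *)
Lemma derive1n_Wf n r : (forall c, f c = d 0%N c 0) -> `|r| < r0 ->
  (fun r => f (a + r *: u))^`(n) r = Wf d (nseq n u) (a + r *: u).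
Proof.
move=> f0 rr; pose G n r := Wf d (nseq n u) (a + r *: u).
have -> : (fun r => f (a + r *: u)) = G 0%N.
  by apply/funext => x; rewrite /G /Wf big_seq1 /= scale1r f0.
apply: (derive1n_witness (G := G)) rr => {r}n r rr.
apply: is_derive_small => e e0.
have nk : {in nseq n u, forall v, dil K B v} by move=> v; rewrite mem_nseq => /andP[_ /eqP ->].
have [r1 r10 H] := Wf_der cB (T rr) K0 uK nk e0.
exists r1 => // h hr; rewrite /G -[h *: 1]/(h * 1) mulr1 scalerDl addrA; exact: H.
Qed.

End PureDerivative.

Section Taylor.
Context {R : realType}.

Lemma mean_value_bound (E E' : R -> R) (h M : R) :
  (forall r, `|r| <= `|h| -> is_derive r (1 : R) E (E' r)) ->
  (forall r, `|r| <= `|h| -> `|E' r| <= M) -> `|E h - E 0| <= M * `|h|.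
Proof.
move=> D B.
have C a b : - `|h| <= a -> b <= `|h| -> {within `[a, b], continuous E}.
  move=> ha bh; apply: derivable_within_continuous => x.
  rewrite in_itv /= => /andP[ax xb].
  have xh : `|x| <= `|h| by rewrite ler_norml (le_trans ha ax) (le_trans xb bh).
  by case: (D x xh).
have D' a b : - `|h| <= a -> b <= `|h| ->
    forall x, x \in `]a, b[%R -> is_derive x (1 : R) E (E' x).
  move=> ha bh x; rewrite in_itv /= => /andP[ax xb]; apply: D.
  by rewrite ler_norml (le_trans ha (ltW ax)) (le_trans (ltW xb) bh).
have [h0|h0] := leP 0 h.
  have l1 : - `|h| <= 0 by rewrite oppr_le0.
  have l2 : h <= `|h| by rewrite ler_norm.
  have [c] := MVT_segment h0 (D' _ _ l1 l2) (C _ _ l1 l2).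
  rewrite in_itv /= => /andP[c0 ch] ->; rewrite subr0 normrM ler_wpM2r//.
  by apply: B; rewrite !ger0_norm.
have l1 : - `|h| <= h by rewrite ltr0_norm// opprK.
have l2 : (0 : R) <= `|h| by [].
have [c] := MVT_segment (ltW h0) (D' _ _ l1 l2) (C _ _ l1 l2).
rewrite in_itv /= => /andP[ch c0]; rewrite distrC => ->; rewrite sub0r normrM normrN ler_wpM2r//.
by apply: B; rewrite !ler0_norm ?(ltW h0)// lerN2.
Qed.

Lemma norm_pairE (z : R * R) : `|z| = Num.max `|z.1| `|z.2|.
Proof. by []. Qed.

Lemma is_derive_fst {V : normedModType R} (E : V -> R * R) x v w :
  is_derive x v E w -> is_derive x v (fun y => (E y).1) w.1.
Proof.
move=> D; apply: is_derive_small => e e0; have [r r0 H] := is_derive_smallP D e0.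
exists r => // h hr; apply: le_trans (H h hr).
by rewrite [leRHS]norm_pairE le_max lexx.
Qed.

Lemma is_derive_snd {V : normedModType R} (E : V -> R * R) x v w :
  is_derive x v E w -> is_derive x v (fun y => (E y).2) w.2.
Proof.
move=> D; apply: is_derive_small => e e0; have [r r0 H] := is_derive_smallP D e0.
exists r => // h hr; apply: le_trans (H h hr).
by rewrite [leRHS]norm_pairE le_max lexx orbT.
Qed.

Lemma norm_pair_le (z : R * R) (M : R) : `|z.1| <= M -> `|z.2| <= M -> `|z| <= M.
Proof. by move=> h1 h2; rewrite norm_pairE ge_max h1. Qed.

Lemma norm_fst_le (z : R * R) : `|z.1| <= `|z|.
Proof. by rewrite [leRHS]norm_pairE le_max lexx. Qed.

Lemma norm_snd_le (z : R * R) : `|z.2| <= `|z|.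
Proof. by rewrite [leRHS]norm_pairE le_max lexx orbT. Qed.

Lemma mean_value_pair (E E' : R -> R * R) (h M : R) :
  (forall r, `|r| <= `|h| -> is_derive r (1 : R) E (E' r)) ->
  (forall r, `|r| <= `|h| -> `|E' r| <= M) -> `|E h - E 0| <= M * `|h|.
Proof.
move=> D B; apply: norm_pair_le.
  apply: (@mean_value_bound (fun r => (E r).1) (fun r => (E' r).1)) => r rh.
    exact/is_derive_fst/D.
  exact: le_trans (norm_fst_le _) (B _ rh).
apply: (@mean_value_bound (fun r => (E r).2) (fun r => (E' r).2)) => r rh.
  exact/is_derive_snd/D.
exact: le_trans (norm_snd_le _) (B _ rh).
Qed.

Lemma is_derive_scalel (W : normedModType R) (g : R -> R) (w : W) (x g' : R) :
  is_derive x (1 : R) g g' -> is_derive x (1 : R) (fun r => g r *: w) (g' *: w).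
Proof.
move=> D; apply: is_derive_small => e e0.
have w1 : 0 < `|w| + 1 by rewrite ltr_wpDl.
have [r r0 H] := is_derive_smallP D (divr_gt0 e0 w1).
exists r => // h hr; rewrite scalerA -!scalerBl normrZ.
apply: le_trans (ler_wpM2r (normr_ge0 w) (H h hr)) _.
rewrite mulrAC ler_wpM2r// mulrAC ler_pdivrMr// ler_wpM2l ?lerDl//; exact: ltW.
Qed.

Lemma is_derive_expS (j : nat) (x : R) :
  is_derive x (1 : R) (fun r => r ^+ j.+1) (j.+1%:R * x ^+ j).
Proof.
split; first exact: exprn_derivable.
by rewrite exp_derive [_ *: (1 : R)]mulr1.
Qed.

Lemma is_derive_taylor_poly (W : normedModType R) n (c : nat -> W) (r : R) :
  is_derive r (1 : R) (fun r => \sum_(j < n.+1) r ^+ j *: ((j`!)%:R^-1 *: c j))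
    (\sum_(j < n) r ^+ j *: ((j`!)%:R^-1 *: c j.+1)).
Proof.
elim: n => [|n IH].
  rewrite big_ord0; under [X in is_derive _ _ X _]eq_fun do rewrite big_ord1 expr0.
  exact: is_derive_cst.
under [X in is_derive _ _ X _]eq_fun do rewrite big_ord_recr.
rewrite [X in is_derive _ _ _ X]big_ord_recr /=; apply: is_deriveD.
have := is_derive_scalel (((n.+1)`!)%:R^-1 *: c n.+1) (is_derive_expS n r).
suff -> : r ^+ n *: ((n`!)%:R^-1 *: c n.+1) = (n.+1%:R * r ^+ n) *: (((n.+1)`!)%:R^-1 *: c n.+1) by [].
rewrite !scalerA factS natrM invfM; congr (_ *: _).
by rewrite mulrACA divff ?pnatr_eq0// mul1r.
Qed.

(** The remainder vanishes at 0 and its derivative is a remainder of order one less for the shifted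
    family, so the mean value inequality gives the induction step. For values in pairs there is an
    inequality but no mean value point; the factorial in the denominator is given up. *)
Lemma taylor_bound n (G : nat -> R -> R * R) (h C : R) :
  (forall j r, `|r| <= `|h| -> is_derive r (1 : R) (G j) (G j.+1 r)) ->
  (forall r, `|r| <= `|h| -> `|G n.+1 r| <= C) ->
  `|G 0%N h - \sum_(j < n.+1) h ^+ j *: ((j`!)%:R^-1 *: G j 0)| <= C * `|h| ^+ n.+1.
Proof.
elim: n G h => [|n IH] G h D B.
  rewrite big_ord1 expr0 fact0 invr1 !scale1r expr1.
  by apply: mean_value_pair => // r rh; exact: D.
pose E r := G 0%N r - \sum_(j < n.+2) r ^+ j *: ((j`!)%:R^-1 *: G j 0).
have E0 : E 0 = 0.
  rewrite /E big_ord_recl expr0 fact0 invr1 !scale1r big1 ?addr0 ?subrr// => i _.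
  by rewrite exprS mul0r scale0r.
rewrite -/(E h) -[E h]subr0 -E0 exprSr mulrA.
have C0 : 0 <= C by apply: le_trans (B 0 _); rewrite ?normr0.
apply: (@mean_value_pair E (fun r => G 1%N r - \sum_(j < n.+1) r ^+ j *: ((j`!)%:R^-1 *: G j.+1 0))) => r rh.
  by apply: is_deriveB; [exact: D|exact: (is_derive_taylor_poly n.+1 (fun j => G j 0))].
apply: le_trans (_ : C * `|r| ^+ n.+1 <= _); last first.
  by rewrite ler_wpM2l// lerXn2r.
apply: (IH (fun j => G j.+1)) => [j t tr|t tr]; first by apply: D; exact: le_trans rh.
by apply: B; exact: le_trans rh.
Qed.

End Taylor.

Section RowNorm.
Context {R : realType} {n : nat}.
Implicit Types x y : 'rV[R]_n.

Lemma rV_norm_le x (M : R) : 0 <= M -> (forall i, `|x ord0 i| <= M) -> `|x| <= M.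
Proof.
move=> M0 H; rewrite /Num.norm /= mx_normrE; apply: bigmax_le => //= ij _.
by rewrite [ij.1]ord1.
Qed.

Lemma rV_coord_le x i : `|x ord0 i| <= `|x|.
Proof.
rewrite [leRHS]/Num.norm /= mx_normrE.
exact: (le_bigmax _ (fun ij : 'I_1 * 'I_n => `|x ij.1 ij.2|) (ord0, i)).
Qed.

Definition unit_ball : set 'rV[R]_n := [set u | `|u| <= 1].

Lemma absconvex_unit_ball : absconvex unit_ball.
Proof.
split=> [|b b' l m Bb Bb' lm]; first by rewrite /unit_ball /= normr0.
apply: le_trans (ler_normD _ _) _; rewrite !normrZ; apply: le_trans lm.
by apply: lerD; apply: ler_piMr.
Qed.

Lemma dil_unit_ball (k : R) u : 0 < k -> dil k unit_ball u <-> `|u| <= k.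
Proof.
move=> k0; split=> [[b Bb ->]|uk].
  by rewrite normrZ gtr0_norm// ler_piMr// ltW.
exists (k^-1 *: u); last by rewrite scalerA divff ?scale1r// gt_eqF.
by rewrite /unit_ball /= normrZ gtr0_norm ?invr_gt0// ler_pdivrMl// mulr1.
Qed.

End RowNorm.
Arguments unit_ball {R n}.

(** * Taylor expansions of smooth functions on R^n *)

Section DirectionalDerivative.
Context {R : realType} {n : nat}.

Lemma is_derive_line {V W : normedModType R} (g : V -> W) z w (r : R) D :
  is_derive (z + r *: w) w g D -> is_derive r (1 : R) (fun r => g (z + r *: w)) D.
Proof.
move=> H; apply: is_derive_small => e e0; have [r1 r10 H1] := is_derive_smallP H e0.
by exists r1 => // h hr; rewrite -[h *: 1]/(h * 1) mulr1 scalerDl addrA; exact: H1.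
Qed.

(** The increment is split along the path [P] that switches on the coordinates of [w] one at a time;
    on each piece the mean value inequality compares with [Dg m z]. *)
Lemma is_derive_C1 (g : 'rV[R]_n -> R * R) (Dg : 'I_n -> 'rV[R]_n -> R * R) z w :
  (forall q, \forall y \near z, is_derive y (evec q) g (Dg q y)) ->
  (forall q, {for z, continuous (Dg q)}) ->
  is_derive z w g (\sum_q w ord0 q *: Dg q z).
Proof.
move=> H C; apply: is_derive_small => e e0.
have n0 : 0 < n%:R * (`|w| + 1) + 1 by rewrite ltr_wpDl// mulr_ge0// addr_ge0.
pose e' := e / (n%:R * (`|w| + 1) + 1); have e'0 : 0 < e' by rewrite divr_gt0.
have H' : \forall y \near z, forall q, is_derive y (evec q) g (Dg q y) /\ `|Dg q z - Dg q y| <= e'.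
  apply: (@filter_forall _ _ (fun q y => is_derive y (evec q) g (Dg q y) /\ `|Dg q z - Dg q y| <= e') (nbhs z)) => q.
  have /(@cvgrPdist_le _ _ _ (nbhs z))/(_ e' e'0) Cq := C q.
  by apply: filterS2 (H q) Cq => y h1 h2; split.
have [r r0 Hr] := (rV_nbhsP _ _).1 H'.
have w10 : 0 < `|w| + 1 by rewrite ltr_wpDl.
exists (r / 2 / (`|w| + 1)) => [|h]; first by rewrite !divr_gt0.
rewrite ler_pdivlMr// => hr.
have hw : `|h| * `|w| < r.
  by rewrite mulrDr mulr1 in hr; have := normr_ge0 h; lra.
pose P (m : nat) : 'rV[R]_n := z + h *: \row_q (if (q < m)%N then w ord0 q else 0).
have P0 : P 0%N = z.
  rewrite /P (_ : (\row_q _) = 0) ?scaler0 ?addr0//.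
  by apply/rowP => q; rewrite !mxE.
have Pn : P n = z + h *: w.
  by congr (_ + _ *: _); apply/rowP => q; rewrite !mxE ltn_ord.
have PS (m : 'I_n) : P m.+1 = P m + (h * w ord0 m) *: evec m.
  rewrite /P -addrA; congr (_ + _); rewrite -scalerA -scalerDr; congr (_ *: _).
  apply/rowP => q; rewrite !mxE /= ltnS leq_eqVlt val_eqE.
  have [->|qm] := eqVneq q m; first by rewrite ltnn mulr1 add0r.
  by rewrite /= mulr0 addr0.
have -> : g (z + h *: w) - g z = \sum_(m < n) (g (P m.+1) - g (P m)).
  by rewrite -(big_mkord xpredT (fun m => g (P m.+1) - g (P m))) telescope_sumr// Pn P0.
rewrite scaler_sumr -sumrB.
apply: le_trans (_ : \sum_(m < n) (e' * (`|h| * `|w|)) <= _); last first.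
  rewrite sumr_const card_ord -mulr_natl.
  have -> : n%:R * (e' * (`|h| * `|w|)) = e' * `|h| * (n%:R * `|w|) by ring.
  have -> : e * `|h| = e' * `|h| * (n%:R * (`|w| + 1) + 1).
    by rewrite mulrAC /e' divfK// gt_eqF.
  rewrite ler_wpM2l ?mulr_ge0//; first exact: ltW.
  by rewrite mulrDr mulr1 -addrA lerDl addr_ge0.
apply: norm_sum_le => m; rewrite PS scalerA.
pose E t := g (P m + t *: evec m) - t *: Dg m z.
have -> : g (P m + (h * w ord0 m) *: evec m) - g (P m) - (h * w ord0 m) *: Dg m z
   = E (h * w ord0 m) - E 0.
  by rewrite /E !scale0r addr0 subr0 addrAC.
have E' : `|h * w ord0 m| <= `|h| * `|w| by rewrite normrM ler_wpM2l// rV_coord_le.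
have Q t : `|t| <= `|h * w ord0 m| -> `|P m + t *: evec m - z| < r.
  move=> th; apply: le_lt_trans hw; rewrite /P addrAC [z + _]addrC addrK.
  apply: rV_norm_le => [|q]; first by rewrite mulr_ge0.
  rewrite !mxE /=; have [->|qm] := eqVneq q m.
    by rewrite ltnn mulr0 add0r mulr1; exact: le_trans E'.
  rewrite mulr0 addr0 normrM ler_wpM2l//; case: ifP => _; first exact: rV_coord_le.
  by rewrite normr0.
apply: le_trans (_ : e' * `|h * w ord0 m| <= _); last by rewrite ler_wpM2l// ltW.
apply: (@mean_value_pair _ E (fun t => Dg m (P m + t *: evec m) - 1 *: Dg m z)) => t th.
  apply: is_deriveB; last by apply: is_derive_scalel; exact: is_derive_id.
  by apply: is_derive_line; have [] := Hr _ (Q t th) m.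
by rewrite scale1r distrC; have [] := Hr _ (Q t th) m.
Qed.

End DirectionalDerivative.

Section SmoothTaylor.
Context {R : realType} {n : nat}.
Variables (O : set 'rV[R]_n) (f : 'rV[R]_n -> R * R).
Hypothesis sf : smooth_on O f.

Let oO : open O := sf.1.

(** The [i]-th derivative along the constant vector [w]; the accumulator [l] makes it a combination
    of iterated partials of [f]. *)
Fixpoint Dw (i : nat) (w : 'rV[R]_n) (l : seq 'I_n) (y : 'rV[R]_n) : R * R :=
  if i is i'.+1 then \sum_q w ord0 q *: Dw i' w (q :: l) y else pders l f y.

Lemma Dw_derive i w l y : O y -> is_derive y w (Dw i w l) (Dw i.+1 w l y).
Proof.
have [D C] := smooth_onP sf.
move=> Oy; elim: i l => [|i IH] l.
  apply: (@is_derive_C1 _ _ _ (fun q => pders (q :: l) f)) => q; last exact: C.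
  by apply: filterS (open_nbhs_nbhs (conj oO Oy)) => x /(D l q).
rewrite (_ : Dw i.+1 w l = \sum_q (w ord0 q \*: Dw i w (q :: l))); last first.
  by apply/funext => x; rewrite fct_sumE.
by apply: is_derive_sum => q; apply: is_deriveZ; exact: IH.
Qed.

Lemma Dw_bound i l z (k : R) : O z -> exists C : R, \forall y \near z,
  forall w, `|w| <= k -> `|Dw i w l y| <= C.
Proof.
move=> Oz; have [D Cf] := smooth_onP sf; elim: i l => [|i IH] l.
  exists (`|pders l f z| + 1).
  have /(@cvgrPdist_le _ _ _ (nbhs z))/(_ 1 ltr01) := Cf l z Oz.
  apply: filterS => y Hy w _.
  by apply: le_trans (norm_le_sub _ (pders l f z)) _; rewrite distrC [leLHS]addrC lerD2l.
have [C HC] := choice (fun q => IH (q :: l)).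
exists (\sum_q `|k| * C q).
have HF : \forall y \near z, forall q (w : 'rV_n), `|w| <= k -> `|Dw i w (q :: l) y| <= C q.
  exact: (@filter_forall _ _ (fun q y => forall w : 'rV_n, `|w| <= k -> `|Dw i w (q :: l) y| <= C q) (nbhs z) _ HC).
apply: filterS HF => y Hy w wk; apply: norm_sum_le => q.
rewrite normrZ; apply: ler_pM => //; last exact: Hy.
by apply: le_trans (rV_coord_le _ _) _; apply: (le_trans wk); exact: ler_norm.
Qed.

(** Brings smooth functions of several variables under the general machinery, whose [Wf_perm] then
    gives the symmetry of mixed partials. *)
Lemma smooth_tay z : O z ->
  tay unit_ball f (fun j c u => (j`!)%:R^-1 *: Dw j u [::] c) z.
Proof.
move=> Oz m k k0.
have [C HC] := @Dw_bound m.+1 [::] z k Oz.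
have [r r0 Hr] := (rV_nbhsP _ _).1 (filterI HC (open_nbhs_nbhs (conj oO Oz))).
have k10 : 0 < k + 2 by rewrite addr_gt0.
have d0 : 0 < r / (k + 2) by rewrite divr_gt0.
(* The whole segment from [c] stays within [(k + 1) / (k + 2)] times [r] of [z], strictly inside the
   good ball. *)
exists (r / (k + 2)) => //; exists `|C| => // c u h.
rewrite /around /= => /(dil_unit_ball _ d0) cd /(dil_unit_ball _ k0) uk hd.
have Q t : `|t| <= `|h| -> `|c + t *: u - z| < r.
  move=> th; rewrite addrAC; apply: le_lt_trans (ler_normD _ _) _.
  rewrite normrZ; have : `|t| * `|u| <= r / (k + 2) * k.
    by apply: ler_pM => //; exact: le_trans hd.
  have rE : r / (k + 2) * (k + 2) = r by rewrite divfK// gt_eqF.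
  rewrite mulrDr in rE; lra.
have := @taylor_bound _ m (fun j t => Dw j u [::] (c + t *: u)) h `|C|.
rewrite scale0r addr0; apply => [j t th|t th].
  by apply: is_derive_line; apply: Dw_derive; have [] := Hr _ (Q t th).
by apply: le_trans (ler_norm C); have [+ _] := Hr _ (Q t th); apply.
Qed.

End SmoothTaylor.

(** * A smooth bump function *)

Section Bump.
Context {R : realType}.

(** Finite orders are used here because closed formulas for all derivatives of the quotient [step]
    would be unwieldy, while each class is closed under products, composition and inverses. *)
Fixpoint Ck (n : nat) (f : R -> R) : Prop :=
  if n is n'.+1 then (exists2 f' : R -> R, forall x, is_derive x (1 : R) f (f' x) & Ck n' f')
  else continuous f.

Lemma CkW n f : Ck n.+1 f -> Ck n f.
Proof.
elim: n f => [|n IH] f [f' D H]; last by exists f' => //; exact: IH.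
by move=> x; apply: differentiable_continuous; apply/derivable1_diffP; case: (D x).
Qed.

Lemma Ck_cst n (c : R) : Ck n (fun=> c).
Proof.
elim: n c => [|n IH] c /=; first by move=> x; exact: cvg_cst.
by exists (fun=> 0) => //; move=> x; exact: is_derive_cst.
Qed.

Lemma Ck_id n : Ck n (fun x => x).
Proof.
case: n => [|n] /=; first by move=> x; exact: cvg_id.
by exists (fun=> 1); [move=> x; exact: is_derive_id|exact: Ck_cst].
Qed.

Lemma Ck_add n f g : Ck n f -> Ck n g -> Ck n (fun x => f x + g x).
Proof.
elim: n f g => [|n IH] f g /=; first by move=> cf cg x; apply: cvgD; [exact: cf|exact: cg].
move=> [f' Df Hf] [g' Dg Hg]; exists (fun x => f' x + g' x); last exact: IH.
by move=> x; apply: is_deriveD.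
Qed.

Lemma Ck_mul n f g : Ck n f -> Ck n g -> Ck n (fun x => f x * g x).
Proof.
elim: n f g => [|n IH] f g; first by move=> cf cg x; apply: cvgM; [exact: cf|exact: cg].
move=> Hf Hg; have [f' Df Hf'] := Hf; have [g' Dg Hg'] := Hg.
exists (fun x => f x * g' x + g x * f' x).
  by move=> x; exact: is_deriveM.
by apply: Ck_add; apply: IH => //; exact: CkW.
Qed.

Lemma Ck_comp n f g : Ck n f -> Ck n g -> Ck n (fun x => f (g x)).
Proof.
elim: n f g => [|n IH] f g.
  by move=> cf cg x; apply: continuous_comp; [exact: cg|exact: cf].
move=> Hf Hg; have [f' Df Hf'] := Hf; have [g' Dg Hg'] := Hg.
exists (fun x => f' (g x) * g' x).
  by move=> x; exact: is_derive1_comp.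
by apply: Ck_mul => //; apply: IH => //; exact: CkW.
Qed.

Lemma Ck_inv n f : (forall x, f x != 0) -> Ck n f -> Ck n (fun x => (f x)^-1).
Proof.
move=> f0; elim: n => [|n IH] Hf; first by move=> x; apply: cvgV => //; exact: Hf.
have [f' Df Hf'] := Hf; exists (fun x => - 1 * ((f x)^-1 * (f x)^-1) * f' x).
  move=> x; have := is_deriveV (f0 x) (Df x).
  by rewrite -[_ *: _]/(- (f x) ^- 2 * f' x) expr2 invfM mulN1r.
by apply: Ck_mul => //; apply: Ck_mul; [exact: Ck_cst|apply: Ck_mul; exact/IH/CkW].
Qed.

(** Differentiation keeps within the span of this family, which is why the power of 1/x is carried
    along. *)
Definition flat (k : nat) (x : R) := if 0 < x then x^-1 ^+ k * expR (- x^-1) else 0.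

Lemma flat_ge0 k x : 0 <= flat k x.
Proof.
rewrite /flat; case: ifP => // x0.
by rewrite mulr_ge0 ?expR_ge0// exprn_ge0// invr_ge0 ltW.
Qed.

(** The term of degree k+2 of the exponential series beats x^(-k) and leaves x^2, enough for a zero
    derivative at the origin. *)
Lemma flat_le k x : flat k x <= (k.+2)`!%:R * x ^+ 2.
Proof.
rewrite /flat; case: ifP => x0; last by rewrite mulr_ge0// sqr_ge0.
have y0 : 0 <= x^-1 by rewrite invr_ge0 ltW.
have := expR_ge1Dxn k.+1 y0; have e0 := expR_gt0 (x^-1).
rewrite expRN ler_pdivrMr// => h.
apply: (@le_trans _ _ ((k.+2)`!%:R * x ^+ 2 * (x^-1 ^+ k.+2 / (k.+2)`!%:R))); last first.
  by apply: ler_wpM2l; [rewrite mulr_ge0 ?sqr_ge0|apply: (le_trans _ h); rewrite lerDr].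
have K0 : (k.+2)`!%:R != 0 :> R by rewrite pnatr_eq0 -lt0n fact_gt0.
have x0' : x != 0 by rewrite gt_eqF.
rewrite (exprS _ k.+1) (exprS _ k); set Y := x^-1 ^+ k; rewrite le_eqVlt; apply/orP; left; apply/eqP.
by field; rewrite K0.
Qed.

Lemma flat_derive k x : is_derive x (1 : R) (flat k) (flat k.+2 x - k%:R * flat k.+1 x).
Proof.
have [x0|x0] := ltP 0 x; last first.
  have E j : flat j x = 0 by rewrite /flat ltNge x0.
  rewrite !E mulr0 subr0; apply: is_derive_small => e e0.
  have [->|xn0] := eqVneq x 0; last first.
    exists (- x); first by rewrite oppr_gt0 lt_neqAle xn0.
    move=> h hx; rewrite scaler0 subr0 E subr0 /flat [h *: 1]mulr1.
    have : x + h <= 0 by have := ler_norm h; lra.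
    by rewrite ltNge => ->; rewrite normr0 mulr_ge0// ltW.
  have K0 : 0 < (k.+2)`!%:R :> R by rewrite ltr0n fact_gt0.
  exists (e / (k.+2)`!%:R); first by rewrite divr_gt0.
  move=> h; rewrite ler_pdivlMr// => he; rewrite scaler0 subr0 add0r [h *: 1]mulr1.
  rewrite /(flat k 0) ltxx subr0 ger0_norm ?flat_ge0//; apply: le_trans (flat_le _ _) _.
  by rewrite -(ger0_norm (sqr_ge0 h)) normrX expr2 mulrA ler_wpM2r// mulrC.
pose g (y : R) := y^-1 ^+ k * expR (- y^-1).
have D : is_derive x (1 : R) g (flat k.+2 x - k%:R * flat k.+1 x).
  have x0' : x != 0 by rewrite gt_eqF.
  have Di : is_derive x (1 : R) (fun y => y^-1) (- x ^- 2 *: 1).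
    exact: is_deriveV (is_derive_id x 1).
  have De : is_derive x (1 : R) (fun y => expR (- y^-1)) (expR (- x^-1) * (- (- x ^- 2 *: 1))).
    by apply: (@is_derive1_comp _ expR (fun y => - y^-1)); exact: is_deriveN.
  have Dp : is_derive x^-1 (1 : R) (fun y => y ^+ k) (k%:R * x^-1 ^+ k.-1).
    by split; [exact: exprn_derivable|rewrite exp_derive [LHS]mulr1].
  have Dx := @is_derive1_comp _ (fun y => y ^+ k) (fun y => y^-1) _ _ _ Dp Di.
  apply: (is_derive_eq (is_deriveM Dx De)).
  rewrite /flat x0 -![_ *: _]/(_ * _) mulr1 -exprVn /=.
  case: k {g Dp Dx} => [|k]; first by rewrite !mul0r mulr0 addr0 subr0 expr0 mul1r opprK mulrC.
  rewrite /= !exprS; ring.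
have : \forall y \near x, g y = flat k y.
  apply/(@nbhs_normP R R^o); exists x => // y /= xy.
  rewrite /flat; case: ifP => // /negP; case.
  by have := ler_norm (x - y); lra.
by move=> /near_eq_is_derive; apply.
Qed.

Lemma flat_Ck n k : Ck n (flat k).
Proof.
elim: n k => [|n IH] k.
  by move=> x; apply: differentiable_continuous; apply/derivable1_diffP; case: (flat_derive k x).
exists (fun x => flat k.+2 x + (- k%:R) * flat k.+1 x).
  by move=> x; rewrite mulNr; exact: flat_derive.
by apply: Ck_add => //; apply: Ck_mul => //; exact: Ck_cst.
Qed.

Definition step (x : R) := flat 0 x * (flat 0 x + flat 0 (1 - x))^-1.

Lemma step_den x : flat 0 x + flat 0 (1 - x) != 0.
Proof.
have P y : 0 < y -> 0 < flat 0 y by move=> y0; rewrite /flat y0 expr0 mul1r expR_gt0.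
rewrite gt_eqF//; have [x0|x0] := ltP 0 x; first by rewrite ltr_wpDr ?flat_ge0 ?P.
by rewrite ltr_wpDl ?flat_ge0// P//; lra.
Qed.

Lemma step_Ck n : Ck n step.
Proof.
have C1 : Ck n (fun x : R => 1 - x).
  have : Ck n (fun x : R => 1 + (-1) * x).
    by apply: Ck_add; [exact: Ck_cst|apply: Ck_mul; [exact: Ck_cst|exact: Ck_id]].
  by congr (Ck n _); apply/funext => x; rewrite mulN1r.
apply: Ck_mul; first exact: flat_Ck.
apply: Ck_inv; first exact: step_den.
by apply: Ck_add; [exact: flat_Ck|apply: (Ck_comp (flat_Ck n 0) C1)].
Qed.

Lemma step0 x : x <= 0 -> step x = 0.
Proof. by move=> x0; rewrite /step {1}/flat ltNge x0 mul0r. Qed.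

Lemma step1 x : 1 <= x -> step x = 1.
Proof.
move=> x1; have x1' : 1 - x <= 0 by lra.
have := step_den x.
have E : flat 0 (1 - x) = 0 by rewrite /flat ltNge x1'.
by rewrite /step E addr0 => n0; rewrite divff.
Qed.

Lemma step_itv x : 0 <= step x <= 1.
Proof.
have := step_den x; have := flat_ge0 0 x; have := flat_ge0 0 (1 - x) => h1 h2 h3.
have h : 0 < flat 0 x + flat 0 (1 - x) by rewrite lt_neqAle eq_sym h3 addr_ge0.
by rewrite /step divr_ge0 ?addr_ge0// ler_pdivrMr// mul1r lerDl.
Qed.

Lemma bump_ex : exists chi : nat -> R -> R,
  [/\ forall n x, is_derive x (1 : R) (chi n) (chi n.+1 x),
      forall x, `|x| <= 1 / 2 -> chi 0%N x = 1,
      forall x, 0 <= chi 0%N x <= 1 &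
      forall n x, 1 <= `|x| -> chi n x = 0].
Proof.
(* The argument is at least 1 for |x| <= 1/2 and at most 0 for |x| >= 1. *)
pose c (x : R) := step (4 / 3 + (- (4 / 3)) * (x * x)).
have Cc n : Ck n c.
  apply: (Ck_comp (step_Ck n) (g := fun x => 4 / 3 + (- (4 / 3)) * (x * x))).
  apply: Ck_add; first exact: Ck_cst.
  apply: Ck_mul; first exact: Ck_cst.
  by apply: Ck_mul; exact: Ck_id.
have D n f : Ck n.+1 f -> Ck n (derive1 f) /\ forall x, is_derive x (1 : R) f (derive1 f x).
  move=> [f' Df Hf]; have -> : derive1 f = f' by apply/funext => x; rewrite derive1E; case: (Df x).
  by split.
have Dn n m : Ck m (derive1n n c).
  elim: n m => [|n IH] m; first exact: Cc.
  by have [] := D _ _ (IH m.+1).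
exists (fun n => derive1n n c); split.
- by move=> n x; have [_ ] := D _ _ (Dn n 1%N).
- move=> x hx; apply: step1.
  have : x * x <= 1 / 2 * (1 / 2).
    by rewrite -[x * x]ger0_norm ?normrM ?ler_pM// -expr2 sqr_ge0.
  lra.
- by move=> x; exact: step_itv.
have Z x : 1 <= `|x| -> c x = 0.
  move=> hx; apply: step0.
  have : 1 * 1 <= x * x.
    by rewrite -[x * x]ger0_norm ?normrM ?ler_pM// -expr2 sqr_ge0.
  lra.
(* Outside the closed interval the function vanishes locally; the endpoints follow by continuity,
   approached from outside along [x + (r / 2) * x]. *)
suff Zn n x : 1 < `|x| -> derive1n n c x = 0.
  move=> n x; rewrite le_eqVlt => /predU1P[x1|]; last exact: Zn.
  apply/eqP; rewrite -normr_le0; apply/ler_addgt0Pr => e e0; rewrite add0r.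
  have := Dn n 0%N x => /(@cvgrPdist_le _ _ _ (nbhs x))/(_ e e0)/(@nbhs_normP R R^o)[r /= r0 Hr].
  have xn0 : x != 0 by rewrite -normr_gt0 -x1.
  pose y := x + (r / 2) * x.
  have ay : `|y| = 1 + r / 2.
    by rewrite /y -[X in X + _]mul1r -mulrDl normrM -x1 mulr1 ger0_norm//; lra.
  have xy : `|x - y| < r.
    by rewrite /y opprD addrA subrr sub0r normrN normrM -x1 mulr1 ger0_norm; lra.
  by have := Hr y xy; rewrite (Zn n y) ?subr0// ay; lra.
elim: n x => [|n IH] x x1; first by apply: Z; exact: ltW.
rewrite derive1nS derive1E (near_eq_derive (g := fun=> 0)); first exact: derive_cst.
apply/(@nbhs_normP R R^o); exists (`|x| - 1) => /=; first by rewrite subr_gt0.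
move=> y /= xy; apply: IH.
have := ler_distD y x 0; rewrite !subr0; lra.
Qed.

End Bump.

(** * Integrals and test functions *)

Section IntLine.
Context {R : realType}.
Let mu := @lebesgue_measure R.
Implicit Types (h : R -> R) (rho : R).

Definition csupp rho h := continuous h /\ forall t, rho < `|t| -> h t = 0.

Lemma csupp_restrict rho h : csupp rho h -> h \_ `[- rho, rho] = h.
Proof.
move=> [_ h0]; apply/funext => t; rewrite patchE; case: ifPn => //.
rewrite notin_setE /= in_itv /= -ler_norml => /negP; rewrite -ltNge => ?.
by rewrite h0.
Qed.

Lemma csupp_Rintegral rho h : csupp rho h ->
  Rintegral mu setT h = Rintegral mu `[- rho, rho] h.
Proof. by move=> H; rewrite [RHS]Rintegral_mkcond csupp_restrict. Qed.

Lemma csupp_integrable_itv rho h : csupp rho h -> mu.-integrable `[- rho, rho] (EFin \o h).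
Proof.
move=> H; apply: continuous_compact_integrable; first exact: segment_compact.
by apply: continuous_subspaceT; exact: H.1.
Qed.

Lemma csupp_integrable rho h : csupp rho h -> mu.-integrable setT (EFin \o h).
Proof.
move=> H; have : mu.-integrable `[- rho, rho] (EFin \o h) by exact: csupp_integrable_itv.
by rewrite integrable_mkcond//= restrict_EFin csupp_restrict.
Qed.

Lemma csupp_bound rho h (M : R) : 0 <= rho -> csupp rho h -> (forall t, `|h t| <= M) ->
  `|Rintegral mu setT h| <= 2 * rho * M.
Proof.
move=> r0 H hM; rewrite (csupp_Rintegral H).
apply: le_trans (le_normr_Rintegral _ _) _ => //; first exact: csupp_integrable_itv.
apply: le_trans (le_Rintegral (f2 := fun=> M) _ _ _ _) _ => //.
- have : csupp rho (fun t => `|h t|).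
    split=> [t|t tr]; last by rewrite H.2// normr0.
    by apply: (@continuous_comp _ _ _ h (fun x : R => `|x|)); [exact: H.1|exact: norm_continuous].
  exact: csupp_integrable_itv.
- apply: continuous_compact_integrable; first exact: segment_compact.
  by apply: continuous_subspaceT => x; exact: cvg_cst.
rewrite Rintegral_cst//= lebesgue_measure_itv /= lte_fin.
case: ifP => _ /=; first lra.
rewrite mulr0 !mulr_ge0//. exact: le_trans (hM 0). Qed.

Lemma csupp_scale rho h (l : R) : 0 <= rho -> 0 < l -> csupp rho h ->
  l * Rintegral mu setT (fun t => h (l * t)) = Rintegral mu setT h.
Proof.
move=> r0 l0 H; have Hl : csupp (rho / l) (fun t => h (l * t)).
  split=> [t|t]; last first.
    by rewrite ltr_pdivrMr// mulrC -{1}(gtr0_norm l0) -normrM; exact: H.2.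
  by apply: (@continuous_comp _ _ _ (fun t => l * t) h); [exact: mulrl_continuous|exact: H.1].
rewrite (csupp_Rintegral H) (csupp_Rintegral Hl) -RintegralZl//; last exact: csupp_integrable_itv.
rewrite /Rintegral; congr fine.
pose F (t : R) := l * t.
have dF x : is_derive x (1 : R) F l.
  by have := is_deriveZ l (is_derive_id x (1 : R)); rewrite -[_ *: 1]/(l * 1) mulr1.
have F' : F^`()%classic = fun=> l by apply/funext => x; rewrite derive1E; case: (dF x).
have b0 : 0 <= rho / l by rewrite divr_ge0// ltW.
have FE1 : F (- (rho / l)) = - rho by rewrite /F mulrN mulrCA divff ?mulr1// gt_eqF.
have FE2 : F (rho / l) = rho by rewrite /F mulrCA divff ?mulr1// gt_eqF.
have := @integration_by_substitution_increasing R F h (- (rho / l)) (rho / l).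
rewrite FE1 FE2 => ->.
- by apply: eq_integral => x _ /=; rewrite F' /F mulrC.
- lra.
- by move=> x y _ _ xy; rewrite /F ltr_pM2l.
- by rewrite F' => x _; exact: cvg_cst.
- by rewrite F'; exact: is_cvg_cst.
- by rewrite F'; exact: is_cvg_cst.
- split.
  + by move=> x _; case: (dF x).
  + by apply: cvg_at_right_filter; exact: mulrl_continuous.
  + by apply: cvg_at_left_filter; exact: mulrl_continuous.
- by apply: continuous_subspaceT; exact: H.1.
Qed.

End IntLine.

(** * Iterated integrals of Lipschitz functions *)

Section IteratedIntegral.
Context {R : realType} {s : nat}.
Implicit Types (f g : 'rV[R]_s -> R) (x y : 'rV[R]_s) (l : seq 'I_s) (rho K : R).

(** [S] collects the coordinates not yet integrated. The Lipschitz property survives integration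
    over a bounded window with an explicit constant, so every intermediate integrand is continuous
    and integrable. *)
Definition lipsupp (S : pred 'I_s) K rho f :=
  (forall x y, `|f x - f y| <= K * `|x - y|) /\
  (forall x j, S j -> rho < `|x ord0 j| -> f x = 0).

Lemma setc_dist x y i t : `|setc x i t - setc y i t| <= `|x - y|.
Proof.
apply: rV_norm_le => // j; rewrite !mxE; case: eqP => _; first by rewrite subrr normr0.
by have := rV_coord_le (x - y) j; rewrite !mxE.
Qed.

Lemma setc_dist1 x i t t' : `|setc x i t - setc x i t'| <= `|t - t'|.
Proof.
by apply: rV_norm_le => // j; rewrite !mxE; case: eqP => _ //; rewrite subrr normr0.
Qed.

Lemma lip_csupp S K rho f x i : lipsupp S K rho f -> S i ->
  csupp rho (fun t => f (setc x i t)).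
Proof.
move=> [L Z] Si; split=> [t|t tr]; last by apply: (Z _ i) => //; rewrite mxE eqxx.
apply/(@cvgrPdist_le _ _ _ (nbhs t)) => e e0.
have K1 : 0 < `|K| + 1 by rewrite ltr_wpDl.
apply/(@nbhs_normP R R^o); exists (e / (`|K| + 1)) => /=; first by rewrite divr_gt0.
move=> u /= tu; apply: le_trans (L _ _) _.
apply: le_trans (_ : (`|K| + 1) * `|t - u| <= _); last first.
  by rewrite mulrC -ler_pdivlMr// ltW.
apply: le_trans (ler_wpM2r (normr_ge0 _) (ler_norm K)) _.
by apply: ler_pM => //; [rewrite lerDl|exact: setc_dist1].
Qed.

Lemma csupp_sub rho (h1 h2 : R -> R) : csupp rho h1 -> csupp rho h2 ->
  csupp rho (fun t => h1 t - h2 t).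
Proof.
move=> [c1 z1] [c2 z2]; split=> [t|t tr]; last by rewrite z1// z2// subrr.
by apply: cvgB; [exact: c1|exact: c2].
Qed.

Lemma iint_lipsupp f K rho l : 0 <= rho -> lipsupp predT K rho f -> uniq l ->
  lipsupp (fun j => j \notin l) (K * (2 * rho) ^+ size l) rho (iint l f).
Proof.
move=> r0 Lf; elim: l => [_|i l IH /= /andP[il ul]].
  by rewrite expr0 mulr1; split=> [|x j _]; [exact: Lf.1|exact: Lf.2].
have {IH} := IH ul; set g := iint l f; set K' := K * _ => Lg.
have cs x : csupp rho (fun t => g (setc x i t)) by exact: lip_csupp Lg il.
split=> [x y|x j].
  rewrite -RintegralB//; [|exact: csupp_integrable (cs x)|exact: csupp_integrable (cs y)].
  have -> : K * (2 * rho) ^+ (size l).+1 * `|x - y| = 2 * rho * (K' * `|x - y|).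
    by rewrite exprS /K'; ring.
  apply: csupp_bound => //; first exact: csupp_sub.
  move=> t; apply: le_trans (Lg.1 _ _) _; apply: ler_wpM2l; last exact: setc_dist.
  (* The constant [K'] is nonnegative because the estimate holds for two distinct points; they
     differ since the coordinate [i] exists. *)
  have := Lg.1 (const_mx 1 : 'rV_s) 0; rewrite subr0 => h1.
  have n1 : 0 < `|const_mx 1 : 'rV[R]_s|.
    rewrite normr_gt0; apply/eqP => /rowP /(_ i); rewrite !mxE => /eqP.
    by rewrite oner_eq0.
  by rewrite -(pmulr_lge0 _ n1); apply: le_trans h1.
rewrite inE negb_or => /andP[ji jl] xj.
have -> : (fun t => g (setc x i t)) = fun=> 0.
  by apply/funext => t; apply: (Lg.2 _ j jl); rewrite mxE (negPf ji).
by rewrite Rintegral_cst// mul0r.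
Qed.

Lemma iint_bound f K rho l M x : 0 <= rho -> lipsupp predT K rho f -> uniq l ->
  (forall x, `|f x| <= M) -> `|iint l f x| <= (2 * rho) ^+ size l * M.
Proof.
move=> r0 Lf + fM; elim: l x => [x _|i l IH x /= /andP[il ul]]; first by rewrite expr0 mul1r.
rewrite exprS -mulrA; apply: csupp_bound => // [|t]; last exact: IH.
exact: lip_csupp (iint_lipsupp r0 Lf ul) il.
Qed.

Lemma iint_linear f g K K' rho l x (a b : R) : 0 <= rho ->
  lipsupp predT K rho f -> lipsupp predT K' rho g -> uniq l ->
  iint l (fun x => a * f x + b * g x) x = a * iint l f x + b * iint l g x.
Proof.
move=> r0 Lf Lg; elim: l x => [//|i l IH x /= /andP[il ul]].
have cf := lip_csupp x (iint_lipsupp r0 Lf ul) il.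
have cg := lip_csupp x (iint_lipsupp r0 Lg ul) il.
have cm c h : csupp rho h -> csupp rho (fun t => c * h t).
  move=> [ch zh]; split=> [t|t tr]; last by rewrite zh// mulr0.
  by apply: cvgM; [exact: cvg_cst|exact: ch].
rewrite -!RintegralZl//; try exact: csupp_integrable cf; try exact: csupp_integrable cg.
rewrite -RintegralD//; [|exact: csupp_integrable (cm _ _ cf)|exact: csupp_integrable (cm _ _ cg)].
by apply: eq_Rintegral => t _; rewrite IH.
Qed.

Lemma iint_scale f K rho l x (c : R) : 0 <= rho -> 0 < c -> lipsupp predT K rho f -> uniq l ->
  c ^+ size l * iint l (fun x => f (c *: x)) x = iint l f (c *: x).
Proof.
move=> r0 c0 Lf; elim: l x => [x|i l IH x /= /andP[il ul]]; first by rewrite expr0 mul1r.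
have cf := lip_csupp (c *: x) (iint_lipsupp r0 Lf ul) il.
rewrite -(csupp_scale r0 c0 cf) exprS -mulrA; congr (_ * _).
have E t : iint l f (setc (c *: x) i (c * t)) = c ^+ size l * iint l (fun x => f (c *: x)) (setc x i t).
  rewrite IH//; congr (iint l f _); apply/rowP => j; rewrite !mxE.
  by case: eqP.
have cl : 0 < c ^+ size l by rewrite exprn_gt0.
under [in RHS]eq_Rintegral do rewrite E.
rewrite RintegralZl//; apply: (@csupp_integrable _ (rho / c)).
have -> : (fun t => iint l (fun x => f (c *: x)) (setc x i t)) =
    (fun t => (c ^+ size l)^-1 * iint l f (setc (c *: x) i (c * t))).
  by apply/funext => t; rewrite E mulKf// gt_eqF.
split=> [t|t]; last first.
  by rewrite ltr_pdivrMr// mulrC -{1}(gtr0_norm c0) -normrM => tr; rewrite cf.2 ?mulr0.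
apply: cvgM; first exact: cvg_cst.
by apply: (@continuous_comp _ _ _ (fun t => c * t) (fun t => iint l f (setc (c *: x) i t)));
  [exact: mulrl_continuous|exact: cf.1].
Qed.

End IteratedIntegral.

(** * Elementary operations on smooth functions *)

Section SmoothOps.
Context {R : realType} {n : nat}.

Lemma is_derive_scalev {V W : normedModType R} (g : V -> W) x v (c : R) D :
  is_derive x v g D -> is_derive x (c *: v) g (c *: D).
Proof.
move=> H; apply: is_derive_small => e e0.
have c1 : 0 < `|c| + 1 by rewrite ltr_wpDl.
have [r r0 Hr] := is_derive_smallP H (divr_gt0 e0 c1).
exists (r / (`|c| + 1)) => [|h]; first by rewrite divr_gt0.
rewrite ler_pdivlMr// => hr; have := Hr (h * c); rewrite normrM !scalerA.
have -> : `|h| * `|c| <= r by apply: le_trans hr; rewrite ler_wpM2l// lerDl.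
move=> /(_ isT) Hh; apply: le_trans Hh _; rewrite mulrAC ler_pdivrMr//.
by rewrite (mulrC `|h|) mulrA [leRHS]mulrAC ler_wpM2r// ler_wpM2l ?lerDl// ltW.
Qed.

Lemma is_derive_precomp {V V' W : normedModType R} (g : V -> W) (L : V' -> V) x v u D :
  (forall h : R, L (x + h *: v) = L x + h *: u) -> is_derive (L x) u g D ->
  is_derive x v (fun y => g (L y)) D.
Proof.
move=> HL H; apply: is_derive_small => e e0.
have [r r0 Hr] := is_derive_smallP H e0.
by exists r => // h hr; rewrite HL; exact: Hr.
Qed.

Lemma smooth_lin {W : normedModType R} (O : set 'rV[R]_n) (f g : 'rV[R]_n -> W) (a b : R) :
  smooth_on O f -> smooth_on O g ->
  smooth_on O (fun x => a *: f x + b *: g x) /\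
  forall l x, O x -> pders l (fun x => a *: f x + b *: g x) x = a *: pders l f x + b *: pders l g x.
Proof.
move=> sf sg; have oO := sf.1.
have [Df Cf] := smooth_onP sf; have [Dg Cg] := smooth_onP sg.
pose F l x := a *: pders l f x + b *: pders l g x.
have DF l i z : O z -> is_derive z (evec i) (F l) (F (i :: l) z).
  move=> Oz; apply: is_deriveD; apply: is_deriveZ; [exact: Df|exact: Dg].
have CF l z : O z -> {for z, continuous (F l)}.
  move=> Oz; apply: (@cvgD _ _ _ (nbhs z)); apply: (@cvgZr _ _ _ (nbhs z)).
    exact: Cf.
  exact: Cg.
by split; [exact: (smooth_family (F := F))|exact: (pders_family (F := F))].
Qed.

Lemma smooth_scale {W : normedModType R} (f : 'rV[R]_n -> W) (c : R) :
  smooth_on setT f -> smooth_on setT (fun x => f (c *: x)) /\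
  forall l x, pders l (fun x => f (c *: x)) x = c ^+ size l *: pders l f (c *: x).
Proof.
move=> sf; have [Df Cf] := smooth_onP sf.
pose F l x := c ^+ size l *: pders l f (c *: x).
have oT : open (setT : set 'rV[R]_n) := openT.
have F0 : F [::] = fun x => f (c *: x) by apply/funext => x; rewrite /F expr0 scale1r.
have DF l i z : setT z -> is_derive z (evec i) (F l) (F (i :: l) z).
  move=> _; rewrite /F /= exprSr -scalerA; apply: is_deriveZ.
  apply: (is_derive_precomp (u := c *: evec i)).
    by move=> h; rewrite scalerDr !scalerA mulrC.
  by apply: is_derive_scalev; exact: Df.
have CF l z : setT z -> {for z, continuous (F l)}.
  move=> _; apply: (@cvgZr _ _ _ (nbhs z)).
  have Cc : {for z, continuous (fun x : 'rV[R]_n => c *: x)} by exact: scaler_continuous.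
  exact: (continuous_comp Cc (Cf l (c *: z) Logic.I)).
rewrite -F0; split; first exact: smooth_family oT DF CF.
by move=> l x; exact: (pders_family oT DF).
Qed.

End SmoothOps.

(** * Test functions, their integrals and rescaling *)

Section TestFunctions.
Context {R : realType} {s : nat}.
Implicit Types (f g : @tfun R s) (rho : R).

Definition vanish rho f := forall xi : 'rV[R]_s, rho < `|xi| -> f xi = 0.

Lemma compact_norm_bound n (L : set 'rV[R]_n) : compact L ->
  exists2 rho : R, 0 <= rho & forall x, L x -> `|x| <= rho.
Proof.
move=> /compact_bounded [M [_ HM]]; exists (`|M| + 1); first by rewrite addr_ge0.
by move=> x Lx; apply: HM => //; rewrite (le_lt_trans (ler_norm M))// ltrDl.
Qed.

Lemma closed_norm_ball n (z : 'rV[R]_n) rho : closed [set x : 'rV[R]_n | `|x - z| <= rho].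
Proof.
have := @closed_closed_ball_ R 'rV[R]_n z rho.
by congr (closed _); apply/funext => x; rewrite /closed_ball_ /= distrC.
Qed.

Lemma compact_norm_ball n (z : 'rV[R]_n) rho : compact [set x : 'rV[R]_n | `|x - z| <= rho].
Proof.
apply: bounded_closed_compact; last exact: closed_norm_ball.
exists (rho + `|z|); split; first exact: num_real.
move=> M Mr x /= xr; rewrite -(subrK z x); apply: le_trans (ler_normD _ _) _.
by apply: ltW; apply: le_lt_trans Mr; rewrite lerD2r.
Qed.

Lemma supp_vanish f rho : vanish rho f <-> (forall xi, supp f xi -> `|xi| <= rho).
Proof.
split=> [v xi|H xi xr]; last first.
  apply/eqP; apply: contraTT xr => fn0; rewrite -leNgt; apply: H.
  exact: subset_closure.
have /closure_id cl := @closed_norm_ball s 0 rho.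
have S : [set xi | f xi != 0] `<=` [set x : 'rV[R]_s | `|x - 0| <= rho].
  by move=> x /=; rewrite subr0; apply: contraNT; rewrite -ltNge => /v ->.
by move=> /(closure_subset S); rewrite -cl /= subr0.
Qed.

Lemma testfun_vanish f : testfun f -> exists2 rho : R, 0 <= rho & vanish rho f.
Proof.
move=> [_ /compact_norm_bound[rho r0 H]]; exists rho => //; exact/supp_vanish.
Qed.

Lemma vanish_testfun f rho : smooth_on setT f -> vanish rho f -> testfun f.
Proof.
move=> sf /supp_vanish H; split=> //; apply: bounded_closed_compact.
  exists rho; split; first exact: num_real.
  by move=> M Mr x /H xr; apply: (le_trans xr); exact: ltW.
exact: closed_closure.
Qed.

Lemma open_norm_gt rho : open [set x : 'rV[R]_s | rho < `|x|].
Proof.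
have := closed_openC (@closed_norm_ball s 0 rho); congr (open _).
apply/seteqP; split=> x /=; rewrite subr0; first by move/negP; rewrite -ltNge.
by move=> xr; apply/negP; rewrite -ltNge.
Qed.

Lemma pders_zero n {W : normedModType R} (l : seq 'I_n) :
  pders l (fun _ : 'rV[R]_n => 0 : W) = fun=> 0.
Proof.
elim: l => [//|i l IH] /=; rewrite IH; apply/funext => x; exact: derive_cst.
Qed.

Lemma vanish_pders f rho l : vanish rho f -> vanish rho (pders l f).
Proof.
move=> v xi xr; rewrite (@pders_local _ _ _ [set x : 'rV[R]_s | rho < `|x|] f (fun=> 0))//.
  by rewrite pders_zero.
exact: open_norm_gt.
Qed.

Lemma testfun_bound f l : testfun f -> exists2 M : R, 0 <= M & forall xi, `|pders l f xi| <= M.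
Proof.
move=> tf; have [rho r0 v] := testfun_vanish tf.
have [D C] := smooth_onP tf.1.
have : compact [set pders l f x | x in [set x : 'rV[R]_s | `|x - 0| <= rho]].
  apply: continuous_compact; last exact: compact_norm_ball.
  by apply: continuous_subspaceT => x; exact: C.
move=> /compact_bounded [M [_ HM]]; exists (`|M| + 1); first by rewrite addr_ge0.
move=> xi; have [xr|xr] := leP `|xi| rho; last by rewrite (vanish_pders l v xr) normr0 addr_ge0.
apply: (HM (`|M| + 1)); first by rewrite (le_lt_trans (ler_norm M))// ltrDl.
by exists xi => //=; rewrite subr0.
Qed.

Lemma testfun_lip f : testfun f ->
  exists K : R, forall x y, `|f x - f y| <= K * `|x - y|.
Proof.
move=> tf; have [D C] := smooth_onP tf.1.
have [M HM] := choice (fun q : 'I_s => let: ex_intro2 M _ H := testfun_bound [:: q] tf in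
  ex_intro (fun M => forall xi, `|pders [:: q] f xi| <= M) M H).
exists (\sum_q M q) => x y.
have := @mean_value_pair _ (fun t : R => f (y + t *: (x - y)))
  (fun t => \sum_q (x - y) ord0 q *: pders [:: q] f (y + t *: (x - y))) 1
  (\sum_q `|x - y| * M q).
rewrite scale1r scale0r addr0 normr1 mulr1 [y + _]addrC subrK mulr_suml => H.
apply: le_trans (H _ _) _ => [t _|t _|].
- apply: is_derive_line; apply: (is_derive_C1 (Dg := fun q => pders [:: q] f)) => q.
    by apply: filterE => z; exact: (D [::] q).
  exact: C.
- by apply: norm_sum_le => q; rewrite normrZ ler_pM// rV_coord_le.
- by apply: ler_sum => q _; rewrite mulrC.
Qed.

Lemma testfun_lipsupp f rho : testfun f -> vanish rho f -> exists K,
  lipsupp predT K rho (fun x => (f x).1) /\ lipsupp predT K rho (fun x => (f x).2).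
Proof.
move=> tf v; have [K HK] := testfun_lip tf; exists K.
split; split=> [x y|x j _ xj].
- exact: le_trans (norm_fst_le (f x - f y)) (HK x y).
- by rewrite v// (lt_le_trans xj (rV_coord_le x j)).
- exact: le_trans (norm_snd_le (f x - f y)) (HK x y).
- by rewrite v// (lt_le_trans xj (rV_coord_le x j)).
Qed.

Lemma vanishS f rho rho' : rho <= rho' -> vanish rho f -> vanish rho' f.
Proof. by move=> rr v xi xr; apply: v; exact: le_lt_trans xr. Qed.

Lemma testfun_lin f g (a b : R) : testfun f -> testfun g ->
  testfun (a *: f + b *: g : @tfun R s).
Proof.
move=> tf tg; have [r1 r10 v1] := testfun_vanish tf; have [r2 r20 v2] := testfun_vanish tg.
apply: (@vanish_testfun _ (Num.max r1 r2)).
  by have [] := smooth_lin a b tf.1 tg.1.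
move=> xi xr; have h1 : r1 < `|xi| by apply: le_lt_trans xr; rewrite le_max lexx.
have h2 : r2 < `|xi| by apply: le_lt_trans xr; rewrite le_max lexx orbT.
by rewrite -[LHS]/(a *: f xi + b *: g xi) v1// v2// !scaler0 addr0.
Qed.

Lemma cint_lin f g (a b : R) : testfun f -> testfun g ->
  cint (a *: f + b *: g : @tfun R s) = a *: cint f + b *: cint g.
Proof.
move=> tf tg; have [r1 r10 v1] := testfun_vanish tf; have [r2 r20 v2] := testfun_vanish tg.
have m1 : r1 <= Num.max r1 r2 by rewrite le_max lexx.
have m2 : r2 <= Num.max r1 r2 by rewrite le_max lexx orbT.
have m0 : 0 <= Num.max r1 r2 by exact: le_trans m1.
have [K1 [L1 L2]] := testfun_lipsupp tf (vanishS m1 v1).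
have [K2 [L3 L4]] := testfun_lipsupp tg (vanishS m2 v2).
rewrite /cint /intRs; congr (_, _).
  exact: (iint_linear 0 a b m0 L1 L3 (enum_uniq _)).
exact: (iint_linear 0 a b m0 L2 L4 (enum_uniq _)).
Qed.

Lemma cint_bound f rho M : 0 <= rho -> testfun f -> vanish rho f -> (forall xi, `|f xi| <= M) ->
  `|cint f| <= (2 * rho) ^+ s * M.
Proof.
move=> r0 tf v fM; have [K [L1 L2]] := testfun_lipsupp tf v.
have e : size (enum 'I_s) = s by rewrite size_enum_ord.
have -> : (2 * rho) ^+ s = (2 * rho) ^+ size (enum 'I_s) by rewrite e.
apply: norm_pair_le => /=; rewrite /intRs.
  by apply: (iint_bound _ r0 L1 (enum_uniq _)) => x; exact: le_trans (norm_fst_le _) (fM x).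
by apply: (iint_bound _ r0 L2 (enum_uniq _)) => x; exact: le_trans (norm_snd_le _) (fM x).
Qed.

Lemma pders_Seps eps f l xi : testfun f ->
  pders l (Seps eps f) xi = (eps ^- s * eps^-1 ^+ size l) *: pders l f (eps^-1 *: xi).
Proof.
move=> tf; have [sc E] := smooth_scale eps^-1 tf.1.
have [_ E2] := smooth_lin (eps ^- s) 0 sc sc.
have := E2 l xi Logic.I; rewrite scale0r addr0 E scalerA => <-.
by congr (pders l _ xi); apply/funext => x; rewrite scale0r addr0.
Qed.

Lemma vanish_Seps eps f rho : 0 < eps -> vanish rho f -> vanish (eps * rho) (Seps eps f).
Proof.
move=> e0 v xi xr; rewrite /Seps v ?scaler0// normrZ gtr0_norm ?invr_gt0//.
by rewrite ltr_pdivlMl.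
Qed.

Lemma testfun_Seps eps f : 0 < eps -> testfun f -> testfun (Seps eps f).
Proof.
move=> e0 tf; have [rho r0 v] := testfun_vanish tf.
apply: (vanish_testfun _ (vanish_Seps e0 v)).
have [sc E] := smooth_scale eps^-1 tf.1.
have [+ _] := smooth_lin (eps ^- s) 0 sc sc.
by congr (smooth_on _ _); apply/funext => x; rewrite scale0r addr0.
Qed.

Lemma cint_Seps eps f : 0 < eps -> testfun f -> cint (Seps eps f) = cint f.
Proof.
move=> e0 tf; have [rho r0 v] := testfun_vanish tf.
have [K [L1 L2]] := testfun_lipsupp tf v.
have c0 : 0 < eps^-1 by rewrite invr_gt0.
have r0' : 0 <= eps * rho by rewrite mulr_ge0// ltW.
have [K' [L3 L4]] := testfun_lipsupp (testfun_Seps e0 tf) (vanish_Seps e0 v).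
have e : size (enum 'I_s) = s by rewrite size_enum_ord.
have key (F G : 'rV[R]_s -> R) KF KG : lipsupp predT KF rho F -> lipsupp predT KG (eps * rho) G ->
    (forall x, G x = eps ^- s * F (eps^-1 *: x)) -> intRs G = intRs F.
  move=> LF LG GF; have := iint_scale 0 r0 c0 LF (enum_uniq 'I_s).
  rewrite scaler0 e exprVn /intRs => <-.
  have := iint_linear 0 (eps ^+ s) 0 r0' LG LG (enum_uniq 'I_s); rewrite mul0r addr0.
  have -> : (fun x => eps ^+ s * G x + 0 * G x) = (fun x => F (eps^-1 *: x)).
    apply/funext => x; rewrite mul0r addr0 GF mulrA divff ?mul1r//.
    by rewrite expf_neq0// gt_eqF.
  by move=> ->; rewrite mulrA mulVf ?mul1r// expf_neq0// gt_eqF.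
by rewrite /cint; congr (_, _); [exact: key L1 L3 _|exact: key L2 L4 _].
Qed.

Lemma A00_lin f g a b : A00 f -> A00 g -> A00 (a *: f + b *: g : @tfun R s).
Proof.
move=> [tf If] [tg Ig]; split; first exact: testfun_lin.
rewrite cint_lin// If Ig.
have -> : ((0, 0) : R * R) = 0 by [].
by rewrite !scaler0 addr0.
Qed.

Lemma A0_lin f g a b : A0 f -> A00 g -> a = 1 -> A0 (a *: f + b *: g : @tfun R s).
Proof.
move=> [tf If] [tg Ig] ->; split; first exact: testfun_lin.
rewrite cint_lin// If Ig.
have -> : ((0, 0) : R * R) = 0 by [].
by rewrite scaler0 addr0 scale1r.
Qed.

Lemma A0_sub f g : A0 f -> A0 g -> A00 (f - g : @tfun R s).
Proof.
move=> [tf If] [tg Ig].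
have -> : f - g = (1 : R) *: f + (-1 : R) *: g by rewrite scale1r scaleN1r.
split; first exact: testfun_lin.
by rewrite cint_lin// If Ig scale1r scaleN1r subrr.
Qed.

Lemma A0_Seps eps f : 0 < eps -> A0 f -> A0 (Seps eps f).
Proof. by move=> e0 [tf If]; split; [exact: testfun_Seps|rewrite cint_Seps]. Qed.

Lemma A00_Seps eps f : 0 < eps -> A00 f -> A00 (Seps eps f).
Proof. by move=> e0 [tf If]; split; [exact: testfun_Seps|rewrite cint_Seps]. Qed.

End TestFunctions.

(** * The special curve lemma *)

Section Profile.
Context {R : realType}.

Definition profile (k : nat -> R -> R) := exists K : nat -> R,
  [/\ forall j x, is_derive x (1 : R) (k j) (k j.+1 x),
      forall j x, 1 <= `|x| -> k j x = 0 & forall j x, `|k j x| <= K j].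

Lemma profile_bound (k : nat -> R -> R) :
  (forall j x, is_derive x (1 : R) (k j) (k j.+1 x)) ->
  (forall j x, 1 <= `|x| -> k j x = 0) -> profile k.
Proof.
move=> D Z; have H j : exists K : R, forall x, `|k j x| <= K.
  have : compact [set k j x | x in `[-1, 1]].
    apply: continuous_compact; last exact: segment_compact.
    apply: continuous_subspaceT => x; apply: differentiable_continuous.
    by apply/derivable1_diffP; case: (D j x).
  move=> /compact_bounded [M [_ HM]]; exists (`|M| + 1) => x.
  have [x1|x1] := leP 1 `|x|; first by rewrite Z// normr0 addr_ge0.
  apply: (HM (`|M| + 1)); first by rewrite (le_lt_trans (ler_norm M))// ltrDl.
  by exists x => //=; rewrite in_itv /= -ler_norml ltW.
by have [K HK] := choice H; exists K; split.
Qed.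

(** [sigma] is [x * chi x]. On the inner half of a window [chi] is 1 and [sigma] is the identity, so
    one prescribes a point and the other a velocity. *)
Lemma profiles : exists chi sigma : nat -> R -> R, [/\ profile chi, profile sigma,
  forall x, `|chi 0%N x| <= 1, forall x, `|sigma 0%N x| <= 1 &
  forall x, `|x| <= 1 / 2 -> chi 0%N x = 1 /\ sigma 0%N x = x].
Proof.
have [chi [D c1 c2 c3]] := @bump_ex R.
(* Leibniz rule for the [j]-th derivative of [x * chi x]; for [j = 0] the truncated predecessor is
   multiplied by 0. *)
pose sigma j x := x * chi j x + j%:R * chi j.-1 x.
exists chi, sigma.
have ac x : `|chi 0%N x| <= 1 by have /andP[? ?] := c2 x; rewrite ger0_norm.
split=> // [||x|x x2].
- exact: profile_bound.
- apply: profile_bound => j x; last first.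
    by move=> x1; rewrite /sigma !c3// !mulr0 addr0.
  have H := is_deriveD (is_deriveM (is_derive_id x (1 : R)) (D j x)) (is_deriveZ j%:R (D j.-1 x)).
  apply: (is_derive_eq (H : is_derive x (1 : R) (sigma j) _)).
  rewrite -![_ *: _]/(_ * _) mulr1 /sigma; case: j {H} => [|j] /=; first by rewrite mul0r mul1r addr0.
  by rewrite (mulrSr 1 j.+1); ring.
- rewrite /sigma mul0r addr0 normrM; have [x1|x1] := leP 1 `|x|.
    by rewrite c3// normr0 mulr0.
  by apply: mulr_ile1 => //; exact: ltW.
- by rewrite /sigma c1// mul0r addr0 mulr1.
Qed.

End Profile.

(** * Windows of time shrinking to the origin *)

Section Windows.
Context {R : realType}.

Definition tt (m : nat) : R := 2^-1 ^+ m.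

Lemma tt_gt0 m : 0 < tt m. Proof. by rewrite exprn_gt0// invr_gt0. Qed.

(** The window of [m] runs from 3/4 to 5/4 of 2^(-m); with this radius different windows are
    disjoint. *)
Definition win (m : nat) (r : R) : R := (r - tt m) / (tt m / 4).

Lemma winE m r : win m r = 4 / tt m * r + (- 4).
Proof.
by rewrite /win; have := tt_gt0 m => /gt_eqF /negbT h; field.
Qed.

Lemma win_small m r : `|win m r| < 1 -> 3 / 4 * tt m <= r.
Proof.
rewrite /win; have t0 := tt_gt0 m; have t40 : 0 < tt m / 4 by rewrite divr_gt0.
rewrite normrM normfV (gtr0_norm t40) ltr_pdivrMr// mul1r ltr_norml => /andP[h _]; lra.
Qed.

(** A cutoff beyond which no window reaches [r], which turns series over windows into finite sums at
    every time. *)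
Definition Nwin (r : R) : nat := if 0 < r then (Num.truncn (2 / r)).+1 else 0%N.

Lemma tt_le m : (m.+1%:R * tt m <= 1 :> R).
Proof.
rewrite /tt exprVn ler_pdivrMr ?exprn_gt0// mul1r -natrX ler_nat.
exact: ltn_expl.
Qed.

Lemma win_big m r r' : 0 < r' -> r' <= r -> (Nwin r' <= m)%N -> 1 <= `|win m r|.
Proof.
move=> r'0 rr; rewrite /Nwin r'0 => Nm; have t0 := tt_gt0 m.
rewrite leNgt; apply/negP; rewrite /win.
have t40 : 0 < tt m / 4 by rewrite divr_gt0.
rewrite normrM normfV (gtr0_norm t40) ltr_pdivrMr// mul1r ltr_norml => /andP[_ h].
have := truncnS_gt (2 / r'); rewrite ltr_pdivrMr// => h2.
have h3 : (Num.truncn (2 / r')).+1%:R * tt m <= 1.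
  by apply: le_trans (tt_le m); rewrite ler_wpM2r ?(ltW t0)// ler_nat ltnW.
have : (Num.truncn (2 / r')).+1%:R * r' <= (Num.truncn (2 / r')).+1%:R * (5 / 4 * tt m).
  by rewrite ler_wpM2l//; lra.
lra.
Qed.

Lemma win_neg m r : r <= 0 -> 1 <= `|win m r|.
Proof.
move=> r0; rewrite leNgt; apply/negP => /win_small; have := tt_gt0 m; lra.
Qed.

Lemma Nwin_mono r' r : 0 < r' -> r' <= r -> (Nwin r <= Nwin r')%N.
Proof.
move=> r'0 rr; have r0 : 0 < r by exact: lt_le_trans rr.
rewrite /Nwin r'0 r0 ltnS le_truncn// ler_wpM2l// lef_pV2 ?posrE//.
Qed.

Lemma win_other m k r : m != k -> `|r - tt k| <= tt k / 8 -> 1 <= `|win m r|.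
Proof.
move=> mk hr; rewrite leNgt; apply/negP; rewrite /win.
have t0 := tt_gt0 m; have tk0 := tt_gt0 k.
have t40 : 0 < tt m / 4 by rewrite divr_gt0.
rewrite normrM normfV (gtr0_norm t40) ltr_pdivrMr// mul1r ltr_norml => /andP[h1 h2].
move: hr; rewrite ler_norml => /andP[h3 h4].
have dbl i j : (i < j)%N -> 2 * tt j <= tt i.
  move=> ij; rewrite /tt -(subnK ij) addnS exprS mulrA divff// mul1r exprD ler_piMl ?exprn_ge0//.
  by rewrite exprn_ile1//; lra.
by case: (ltngtP m k) mk => // /dbl; lra.
Qed.

End Windows.

Section ProductRule.
Context {R : realType} {V W : normedModType R}.

Lemma is_derive_small_cont (p : V -> W) x v p' : is_derive x v p p' ->
  exists2 r : R, 0 < r & forall h : R, `|h| <= r -> `|p (x + h *: v) - p x| <= (`|p'| + 1) * `|h|.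
Proof.
move=> D; have [r r0 H] := is_derive_smallP D ltr01; exists r => // h hr.
apply: le_trans (norm_le_sub _ (h *: p')) _; rewrite mulrDl addrC normrZ mulrC lerD2l.
exact: H.
Qed.

Lemma is_derive_scale_fun (g : V -> R) (p : V -> W) x v g' p' :
  is_derive x v g g' -> is_derive x v p p' ->
  is_derive x v (fun y => g y *: p y) (g' *: p x + g x *: p').
Proof.
move=> Dg Dp; apply: is_derive_small => e e0.
have e3 : 0 < e / 3 by rewrite divr_gt0.
have [r1 r10 H1] := is_derive_small_cont Dp.
have P0 : 0 < `|p x| + `|p'| + 1 by rewrite ltr_wpDl// addr_ge0.
have g0 : 0 < `|g x| + 1 by rewrite ltr_wpDl.
have [r2 r20 H2] := is_derive_smallP Dg (divr_gt0 e3 P0).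
have [r3 r30 H3] := is_derive_smallP Dp (divr_gt0 e3 g0).
have [r r0 Hr] := @pick_small R [:: (1, r1); (1, r2); (1, r3); (1, 1); (`|g'| * (`|p'| + 1), e / 3)]
  ltac:(by rewrite /= r10 r20 r30 e3 ltr01 ?ler01 mulr_ge0// addr_ge0).
exists r => // h hr.
have := Hr `|h|; rewrite normr_ge0 hr => /(_ isT) /=; rewrite !mulr1 andbT.
move=> /and5P[h1 h2 h3 h4 h5].
have {}H1 := H1 h h1; have {}H2 := H2 h h2; have {}H3 := H3 h h3.
set y := x + h *: v in H1 H2 H3 *.
have py : `|p y| <= `|p x| + `|p'| + 1.
  apply: le_trans (norm_le_sub _ (p x)) _; rewrite [leLHS]addrC -addrA lerD2l.
  by apply: le_trans H1 _; rewrite ler_piMr// addr_ge0.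
have -> : g y *: p y - g x *: p x - h *: (g' *: p x + g x *: p') =
  (g y - g x - h *: g') *: p y + g x *: (p y - p x - h *: p') + (h * g') *: (p y - p x).
  rewrite -[h *: g']/(h * g') !scalerBl !scalerBr scalerDr !scalerA (mulrC (g x) h).
  set A := g y *: _; set B0 := g x *: p y; set C := (h * g') *: p y; set D := g x *: p x.
  set E := (h * g') *: p x; set F := _ *: p'.
  rewrite [A - B0 - C]addrAC opprD !addrA subrK [A - C - D]addrAC [A - D - C - F]addrAC subrK.
  by rewrite addrAC.
apply: le_trans (ler_normD _ _) _; apply: le_trans (lerD (ler_normD _ _) (lexx _)) _.
rewrite !normrZ.
have E1 : `|g y - g x - h *: g'| * `|p y| <= e / 3 * `|h|.
  apply: le_trans (ler_pM (normr_ge0 _) (normr_ge0 _) H2 py) _.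
  by rewrite mulrAC divfK// gt_eqF.
have E2 : `|g x| * `|p y - p x - h *: p'| <= e / 3 * `|h|.
  apply: le_trans (ler_wpM2l (normr_ge0 _) H3) _.
  rewrite mulrA ler_wpM2r// mulrC -mulrA ler_piMr// ?(ltW e3)// mulrC ler_pdivrMr// mul1r lerDl//.
have E3 : `|h| * `|g'| * `|p y - p x| <= e / 3 * `|h|.
  apply: le_trans (ler_wpM2l _ H1) _; first by rewrite mulr_ge0.
  by rewrite mulrA ler_wpM2r// -mulrA.
lra.
Qed.

End ProductRule.

Lemma continuous_sum {R : realType} {V : topologicalType} {W : normedModType R} (N : nat)
    (F : nat -> V -> W) (z : V) : (forall m, {for z, continuous (F m)}) ->
  {for z, continuous (fun y => \sum_(m < N) F m y)}.
Proof.
move=> H; elim: N => [|N IH].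
  rewrite (_ : (fun y => _) = cst 0); first exact: cst_continuous.
  by apply/funext => y; rewrite big_ord0.
rewrite (_ : (fun y => _) = (fun y => \sum_(m < N) F m y + F N y)).
  exact: (continuousD IH (H N)).
by apply/funext => y; rewrite big_ord_recr.
Qed.

(** * Series of bumps with rapidly decreasing coefficients *)

Section Series.
Context {R : realType} {n : nat} {W : normedModType R}.
Variables (i0 : 'I_n) (k : nat -> R -> R) (P : nat -> seq 'I_n -> 'rV[R]_n -> W).
Variables (eta : nat -> R).
Hypothesis pk : profile k.
Hypothesis HPd : forall m l i z, is_derive z (evec i) (P m l) (P m (i :: l) z).
Hypothesis HPc : forall m l z, {for z, continuous (P m l)}.
Hypothesis HPb : exists M : seq 'I_n -> R, forall m l z, `|P m l z| <= M l.
Hypothesis HP0 : forall m l z, i0 \in l -> P m l z = 0.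
Hypothesis He : forall c, exists C, forall m, `|eta m| * 2 ^+ (m * c) <= C.

Implicit Types z : 'rV[R]_n.

Let cnt (l : seq 'I_n) := count_mem i0 l.
Let rst (l : seq 'I_n) := [seq i <- l | i != i0].

(** The partials of the m-th summand in closed form: each time letter [i0] falls on the profile and
    brings a factor [4 / tt m], the other letters fall on [P m], which by [HP0] does not depend on
    time. *)
Definition wterm m l (z : 'rV[R]_n) : W :=
  (eta m * (4 / tt m) ^+ cnt l * k (cnt l) (win m (z ord0 i0))) *: P m (rst l) z.

Definition wsum l (z : 'rV[R]_n) : W := \sum_(m < Nwin (z ord0 i0)) wterm m l z.

Lemma wterm_derive m l i z : is_derive z (evec i) (wterm m l) (wterm m (i :: l) z).
Proof.
have [K [Dk _ _]] := pk.
have Dw : is_derive (z ord0 i0) (1 : R) (fun r => k (cnt l) (win m r))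
    ((4 / tt m) *: k (cnt l).+1 (win m (z ord0 i0))).
  have -> : (fun r => k (cnt l) (win m r)) = (fun r => k (cnt l) (4 / tt m * r + (- 4))).
    by apply/funext => r; rewrite winE.
  by rewrite winE; exact: (is_derive_affine (Dk _ _)).
have Dz : is_derive z (evec i) (fun y : 'rV[R]_n => k (cnt l) (win m (y ord0 i0)))
    ((i == i0)%:R *: ((4 / tt m) *: k (cnt l).+1 (win m (z ord0 i0)))).
  apply: (@is_derive_precomp _ _ _ _ (fun r => k (cnt l) (win m r)) (fun y : 'rV[R]_n => y ord0 i0) z (evec i) ((i == i0)%:R *: (1 : R))); last exact: is_derive_scalev.
  by move=> h; rewrite !mxE -[h *: _]/(h * ((i == i0)%:R * 1)) mulr1 eqxx eq_sym.
have De := is_deriveZ (eta m * (4 / tt m) ^+ cnt l) Dz.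
have H := is_derive_scale_fun De (HPd m (rst l) i z).
apply: (is_derive_eq (H : is_derive z (evec i) (wterm m l) _)).
rewrite /wterm /cnt /rst /=; have [->|ii0] := eqVneq i i0.
  rewrite (@HP0 m (i0 :: [seq i <- l | i != i0]) z) ?mem_head// scaler0 addr0 add1n exprS scale1r -![_ *: (_ : R)]/(_ * _).
  by congr (_ *: _); ring.
by rewrite !scale0r scaler0 scale0r add0r add0n.
Qed.

Lemma wterm_cont m l z : {for z, continuous (wterm m l)}.
Proof.
have [K [Dk _ _]] := pk.
have C1 : {for z, continuous (fun y : 'rV[R]_n => y ord0 i0)} by exact: coord_continuous.
have C2 : {for z ord0 i0, continuous (fun r => eta m * (4 / tt m) ^+ cnt l * k (cnt l) (win m r))}.
  apply: differentiable_continuous; apply/derivable1_diffP.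
  have Dw : is_derive (z ord0 i0) (1 : R) (fun r => k (cnt l) (win m r))
      ((4 / tt m) *: k (cnt l).+1 (win m (z ord0 i0))).
    have -> : (fun r => k (cnt l) (win m r)) = (fun r => k (cnt l) (4 / tt m * r + (- 4))).
      by apply/funext => r; rewrite winE.
    by rewrite winE; exact: (is_derive_affine (Dk _ _)).
  by have [] := is_deriveZ (eta m * (4 / tt m) ^+ cnt l) Dw.
have C3 := continuous_comp C1 C2.
apply: (@cvgZ _ _ _ (nbhs z) _ (fun y : 'rV[R]_n => eta m * (4 / tt m) ^+ cnt l * k (cnt l) (win m (y ord0 i0))) (P m (rst l)) ); [exact: C3|exact: HPc].
Qed.

Lemma wterm_out m l z : 1 <= `|win m (z ord0 i0)| -> wterm m l z = 0.
Proof. by have [K [_ Z _]] := pk; move=> w1; rewrite /wterm Z// mulr0 scale0r. Qed.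

Lemma wsumE l z N : (Nwin (z ord0 i0) <= N)%N -> wsum l z = \sum_(m < N) wterm m l z.
Proof.
move=> NN; rewrite /wsum -!(big_mkord xpredT (fun m => wterm m l z)).
rewrite [RHS](big_cat_nat (leq0n _) NN) /= [X in _ + X]big_nat_cond [X in _ + X]big1 ?addr0// => m /andP[/andP[Nm _] _].
apply: wterm_out; have [r0|r0] := ltP 0 (z ord0 i0); last exact: win_neg.
exact: win_big Nm.
Qed.

(** Flatness at time 0. A summand is nonzero only where [tt m] is at most 4/3 of the time [r]: two
    powers of [tt m] become 16/9 of [r ^+ 2], and a third sums geometrically. With the factor 2^(m *
    cnt l) from differentiation this costs the exponent [cnt l + 3], absorbed by the decay of
    [eta]. *)
Lemma wsum_est l : exists2 C : R, 0 <= C & forall z, `|wsum l z| <= C * (z ord0 i0) ^+ 2.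
Proof.
have [K [_ _ HK]] := pk; have [M HM] := HPb; have [C HC] := He (cnt l + 3).
have C0 : 0 <= C by apply: le_trans (HC 0%N); rewrite mulr_ge0// exprn_ge0.
have K0 : 0 <= K (cnt l) by apply: le_trans (HK (cnt l) 0).
have M0 : 0 <= M (rst l) by apply: le_trans (HM 0%N (rst l) 0).
pose A := C * 4 ^+ cnt l * K (cnt l) * M (rst l).
have A0 : 0 <= A by rewrite !mulr_ge0// exprn_ge0.
have est m z : `|wterm m l z| <= A * (16 / 9) * (z ord0 i0) ^+ 2 * tt m.
  have [w1|w1] := leP 1 `|win m (z ord0 i0)|.
    rewrite wterm_out// normr0; apply: mulr_ge0; last exact/ltW/tt_gt0.
    by apply: mulr_ge0; [apply: mulr_ge0 => //; lra|exact: sqr_ge0].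
  have t0 := @tt_gt0 R m; have := win_small w1; set r := z ord0 i0 => hr.
  have rr : tt m ^+ 2 <= 16 / 9 * r ^+ 2.
    have : (3 / 4 * tt m) ^+ 2 <= r ^+ 2 by rewrite lerXn2r ?nnegrE//; lra.
    by rewrite exprMn; lra.
  rewrite /wterm normrZ !normrM normrX normf_div (gtr0_norm t0) normr_nat.
  have E4 : (4 / tt m) ^+ cnt l = 4 ^+ cnt l * 2 ^+ (m * cnt l) :> R.
    by rewrite expr_div_n /tt -exprM exprVn invrK.
  rewrite E4; have Et : 2 ^+ (m * 3) * tt m ^+ 3 = 1 :> R.
    by rewrite /tt exprM -exprMn -exprMn divff ?expr1n.
  have -> : `|eta m| * (4 ^+ cnt l * 2 ^+ (m * cnt l)) = `|eta m| * 2 ^+ (m * (cnt l + 3)) * 4 ^+ cnt l * tt m ^+ 3.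
    rewrite -[LHS]mulr1 -[X in _ * X = _]Et mulnDr exprD; ring.
  have -> : A * (16 / 9) * r ^+ 2 * tt m = C * 4 ^+ cnt l * ((16 / 9 * r ^+ 2) * tt m) * K (cnt l) * M (rst l).
    by rewrite /A; ring.
  have t3 : 0 <= tt m ^+ 3 :> R by rewrite exprn_ge0// ltW.
  have p1 : 0 <= `|eta m| * 2 ^+ (m * (cnt l + 3)) * 4 ^+ cnt l.
    by rewrite !mulr_ge0 ?exprn_ge0.
  have q1 : `|eta m| * 2 ^+ (m * (cnt l + 3)) * 4 ^+ cnt l <= C * 4 ^+ cnt l.
    by rewrite ler_wpM2r ?exprn_ge0.
  have q2 : tt m ^+ 3 <= 16 / 9 * r ^+ 2 * tt m by rewrite exprSr ler_wpM2r// ltW.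
  have q3 := ler_pM p1 t3 q1 q2.
  have q4 := ler_pM (mulr_ge0 p1 t3) (normr_ge0 _) q3 (HK (cnt l) (win m r)).
  exact: (ler_pM (mulr_ge0 (mulr_ge0 p1 t3) (normr_ge0 _)) (normr_ge0 _) q4 (HM m (rst l) z)).
exists (A * (16 / 9) * 2); first by do 2!apply: mulr_ge0 => //; lra.
move=> z; have B0 : 0 <= A * (16 / 9) * z ord0 i0 ^+ 2 by rewrite mulr_ge0 ?sqr_ge0//; apply: mulr_ge0 => //; lra.
apply: le_trans (_ : \sum_(m < Nwin (z ord0 i0)) A * (16 / 9) * z ord0 i0 ^+ 2 * tt m <= _).
  by apply: norm_sum_le => m; exact: est.
rewrite -mulr_sumr [leRHS]mulrAC ler_wpM2l//.
have S N : \sum_(m < N) tt m = 2 - 2 * tt N :> R.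
  elim: N => [|N IH]; first by rewrite big_ord0 /tt expr0; lra.
  by rewrite big_ord_recr /= IH /tt exprS; lra.
by rewrite S; have := @tt_gt0 R (Nwin (z ord0 i0)); lra.
Qed.

Lemma wsum_near z : z ord0 i0 != 0 -> exists N, forall l, \forall y \near z,
  wsum l y = \sum_(m < N) wterm m l y.
Proof.
move=> r0; exists (if 0 < z ord0 i0 then Nwin (z ord0 i0 / 2) else 0%N) => l'.
apply/rV_nbhsP; exists (`|z ord0 i0| / 2); first by rewrite divr_gt0// normr_gt0.
move=> y yz; have := le_lt_trans (rV_coord_le (y - z) i0) yz; rewrite !mxE => hy.
apply: wsumE; case: ifP => rp.
  rewrite (gtr0_norm rp) ltr_norml in hy; move: hy => /andP[h1 h2].
  by apply: Nwin_mono; lra.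
have rn : z ord0 i0 < 0 by rewrite lt_neqAle r0 leNgt rp.
rewrite (ltr0_norm rn) ltr_norml in hy; move: hy => /andP[h1 h2].
by rewrite /Nwin; case: ifP => //; lra.
Qed.

(** Away from time 0 the sum is locally finite; at time 0 both sides vanish by the quadratic
    bound. *)
Lemma wsum_derive l i z : is_derive z (evec i) (wsum l) (wsum (i :: l) z).
Proof.
have [r0|r0] := eqVneq (z ord0 i0) 0; last first.
  have [N HN] := wsum_near r0.
  have -> : wsum (i :: l) z = \sum_(m < N) wterm m (i :: l) z.
    exact: (nbhs_singleton (HN (i :: l))).
  apply: (near_eq_is_derive (f := \sum_(m < N) wterm m l)).
    by apply: filterS (HN l) => y ->; rewrite fct_sumE.
  by apply: is_derive_sum => m; exact: wterm_derive.
have Z l' : wsum l' z = 0 by rewrite /wsum r0 /Nwin ltxx big_ord0.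
rewrite Z; have [C C0 HC] := wsum_est l.
apply: is_derive_small => e e0.
have C1 : 0 < C + 1 by rewrite ltr_wpDl.
exists (e / (C + 1)) => [|h]; first by rewrite divr_gt0.
rewrite ler_pdivlMr// => hr; rewrite scaler0 subr0 Z subr0.
apply: le_trans (HC _) _; rewrite !mxE r0 add0r.
have : (h * (i0 == i)%:R) ^+ 2 <= `|h| ^+ 2.
  by rewrite exprMn real_normK ?num_real// ler_piMr ?sqr_ge0//; case: eqP; rewrite ?expr1n ?expr0n.
rewrite [(ord0 == ord0)]eqxx /= => hh.
apply: le_trans (ler_wpM2l C0 hh) _; rewrite expr2 mulrA ler_wpM2r//.
by apply: le_trans hr; rewrite mulrC ler_wpM2l// lerDl.
Qed.

Lemma wsum_cont l z : {for z, continuous (wsum l)}.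
Proof.
have [r0|r0] := eqVneq (z ord0 i0) 0; last first.
  have [N HN] := wsum_near r0.
  have E := nbhs_singleton (HN l).
  rewrite /prop_for /continuous_at E.
  have : \sum_(m < N) wterm m l y @[y --> z] --> \sum_(m < N) wterm m l z.
    exact: (@continuous_sum _ _ _ N (wterm^~ l) z (fun m => @wterm_cont m l z)).
  move=> Cl; apply: cvg_trans Cl; apply: (@near_eq_cvg _ _ (nbhs z)).
  by apply: filterS (HN l) => y ->.
have Z l' : wsum l' z = 0 by rewrite /wsum r0 /Nwin ltxx big_ord0.
have [C C0 HC] := wsum_est l.
apply/(@cvgrPdist_le _ _ _ (nbhs z)) => e e0; apply/rV_nbhsP.
have C1 : 0 < C + 1 by rewrite ltr_wpDl.
exists (Num.min 1 (e / (C + 1))); first by rewrite lt_min ltr01 divr_gt0.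
move=> y; rewrite lt_min => /andP[y1 ye]; rewrite Z sub0r normrN.
have := rV_coord_le (y - z) i0; rewrite !mxE r0 subr0 => hy.
apply: le_trans (HC y) _; rewrite -(ger0_norm (sqr_ge0 _)) normrX.
rewrite ltr_pdivlMr// in ye; apply: le_trans (ltW ye).
rewrite mulrC mulrDr mulr1; apply: le_trans (_ : `|y - z| * C <= _); last by rewrite lerDl.
rewrite ler_wpM2r// expr2 -[leRHS]mulr1; apply: ler_pM => //.
by apply: le_trans hy _; exact: ltW.
Qed.

Lemma wsum_smooth : smooth_on setT (wsum [::]).
Proof.
apply: (smooth_family (F := wsum)) => // [|l i z _|l z _].
- exact: openT.
- exact: wsum_derive.
- exact: wsum_cont.
Qed.

End Series.

Section JointFamily.
Context {R : realType} {m s : nat} {W : normedModType R}.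
Implicit Types (g : 'rV[R]_s -> W) (l : seq 'I_(m + s)) (z : 'rV[R]_(m + s)).

Definition rcoord (i : 'I_(m + s)) : option 'I_s := if fintype.split i is inr j then Some j else None.

Lemma rcoord_rshift j : rcoord (rshift m j) = Some j.
Proof. by rewrite /rcoord; case: split_ordP => k /eqP; rewrite ?eq_rlshift// eq_rshift => /eqP ->. Qed.

Lemma rcoord_lshift j : rcoord (lshift s j) = None.
Proof. by rewrite /rcoord; case: split_ordP => k /eqP //; rewrite eq_lrshift. Qed.

Definition rfam g l z : W :=
  if all (fun i => rcoord i) l then pders (pmap rcoord l) g (rsubmx z) else 0.

Lemma rsubmx_evec (i : 'I_(m + s)) :
  rsubmx (evec i : 'rV[R]_(m + s)) = if rcoord i is Some j then evec j else 0.
Proof.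
case: (split_ordP i) => k ->; rewrite ?rcoord_lshift ?rcoord_rshift; apply/rowP => q; rewrite !mxE.
  by rewrite eq_rlshift andbF.
by rewrite eq_rshift.
Qed.

Lemma rfam_derive g l i z : smooth_on setT g -> is_derive z (evec i) (rfam g l) (rfam g (i :: l) z).
Proof.
move=> sg; have [D C] := smooth_onP sg; rewrite /rfam /=.
case: (boolP (all _ l)) => al; last by rewrite andbF; exact: is_derive_cst.
rewrite andbT; apply: (@is_derive_precomp _ _ _ _ (pders (pmap rcoord l) g) (fun y : 'rV[R]_(m + s) => rsubmx y) z (evec i) (rsubmx (evec i))).
  by move=> h; rewrite linearD linearZ.
by rewrite rsubmx_evec; case: (rcoord i) => [j|] /=; [exact: D|exact: is_derive0].
Qed.

Lemma rsubmx_cont z : {for z, continuous (fun y : 'rV[R]_(m + s) => rsubmx y)}.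
Proof. by apply: differentiable_continuous; exact: differentiable_rsubmx. Qed.

Lemma rfam_cont g l z : smooth_on setT g -> {for z, continuous (rfam g l)}.
Proof.
move=> sg; have [D C] := smooth_onP sg; rewrite /rfam.
case: (boolP (all _ l)) => al; last exact: cst_continuous.
exact: (continuous_comp (@rsubmx_cont z) (C (pmap rcoord l) (rsubmx z) Logic.I)).
Qed.

Lemma rfam_left g l z j : lshift s j \in l -> rfam g l z = 0.
Proof.
by move=> jl; rewrite /rfam; case: ifP => // /allP/(_ _ jl); rewrite rcoord_lshift.
Qed.

Lemma rfam_smooth g : smooth_on setT g -> smooth_on setT (fun z : 'rV[R]_(m + s) => g (rsubmx z)).
Proof.
move=> sg; apply: (smooth_family (F := rfam g)) => // [|l i z _|l z _].
- exact: openT.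
- exact: rfam_derive.
- exact: rfam_cont.
Qed.

End JointFamily.

(** * The special curve in the space of test functions and points *)

Section Curves.
Context {R : realType} {s : nat}.
Local Notation X := (@tfun R s * 'rV[R]_s)%type.
Implicit Types (M : seq 'I_s -> R) (mv rho : R).

(** Integral 0 in the first component keeps perturbations of a point inside the affine space A_0 x
    R^s. *)
Definition Bd rho M mv : set X := [set b | [/\ A00 b.1, vanish rho b.1,
  forall l xi, `|pders l b.1 xi| <= M l & `|b.2| <= mv]].

Lemma A00_zero : A00 (0 : @tfun R s).
Proof.
have sm : smooth_on setT (0 : @tfun R s).
  have D (l : seq 'I_s) i (z : 'rV[R]_s) : setT z -> is_derive z (evec i) (fun _ => 0 : R * R) 0.
    by move=> _; exact: is_derive_cst.
  have C (l : seq 'I_s) (z : 'rV[R]_s) : setT z -> {for z, continuous (fun _ : 'rV[R]_s => 0 : R * R)}.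
    by move=> _; exact: cst_continuous.
  exact: (smooth_family (F := fun _ _ => 0) openT D C).
have tz : testfun (0 : @tfun R s) by apply: (vanish_testfun (rho := 0) sm).
split => //; have := cint_lin 0 0 tz tz.
by rewrite !scale0r !addr0 => ->.
Qed.

Lemma Bd_absconvex rho M mv : (forall l, 0 <= M l) -> 0 <= mv -> absconvex (Bd rho M mv).
Proof.
move=> M0 mv0; split.
  split => //; [exact: A00_zero| |by rewrite normr0].
  by move=> l xi; have -> := congr1 (fun f => f xi) (@pders_zero R s _ l); rewrite normr0.
move=> b b' l m [h1 h2 h3 h4] [k1 k2 k3 k4] lm; split.
- exact: A00_lin.
- by move=> xi xr; rewrite -[LHS]/(l *: b.1 xi + m *: b'.1 xi) h2// k2// !scaler0 addr0.
- move=> q xi; have [_ ->] := smooth_lin l m h1.1.1 k1.1.1; last by [].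
  apply: le_trans (ler_normD _ _) _; rewrite !normrZ.
  apply: le_trans (_ : (`|l| + `|m|) * M q <= _); last by rewrite ler_piMl.
  by rewrite mulrDl; apply: lerD; rewrite ler_wpM2l.
- apply: le_trans (ler_normD _ _) _; rewrite !normrZ.
  apply: le_trans (_ : (`|l| + `|m|) * mv <= _); last by rewrite ler_piMl.
  by rewrite mulrDl; apply: lerD; rewrite ler_wpM2l.
Qed.

Lemma around_Bd rho M mv (a c : X) (e : R) : around (Bd rho M mv) a e c -> 0 <= e ->
  A0 a.1 -> vanish rho a.1 -> [/\ A0 c.1, vanish rho c.1 & `|c.2 - a.2| <= e * mv].
Proof.
move=> [b [h1 h2 h3 h4]] /eqP; rewrite subr_eq addrC => /eqP -> e0 Aa va; split.
- have := A0_lin e Aa h1 (erefl 1); by rewrite scale1r.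
- by move=> xi xr; rewrite -[LHS]/(a.1 xi + e *: b.1 xi) va// h2// scaler0 addr0.
- by rewrite -[(a + e *: b).2]/(a.2 + e *: b.2) addrAC subrr add0r normrZ ger0_norm// ler_wpM2l.
Qed.

Variables (chi sigma : nat -> R -> R).
Hypotheses (pchi : profile chi) (psigma : profile sigma).
Hypothesis chi1 : forall x, `|chi 0%N x| <= 1.
Hypothesis sigma1 : forall x, `|sigma 0%N x| <= 1.
Hypothesis chisigma : forall x, `|x| <= 1 / 2 -> chi 0%N x = 1 /\ sigma 0%N x = x.

Variables (rho : R) (M : seq 'I_s -> R) (mv : R) (a : X) (b u : nat -> X) (eta : nat -> R).
Hypotheses (M0 : forall l, 0 <= M l) (mv0 : 0 <= mv).
Hypotheses (Aa : A0 a.1) (va : vanish rho a.1).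
Hypotheses (Bb : forall m, Bd rho M mv (b m)) (Bu : forall m, Bd rho M mv (u m)).
Hypothesis He : forall c, exists C, forall m, `|eta m| * 2 ^+ (m * c) <= C.

(** Kriegl's curve. Near time [tt m] it is the segment through [a + eta m *: b m] with velocity
    [eta m *: u m]; the factor [tt m / 4] undoes the rescaling of time in [win]. *)
Definition ccurve (r : R) : X := a + \sum_(m < Nwin r)
  ((eta m * chi 0%N (win m r)) *: b m + (eta m * (tt m / 4) * sigma 0%N (win m r)) *: u m).

Let cB := Bd_absconvex rho M0 mv0.

(** A summand costs at most the modulus of [eta m] for the point and as much for the velocity,
    whence the factor 2. *)
Lemma ccurve_around r (S : R) : (forall N, \sum_(m < N) `|eta m| <= S) ->
  around (Bd rho M mv) a (2 * S) (ccurve r).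
Proof.
move=> HS; rewrite /around /= /ccurve addrC addKr.
have S0 : 0 <= S by have := HS 0%N; rewrite big_ord0.
have H N : dil (\sum_(m < N) 2 * `|eta m|) (Bd rho M mv) (\sum_(m < N)
  ((eta m * chi 0%N (win m r)) *: b m + (eta m * (tt m / 4) * sigma 0%N (win m r)) *: u m)).
  elim: N => [|N IH]; first by rewrite !big_ord0; exact: dil0.
  have s0 : 0 <= \sum_(m < N) 2 * `|eta m| by rewrite sumr_ge0// => m _; exact: mulr_ge0.
  have e0 : 0 <= 2 * `|eta N| by exact: mulr_ge0.
  rewrite !big_ord_recr /=; apply: (dilD cB s0 e0 IH).
  rewrite mulrDl mul1r; apply: (dilD cB) => //.
    apply: (dilS cB (k := eta N * chi 0%N (win N r))); last by exists (b N).
    by rewrite normrM normr_id ler_piMr.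
  apply: (dilS cB (k := eta N * (tt N / 4) * sigma 0%N (win N r))); last by exists (u N).
  rewrite -mulrA normrM normr_id ler_piMr// normrM mulr_ile1//.
  have := @tt_gt0 R N; have := @tt_le R N => h1 h2.
  have : tt N <= 1 :> R by apply: le_trans h1; rewrite ler_peMl ?(ltW h2)// ler1n.
  by rewrite ger0_norm; lra.
apply: (dilS cB) (H _); rewrite !ger0_norm; last by rewrite sumr_ge0// => m _; rewrite mulr_ge0.
  by rewrite -mulr_sumr ler_wpM2l.
by rewrite mulr_ge0.
Qed.

Lemma ccurve_near m r : `|r - tt m| <= tt m / 8 ->
  ccurve r = a + eta m *: b m + (eta m * (r - tt m)) *: u m.
Proof.
move=> hr; rewrite /ccurve -addrA; congr (_ + _).
pose F j := (eta j * chi 0%N (win j r)) *: b j + (eta j * (tt j / 4) * sigma 0%N (win j r)) *: u j.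
have [Kc [_ Zc _]] := pchi; have [Ks [_ Zs _]] := psigma.
have F0 j : 1 <= `|win j r| -> F j = 0 by move=> w1; rewrite /F Zc// Zs// !mulr0 !scale0r addr0.
have t0 := @tt_gt0 R m.
have w2 : `|win m r| <= 1 / 2.
  have t4 : 0 < tt m / 4 :> R by rewrite divr_gt0.
  rewrite /win normrM normfV (gtr0_norm t4) ler_pdivrMr//; lra.
have -> : eta m *: b m + (eta m * (r - tt m)) *: u m = F m.
  rewrite /F; have [-> ->] := chisigma w2; rewrite mulr1 /win; congr (_ + _ *: _).
  by field; rewrite gt_eqF.
have r0 : 0 < r by move: hr; rewrite ler_norml => /andP[? ?]; lra.
have mN : (m < Nwin r)%N.
  rewrite ltnNge; apply/negP => Nm; have := win_big r0 (lexx r) Nm; rewrite leNgt => /negP; apply.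
  by apply: le_lt_trans w2 _; lra.
rewrite -(big_mkord xpredT F) (bigD1_seq m) ?mem_index_iota ?iota_uniq//=.
by rewrite big1 ?addr0// => j jm; apply: F0; exact: win_other hr.
Qed.

Let He' c : exists C, forall m, `|eta m * (tt m / 4)| * 2 ^+ (m * c) <= C.
Proof.
have [C HC] := He c; exists C => m; apply: le_trans (HC m).
rewrite ler_wpM2r ?exprn_ge0// normrM ler_piMr//.
have h2 := @tt_gt0 R m; have h1 := @tt_le R m.
have : tt m <= 1 :> R by apply: le_trans h1; rewrite ler_peMl ?(ltW h2)// ler1n.
by rewrite ger0_norm; lra.
Qed.

Lemma smooth_add3 n (W : normedModType R) (f g h : 'rV[R]_n -> W) :
  smooth_on setT f -> smooth_on setT g -> smooth_on setT h ->
  smooth_on setT (fun x => f x + g x + h x).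
Proof.
move=> sf sg sh; have [s1 _] := smooth_lin 1 1 sf sg; have [+ _] := smooth_lin 1 1 s1 sh.
by congr (smooth_on _ _); apply/funext => x; rewrite !scale1r.
Qed.

Variable S : R.
Hypothesis HS : forall N, \sum_(m < N) `|eta m| <= S.

Let S0 : 0 <= 2 * S.
Proof. by rewrite mulr_ge0//; have := HS 0%N; rewrite big_ord0. Qed.

Let wsum_rfam (k : nat -> R -> R) (e : nat -> R) (v : nat -> X) : profile k ->
  (forall m, Bd rho M mv (v m)) -> (forall c, exists C, forall m, `|e m| * 2 ^+ (m * c) <= C) ->
  smooth_on setT (wsum (lshift s (ord0 : 'I_1)) k (fun m => rfam (v m).1) e [::]).
Proof.
move=> pk Bv Hv; have sv m : smooth_on setT (v m).1 by have [[[]]] := Bv m.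
apply: wsum_smooth => //.
- by move=> m l i z; exact: rfam_derive.
- by move=> m l z; exact: rfam_cont.
- exists (fun l => M (pmap rcoord l)) => m l z; rewrite /rfam; case: ifP => _.
    by have [_ _ + _] := Bv m; apply.
  by rewrite normr0.
- by move=> m l z; exact: rfam_left.
Qed.

Let sum1 N (F : nat -> X) xi : (\sum_(m < N) F m).1 xi = \sum_(m < N) (F m).1 xi.
Proof. by elim: N => [|N IH]; rewrite ?big_ord0// !big_ord_recr /= -IH. Qed.

Let sum2 N (F : nat -> X) : (\sum_(m < N) F m).2 = \sum_(m < N) (F m).2.
Proof. by elim: N => [|N IH]; rewrite ?big_ord0// !big_ord_recr /= -IH. Qed.

Lemma ccurve_dcurve : dcurve (fun r => (ccurve r).1).
Proof.
have A r : A0 (ccurve r).1 /\ vanish rho (ccurve r).1.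
  by have [] := around_Bd (ccurve_around r HS) S0 Aa va.
split; last split.
- by move=> r; have [[]] := A r.
- have s1 := @rfam_smooth _ 1 s _ _ Aa.1.1.
  have s2 := wsum_rfam pchi Bb He; have s3 := wsum_rfam psigma Bu He'.
  have := smooth_add3 s1 s2 s3; congr (smooth_on _ _); apply/funext => p.
  rewrite /ccurve /wsum.
  set r := p ord0 _; set N := Nwin _.
pose F m := (eta m * chi 0%N (win m r)) *: b m + (eta m * (tt m / 4) * sigma 0%N (win m r)) *: u m.
  rewrite -[RHS]/(a.1 (rsubmx p) + (\sum_(m < N) F m).1 (rsubmx p)) sum1 -addrA; congr (_ + _).
  rewrite -big_split; apply: eq_bigr => m _.
  by rewrite /wterm /= !expr0 !mulr1.
- move=> t t'; exists [set x : 'rV[R]_s | `|x - 0| <= rho]; split; first exact: compact_norm_ball.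
  by move=> r _ xi; rewrite /= subr0; apply: (supp_vanish _ _).1; case: (A r).
Qed.

Let wsum_cst (k : nat -> R -> R) (e : nat -> R) (v : nat -> X) : profile k ->
  (forall m, Bd rho M mv (v m)) -> (forall c, exists C, forall m, `|e m| * 2 ^+ (m * c) <= C) ->
  smooth_on setT (wsum (ord0 : 'I_1) k (fun m l _ => if l is [::] then (v m).2 else 0) e [::]).
Proof.
move=> pk Bv Hv; apply: wsum_smooth => //.

- by move=> m l z; exact: cst_continuous.
- exists (fun=> mv) => m [|j l] z; last by rewrite normr0.
  by have [] := Bv m.
- by move=> m [].
Qed.

Lemma ccurve_scurve : scurve (fun r => (ccurve r).2).
Proof.
have s1 : smooth_on setT (fun _ : 'rV[R]_1 => a.2).
  have D (l : seq 'I_1) i (z : 'rV[R]_1) : setT z -> is_derive z (evec i) (fun _ => if l is [::] then a.2 else 0) 0.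
    by move=> _; exact: is_derive_cst.
  have C (l : seq 'I_1) (z : 'rV[R]_1) : setT z -> {for z, continuous (fun _ : 'rV[R]_1 => if l is [::] then a.2 else 0)}.
    by move=> _; exact: cst_continuous.
  exact: (smooth_family (F := fun l _ => if l is [::] then a.2 else 0) openT D C).
have s2 := wsum_cst pchi Bb He; have s3 := wsum_cst psigma Bu He'.
have := smooth_add3 s1 s2 s3; rewrite /scurve; congr (smooth_on _ _); apply/funext => p.
rewrite /ccurve /wsum.
set r := p ord0 _; set N := Nwin _.
pose F m := (eta m * chi 0%N (win m r)) *: b m + (eta m * (tt m / 4) * sigma 0%N (win m r)) *: u m.
rewrite -[RHS]/(a.2 + (\sum_(m < N) F m).2) sum2 -addrA; congr (_ + _).
rewrite -big_split; apply: eq_bigr => m _.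
by rewrite /wterm /= !expr0 !mulr1.
Qed.

Lemma Ed_ccurve (Om : set 'rV[R]_s) Rd : Ed Om Rd ->
  (forall c, around (Bd rho M mv) a (2 * S) c -> Uset Om c.1 c.2) ->
  scurve (fun r => Rd (ccurve r).1 (ccurve r).2).
Proof.
move=> E HU; apply: (E (fun r => (ccurve r).1) (fun r => (ccurve r).2)).
- exact: ccurve_dcurve.
- exact: ccurve_scurve.
- by move=> t; apply/HU/ccurve_around.
Qed.

End Curves.

Section Germs.
Context {R : realType} {W : normedModType R}.

Lemma derive1n_shift (g : R -> W) (t x : R) j :
  derive1n j g (t + x) = derive1n j (fun x => g (t + x)) x.
Proof.
elim: j x => [//|j IH] x; rewrite !derive1nS /derive1.
apply: congr1; apply: (congr1 (fun F => F @ _)); apply/funext => h.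
by rewrite -!IH addrCA.
Qed.

(** Reads the derivatives of [Rd] along a segment off the special curve, which runs through it at
    speed [eta]. *)
Lemma germ_smooth (k g : R -> W) (eta t e : R) : 0 < eta ->
  (forall j r, is_derive r (1 : R) (derive1n j k) (derive1n j.+1 k r)) ->
  (forall x, `|x| < e -> g x = k (eta^-1 * x + t)) -> forall j x, `|x| < e ->
  derive1n j g x = eta^-1 ^+ j *: derive1n j k (eta^-1 * x + t) /\
  is_derive x (1 : R) (derive1n j g) (derive1n j.+1 g x).
Proof.
move=> eta0 Dk gk.
pose G j x := eta^-1 ^+ j *: derive1n j k (eta^-1 * x + t).
have DG j x : is_derive x (1 : R) (G j) (G j.+1 x).
  by rewrite /G exprSr -scalerA; apply: is_deriveZ; exact: (is_derive_affine (Dk _ _)).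
have E j x : `|x| < e -> derive1n j g x = G j x.
  move=> xe; have G0 : G 0%N = fun x => k (eta^-1 * x + t).
    by apply/funext => y; rewrite /G expr0 scale1r.
  by rewrite (derive1n_near gk)// -G0 (derive1n_witness (G := G) (d := e)).
move=> j x xe; split; first exact: E.
rewrite E//; apply: near_eq_is_derive (DG j x).
apply/(@nbhs_normP R R^o); exists (e - `|x|) => /=; first by rewrite subr_gt0.
move=> y /= xy; rewrite E//; have := ler_distD x y 0; rewrite !subr0 (distrC y).
by move=> yr; apply: (le_lt_trans yr); rewrite -ltrBrDr.
Qed.

End Germs.

(** * Uniform Taylor expansions for elements of E^d *)

Section EdTaylor.
Context {R : realType} {s : nat}.
Local Notation X := (@tfun R s * 'rV[R]_s)%type.
Variables (Om : set 'rV[R]_s) (Rd : @tfun R s -> 'rV[R]_s -> R * R).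
Hypothesis E : Ed Om Rd.
Variables (rho : R) (x0 : 'rV[R]_s) (d0 : R).
Hypotheses (rho0 : 0 <= rho) (Hball : forall y, `|y - x0| < rho + d0 -> Om y).

(** A part of U(Om) with fixed room for support and point: unlike U(Om) itself, it is visibly stable
    under small moves in [Bd]. *)
Definition Vset : set X := [set c | [/\ A0 c.1, vanish rho c.1 & `|c.2 - x0| < d0]].

Definition fun2 (c : X) : R * R := Rd c.1 c.2.

Definition tcoef (j : nat) (c u : X) : R * R :=
  (j`!)%:R^-1 *: derive1n j (fun r : R => fun2 (c + r *: u)) 0.

Lemma Vset_Uset c : Vset c -> Uset Om c.1 c.2.
Proof.
move=> [A v cx]; split=> //; split.
  by apply: Hball; apply: (lt_le_trans cx); rewrite lerDr.
move=> xi /((supp_vanish _ _).1 v) xr /=; apply: Hball.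
by rewrite -addrA; apply: (le_lt_trans (ler_normD _ _)); exact: ler_ltD.
Qed.

Variables (M : seq 'I_s -> R) (mv : R).
Hypotheses (M0 : forall l, 0 <= M l) (mv0 : 0 <= mv).

Lemma Vset_open (q : R) a : 0 <= q -> Vset a -> exists2 r : R, 0 < r &
  forall e c, 0 <= e <= r -> around (Bd rho (fun l => q * M l) (q * mv)) a e c -> Vset c.
Proof.
move=> q0 [A v ax]; have [r r0 Hr] := @pick_small R [:: (q * mv, (d0 - `|a.2 - x0|) / 2)]
  ltac:(rewrite /= mulr_ge0//; lra).
exists r => // e c /andP[e0 er] ac; have [Ac vc cx] := around_Bd ac e0 A v; split=> //.
have := Hr e; rewrite e0 er => /(_ isT) /=; rewrite andbT => He.
have := ler_distD a.2 c.2 x0; lra.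
Qed.

Let cB q : 0 <= q -> absconvex (Bd rho (fun l => q * M l) (q * mv)).
Proof. by move=> q0; apply: Bd_absconvex => [l|]; rewrite mulr_ge0. Qed.

(** A square in the exponent beats every linear one, by [m * c <= m * m + c * c]. *)
Let eta_rapid (e : R) c : exists C, forall m, `|e * 2^-1 ^+ (m * m)| * 2 ^+ (m * c) <= C.
Proof.
exists (`|e| * 2 ^+ (c * c)) => m.
rewrite normrM -mulrA ler_wpM2l// ger0_norm ?exprn_ge0// exprVn mulrC ler_pdivrMr ?exprn_gt0//.
by rewrite -exprD ler_weXn2l ?ler1n//; nia.
Qed.

Let eta_sum (e : R) N : 0 <= e -> \sum_(m < N) `|e * 2^-1 ^+ (m * m)| <= 2 * e.
Proof.
move=> e0; apply: (@le_trans _ _ (\sum_(m < N) e * tt m)).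
  apply: ler_sum => m _; rewrite normrM (ger0_norm e0) ler_wpM2l// ger0_norm ?exprn_ge0//.
  rewrite /tt !exprVn lef_pV2 ?posrE ?exprn_gt0// ler_weXn2l ?ler1n//; nia.
rewrite -mulr_sumr mulrC ler_wpM2r//.
have S : \sum_(m < N) tt m = 2 - 2 * tt N :> R.
  elim: N => [|N IH]; first by rewrite big_ord0 /tt expr0; lra.
  by rewrite big_ord_recr /= IH /tt exprS; lra.
by rewrite S; have := @tt_gt0 R N; lra.
Qed.

(* Points [a + eta m *: b m] and directions [u m], met by one smooth curve at times [tt m]. *)
Lemma special_curve q a (e : R) (b u : nat -> X) : 0 <= q -> Vset a -> 0 < e ->
  (forall c, around (Bd rho (fun l => q * M l) (q * mv)) a (4 * e) c -> Vset c) ->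
  (forall m, Bd rho (fun l => q * M l) (q * mv) (b m)) ->
  (forall m, Bd rho (fun l => q * M l) (q * mv) (u m)) ->
  exists k : R -> R * R, (forall j r, is_derive r (1 : R) (derive1n j k) (derive1n j.+1 k r)) /\
    forall m, let eta := e * 2^-1 ^+ (m * m) in
      forall x, `|x| < eta * (tt m / 8) ->
      fun2 (a + eta *: b m + x *: u m) = k (eta^-1 * x + tt m).
Proof.
move=> q0 Va e0 HV Bb Bu; have [chi [sigma [p1 p2 p3 p4 p5]]] := @profiles R.
have e0' := ltW e0; have [Aa va _] := Va.
pose eta m : R := e * 2^-1 ^+ (m * m).
have qM0 l : 0 <= q * M l by rewrite mulr_ge0.
have qm0 : 0 <= q * mv by rewrite mulr_ge0.
exists (fun2 \o ccurve chi sigma a b u eta); split.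
  apply: scurve_derive1n.
  apply: (@Ed_ccurve _ _ chi sigma p1 p2 p3 p4 rho _ _ a b u eta qM0 qm0 Aa va Bb Bu (eta_rapid e) (2 * e)) => //.
  - by move=> N; exact: eta_sum.
  - exact: E.
  - move=> c; have -> : 2 * (2 * e) = 4 * e by ring.
    by move=> /HV; exact: Vset_Uset.
move=> m eta_m x; rewrite -/(eta m) in eta_m *.
have em0 : 0 < eta m by rewrite mulr_gt0// exprn_gt0// invr_gt0.
move=> xm /=; rewrite (ccurve_near p1 p2 p5 _ _ _ _ (m := m)).
  by rewrite addrK mulrA divff ?mul1r// gt_eqF.
by rewrite addrK normrM normfV (gtr0_norm em0) mulrC ler_pdivrMr// mulrC ltW.
Qed.

(** A special curve with all [b m] equal to 0 and constant [u] stays on the line through [a]; its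
    germ at time [tt 0] suffices. *)
Lemma line_smooth q a u : 0 < q -> Vset a -> Bd rho (fun l => q * M l) (q * mv) u ->
  forall j, is_derive (0 : R) (1 : R) (derive1n j (fun r : R => fun2 (a + r *: u)))
     (derive1n j.+1 (fun r : R => fun2 (a + r *: u)) 0).
Proof.
move=> q0 Va Bu j; have q0' := ltW q0; have [r r0 Hr] := Vset_open q0' Va.
have e0 : 0 < r / 4 by rewrite divr_gt0.
have Ha c : around (Bd rho (fun l => q * M l) (q * mv)) a (4 * (r / 4)) c -> Vset c.
  by apply: Hr; apply/andP; split; lra.
have [k [Dk Hk]] := special_curve q0' Va e0 Ha (fun=> (cB q0').1) (fun=> Bu).
have e8 : 0 < r / 4 * (tt 0 / 8) by rewrite mulr_gt0// divr_gt0// tt_gt0.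
have {}Hk x : `|x| < r / 4 * (tt 0 / 8) -> fun2 (a + x *: u) = k ((r / 4)^-1 * x + tt 0).
  by have := Hk 0%N x; rewrite /= expr0 mulr1 scaler0 addr0.
by have [] := germ_smooth e0 Dk Hk j (x := 0) _; rewrite ?normr0.
Qed.

(** Otherwise there are points [a + eta m *: b m] and directions [u m] at which the n-th derivative
    exceeds [m / eta m ^+ n]. The special curve passes them with velocity [eta m *: u m], so along
    it the n-th derivative exceeds [m] at time [tt m], although it is continuous at 0. *)
Lemma derivative_bound q a n : 0 < q -> Vset a -> exists2 r : R, 0 < r & exists C, forall c u,
  around (Bd rho (fun l => q * M l) (q * mv)) a r c -> Bd rho (fun l => q * M l) (q * mv) u ->
  `|derive1n n (fun r : R => fun2 (c + r *: u)) 0| <= C.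
Proof.
move=> q0 Va; have q0' := ltW q0; have [r r0 Hr] := Vset_open q0' Va.
have e0 : 0 < r / 4 by rewrite divr_gt0.
have Ha c : around (Bd rho (fun l => q * M l) (q * mv)) a (4 * (r / 4)) c -> Vset c.
  by apply: Hr; apply/andP; split; lra.
pose eta m : R := r / 4 * 2^-1 ^+ (m * m).
have eta0 m : 0 < eta m by rewrite mulr_gt0// exprn_gt0// invr_gt0.
apply: contrapT => H.
have {}H m : exists bu : X * X, [/\ Bd rho (fun l => q * M l) (q * mv) bu.1,
    Bd rho (fun l => q * M l) (q * mv) bu.2 &
    m%:R < `|eta m ^+ n *: derive1n n (fun r : R => fun2 (a + eta m *: bu.1 + r *: bu.2)) 0|].
  apply: contrapT => Hm; apply: H; exists (eta m) => //; exists (m%:R / eta m ^+ n) => c u ac Bu.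
  rewrite leNgt; apply/negP => Hc; apply: Hm.
  have [b Bb cb] := ac; exists (b, u); split => //=.
  have -> : a + eta m *: b = c by rewrite -cb addrC subrK.
  rewrite normrZ ger0_norm ?exprn_ge0 ?(ltW (eta0 m))// mulrC -ltr_pdivrMr ?exprn_gt0//.
have [bu Hbu] := choice H.
have [k [Dk Hk]] := special_curve q0' Va e0 Ha (b := fun m => (bu m).1) (u := fun m => (bu m).2)
  (fun m => let: And3 h _ _ := Hbu m in h) (fun m => let: And3 _ h _ := Hbu m in h).
have big m : m%:R < `|derive1n n k (tt m)|.
  have em : 0 < eta m * (tt m / 8) by rewrite mulr_gt0// divr_gt0// tt_gt0.
  have [h _] := germ_smooth (eta0 m) Dk (Hk m) n (x := 0) ltac:(by rewrite normr0).
  have [_ _] := Hbu m; rewrite h mulr0 add0r scalerA -exprMn divff ?gt_eqF//.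
  by rewrite expr1n scale1r.
have [rr rr0 Hrr] := is_derive_small_cont (Dk n 0).
set K := `|derive1n n.+1 k 0| + 1 in Hrr.
have K0 : 0 <= K by rewrite addr_ge0.
(* Large enough for [tt m <= rr] and for [m] to exceed the bound on the n-th derivative at times up
   to [rr]. *)
pose m := (maxn (Num.truncn rr^-1) (Num.truncn (`|derive1n n k 0| + K * rr))).+1.
have trr : tt m <= rr.
  have := @tt_le R m; rewrite -ler_pdivlMl ?ltr0n// mulr1 => h; apply: le_trans h _.
  rewrite -[leRHS]invrK lef_pV2 ?posrE ?ltr0n ?invr_gt0//.
  apply: ltW; apply: lt_le_trans (truncnS_gt _) _; rewrite ler_nat /m ltnS.
  by apply: leqW; exact: leq_maxl.
have := big m; rewrite ltNge => /negP; apply.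
have := Hrr (tt m); rewrite (gtr0_norm (tt_gt0 m)) trr add0r [_ *: (1 : R)]mulr1 => /(_ isT) h.
apply: le_trans (norm_le_sub _ (derive1n n k 0)) _; rewrite addrC.
apply: le_trans (_ : `|derive1n n k 0| + K * rr <= _).
  by rewrite lerD2l; apply: le_trans h _; rewrite ler_wpM2l.
apply: ltW; apply: lt_le_trans (truncnS_gt _) _; rewrite ler_nat.
by rewrite ltnS leq_maxr.
Qed.

Lemma dil_Bd (k q : R) u : 0 <= k -> k <= q -> dil k (Bd rho M mv) u ->
  Bd rho (fun l => q * M l) (q * mv) u.
Proof.
move=> k0 kq [b [h1 h2 h3 h4] ->]; split.
- have := A00_lin k 0 h1 h1; rewrite -[(k *: b).1]/(k *: b.1).
  by congr (A00 _); apply/funext => xi; rewrite -[LHS]/(k *: b.1 xi + 0 *: b.1 xi) scale0r addr0.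
- by move=> xi xr; rewrite -[LHS]/(k *: b.1 xi) h2// scaler0.
- move=> l xi; have [_ /(_ l xi Logic.I)] := smooth_lin k 0 h1.1.1 h1.1.1.
  rewrite scale0r addr0.
  have -> : (fun x => k *: b.1 x + 0 *: b.1 x) = (k *: b).1.
    by apply/funext => x; rewrite scale0r addr0.
  by move=> ->; rewrite normrZ ger0_norm//; apply: ler_pM.
- by rewrite -[(k *: b).2]/(k *: b.2) normrZ ger0_norm//; apply: ler_pM.
Qed.

(** One-variable Taylor expansion along each segment, with remainders made uniform by
    [derivative_bound]. *)
Lemma Ed_tay a : Vset a -> tay (Bd rho M mv) fun2 tcoef a.
Proof.
(* With [q = k + 1] one enlarged set contains both the original one, which measures base points, and
   its [k]-fold dilation, which contains the directions. *)
move=> Va n k k0; pose q := k + 1; have q0 : 0 < q by rewrite addr_gt0.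
have q0' := ltW q0; have kq : k <= q by rewrite lerDl.
have q1 : 1 <= q by rewrite lerDr ltW.
have [r1 r10 H1] := Vset_open q0' Va.
have [r2 r20 [C HC]] := derivative_bound n.+1 q0 Va.
pose r := Num.min (r1 / 2) (r2 / 2).
have r0 : 0 < r by rewrite lt_min !divr_gt0.
have rr1 : r <= r1 / 2 by rewrite ge_min lexx.
have rr2 : r <= r2 / 2 by rewrite ge_min lexx orbT.
have BB e c : 0 <= e -> around (Bd rho M mv) a e c ->
    around (Bd rho (fun l => q * M l) (q * mv)) a e c.
  move=> e0 [b Bb cb]; exists b => //; apply: (dil_Bd ler01 q1).
  by exists b; rewrite ?scale1r.
exists r => //; exists `|C| => // c u h cr uk hr.
have Bu := dil_Bd (ltW k0) kq uk.
have r0' := ltW r0.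
have ct t : `|t| <= `|h| -> around (Bd rho (fun l => q * M l) (q * mv)) a (r + r) (c + t *: u).
  move=> th; apply: (around_shift (cB q0') (k := 1)) => //.
  - by rewrite mulr1; exact: le_trans hr.
  - exact: BB.
  - by exists u; rewrite ?scale1r.
pose g (t : R) := fun2 (c + t *: u).
have shift t : (fun x : R => g (t + x)) = (fun x : R => fun2 ((c + t *: u) + x *: u)).
  by apply/funext => x; rewrite /g scalerDl addrA.
have := @taylor_bound _ n (fun j t => derive1n j g t) h `|C|.
apply => [j t th|t th].
  have Vt : Vset (c + t *: u).
    by apply: H1 (ct t th); apply/andP; split; lra.
  have := line_smooth q0 Vt Bu j; rewrite -shift => D.
  have D2 : is_derive (1 * t + (- t)) (1 : R) (derive1n j (fun x : R => g (t + x)))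
      (derive1n j.+1 (fun x : R => g (t + x)) 0).
    by rewrite mul1r subrr.
  have := is_derive_affine D2; rewrite scale1r -derive1n_shift addr0.
  congr (is_derive _ _ _ _); apply/funext => x.
  by rewrite -derive1n_shift mul1r addrC subrK.
apply: le_trans (ler_norm C); have := derive1n_shift g t 0 n.+1; rewrite addr0 => ->.
rewrite shift; apply: HC => //; apply: aroundS (ct t th) => //; first exact: cB.
  by lra.
by lra.
Qed.

End EdTaylor.

(** * Differentials as multilinear derivatives *)

Section Span.
Context {R : realType} {X : lmodType R} {W : normedModType R}.
Variables (B : set X).
Implicit Types us vs pre : seq X.
Hypothesis cB : absconvex B.

(** The linear span of [B]; stating multilinearity on it spares the bookkeeping of dilation
    factors. *)
Definition inspan (v : X) := exists2 k : R, 0 < k & dil k B v.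

Lemma inspan_dil (k : R) v : 0 <= k -> dil k B v -> inspan v.
Proof.
move=> k0 vk; exists (k + 1); first by rewrite ltr_wpDl.
by apply: (dilS cB) vk; rewrite !ger0_norm ?lerDl// addr_ge0.
Qed.

Lemma inspan0 : inspan 0.
Proof. by exists 1 => //; exact: dil0. Qed.

Lemma inspanD u v : inspan u -> inspan v -> inspan (u + v).
Proof.
move=> [k k0 uk] [l l0 vl]; exists (k + l); first by rewrite addr_gt0.
by apply: dilD => //; exact: ltW.
Qed.

Lemma inspanZ (c : R) u : inspan u -> inspan (c *: u).
Proof.
move=> [k k0 uk]; apply: (@inspan_dil (`|c| * k)); first by rewrite mulr_ge0// ltW.
by apply: (dilS cB) (dilZ c uk); rewrite !normrM normr_id.
Qed.

Lemma inspan_sum (I : Type) (r : seq I) (F : I -> X) : (forall i, inspan (F i)) ->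
  inspan (\sum_(i <- r) F i).
Proof.
move=> H; elim: r => [|i r IH]; first by rewrite big_nil; exact: inspan0.
by rewrite big_cons; exact: inspanD.
Qed.

Lemma inspan_common us : {in us, forall u, inspan u} ->
  exists2 k : R, 0 < k & {in us, forall u, dil k B u}.
Proof.
elim: us => [|u us IH] H; first by exists 1.
have [k k0 Hk] := IH (fun v vus => H v (mem_behead (s := u :: us) vus)).
have [l l0 Hl] := H u (mem_head u us).
exists (k + l); first by rewrite addr_gt0.
move=> v; rewrite inE => /predU1P[->|/Hk].
  by apply: (dilS cB) Hl; rewrite !gtr0_norm ?addr_gt0// lerDr ltW.
by apply: (dilS cB); rewrite !gtr0_norm ?addr_gt0// lerDl ltW.
Qed.

Variables (f : X -> W) (d : nat -> X -> X -> W) (a : X).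
Hypothesis T : tay B f d a.

Lemma Wf_permS us vs : {in us, forall u, inspan u} -> perm_eq us vs -> Wf d us a = Wf d vs a.
Proof. by move=> /inspan_common[k k0 uk]; exact: (Wf_perm cB T k0). Qed.

Lemma Wf_addS u v us : inspan u -> inspan v -> {in us, forall u, inspan u} ->
  Wf d (u + v :: us) a = Wf d (u :: us) a + Wf d (v :: us) a.
Proof.
move=> su sv sus; have : {in u :: v :: us, forall u, inspan u}.
  by move=> w; rewrite !inE => /or3P[/eqP ->|/eqP ->|/sus].
move=> /inspan_common[k k0 H]; apply: (Wf_add cB T k0).
- by apply: H; rewrite inE eqxx.
- by apply: H; rewrite !inE eqxx orbT.
- by move=> w wus; apply: H; rewrite !inE wus !orbT.
Qed.

Lemma Wf_scaleS (l : R) u us : inspan u -> {in us, forall u, inspan u} ->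
  Wf d (l *: u :: us) a = l *: Wf d (u :: us) a.
Proof.
move=> su sus; have : {in l *: u :: u :: us, forall u, inspan u}.
  by move=> w; rewrite !inE => /or3P[/eqP ->|/eqP ->//|/sus//]; exact: inspanZ.
move=> /inspan_common[k k0 H]; apply: (Wf_scale cB T k0).
- by apply: H; rewrite !inE eqxx orbT.
- by apply: H; rewrite inE eqxx.
- by move=> w wus; apply: H; rewrite !inE wus !orbT.
Qed.

Lemma Wf_zeroS us : {in us, forall u, inspan u} -> Wf d (0 :: us) a = 0.
Proof. by move=> sus; have := Wf_scaleS 0 inspan0 sus; rewrite !scale0r. Qed.

Lemma Wf_sum_head (l : seq X) us : {in l, forall u, inspan u} -> {in us, forall u, inspan u} ->
  Wf d (\sum_(v <- l) v :: us) a = \sum_(v <- l) Wf d (v :: us) a.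
Proof.
elim: l => [|v l IH] sl sus; first by rewrite !big_nil Wf_zeroS.
have sl' : {in l, forall u, inspan u} by move=> w wl; apply: sl; rewrite inE wl orbT.
rewrite !big_cons Wf_addS//; [by rewrite IH|by apply: sl; rewrite inE eqxx|].
by elim: (l) sl' => [|w l' IHl] H; rewrite ?big_nil ?big_cons; [exact: inspan0|];
   apply: inspanD; [apply: H; rewrite inE eqxx|apply: IHl => z zl; apply: H; rewrite inE zl orbT].
Qed.

Fixpoint choices (L : seq (seq X)) (t : seq X) : bool :=
  match L, t with
  | [::], [::] => true
  | l :: L', v :: t' => (v \in l) && choices L' t'
  | _, _ => false
  end.

(** Multilinear expansion with one summand chosen from each list; [pre] holds the choices already
    made. *)
Lemma Wf_sum_bound (L : seq (seq X)) pre (Q : R) :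
  {in L, forall l, {in l, forall u, inspan u}} -> {in pre, forall u, inspan u} ->
  (forall t, choices L t -> `|Wf d (pre ++ t) a| <= Q) ->
  `|Wf d (pre ++ [seq \sum_(v <- l) v | l <- L]) a| <= (\prod_(l <- L) size l)%:R * Q.
Proof.
elim: L pre => [|l L IH] pre sL spre HQ.
  by rewrite big_nil mul1r; apply: HQ.
have sl : {in l, forall u, inspan u} by apply: sL; rewrite inE eqxx.
have sL' : {in L, forall l, {in l, forall u, inspan u}}.
  by move=> m mL; apply: sL; rewrite inE mL orbT.
have ssum (m : seq X) : {in m, forall u, inspan u} -> inspan (\sum_(v <- m) v).
  elim: m => [|w m IHm] H; rewrite ?big_nil ?big_cons; first exact: inspan0.
  by apply: inspanD; [apply: H; rewrite inE eqxx|apply: IHm => z zl; apply: H; rewrite inE zl orbT].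
set us := [seq \sum_(v <- l) v | l <- L].
have sus : {in us, forall u, inspan u}.
  by move=> u /mapP[m mL ->]; apply: ssum; exact: sL'.
have spu : {in pre ++ us, forall u, inspan u}.
  by move=> u; rewrite mem_cat => /orP[/spre|/sus].
rewrite /= (@Wf_permS _ (\sum_(v <- l) v :: pre ++ us)); first last.
- by rewrite -cat1s perm_catCA.
- by move=> u; rewrite mem_cat inE => /or3P[/spre//|/eqP ->|/sus//]; exact: ssum.
rewrite Wf_sum_head// big_cons natrM -mulrA; apply: norm_sum_seq => v vl.
have -> : Wf d (v :: pre ++ us) a = Wf d (rcons pre v ++ us) a.
  apply: Wf_permS; last by rewrite cat_rcons -cat1s perm_catCA.
  by move=> u; rewrite inE => /predU1P[->|/spu//]; exact: sl.
apply: IH => // [u|t tL].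
  by rewrite mem_rcons inE => /predU1P[->|/spre//]; exact: sl.
by rewrite cat_rcons; apply: HQ; rewrite /= vl.
Qed.

End Span.

Lemma nodes_ind {R : realType} {X : lmodType R} (P : nat -> X -> Prop) (us : seq X) :
  P 0%N 0 -> (forall m w, P m w -> P m.+1 w) ->
  (forall m w u, u \in us -> P m w -> P m.+1 (w + u)) ->
  forall e, e \in nodes us -> P (size us) e.2.
Proof.
move=> P0 PS PD; have : {subset us <= us} by [].
elim: {1 3 4}us => [|u vs IH] sub e /=; first by rewrite inE => /eqP ->.
have {}IH := IH (fun v vv => sub v (mem_behead (s := u :: vs) vv)).
rewrite mem_cat => /orP[] /mapP[e' /IH he' ->] /=; last exact: PS.
by apply: PD => //; apply: sub; rewrite inE eqxx.
Qed.

(** A violating sequence would cluster at a point of [K], which is interior to [Om]. *)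
Lemma compact_thick {R : realType} {s : nat} (K Om : set 'rV[R]_s) : open Om -> compact K -> K `<=` Om ->
  exists2 r : R, 0 < r & forall x y, K x -> `|y - x| < r -> Om y.
Proof.
move=> oO cK KO; apply: contrapT => H.
have {}H m : exists xy : 'rV[R]_s * 'rV[R]_s, [/\ K xy.1, `|xy.2 - xy.1| < m.+1%:R^-1 & ~ Om xy.2].
  apply: contrapT => Hm; apply: H; exists m.+1%:R^-1; first by rewrite invr_gt0 ltr0n.
  by move=> x y Kx yx; apply: contrapT => nO; apply: Hm; exists (x, y).
have [xy Hxy] := choice H.
have [|x [Kx cx]] := cK ((fun m => (xy m).1) @ \oo) _.
  by exists 0%N => // m _; have [] := Hxy m.
have [r r0 Hr] := (rV_nbhsP _ _).1 (open_nbhs_nbhs (conj oO (KO x Kx))).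
have FA : (fmap (fun m => (xy m).1) \oo) [set (xy m).1 | m in [set m | (m.+1%:R^-1 : R) < r / 2]].
  exists (Num.truncn (r / 2)^-1) => // m /= hm; exists m => //=.
  rewrite -[ltRHS]invrK ltf_pV2 ?posrE ?ltr0n ?invr_gt0 ?divr_gt0//.
  by apply: lt_le_trans (truncnS_gt _) _; rewrite ler_nat ltnS.
have nB : nbhs x [set y : 'rV[R]_s | `|y - x| < r / 2].
  by apply/rV_nbhsP; exists (r / 2); rewrite ?divr_gt0.
have [_ [[m /= mr <-] yx]] := cx _ _ FA nB.
have [_ xym nO] := Hxy m; apply: nO; apply: Hr.
have xym2 := lt_trans xym mr; have := ler_distD (xy m).1 (xy m).2 x => h.
by apply: (le_lt_trans h); have := ltrD xym2 yx; rewrite -splitr.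
Qed.

Lemma norm_evec_le1 {R : realType} n (i : 'I_n) : `|evec i : 'rV[R]_n| <= 1.
Proof.
by apply: rV_norm_le => // j; rewrite !mxE; case: (_ && _); rewrite ?normr1 ?normr0.
Qed.

Lemma finite_bound {R : realType} {s : nat} (I : finType) (psi : I -> @tfun R s) :
  (forall i, testfun (psi i)) -> exists2 M : seq 'I_s -> R, forall l, 0 <= M l &
    forall i l xi, `|pders l (psi i) xi| <= M l.
Proof.
move=> t; have H (il : I * seq 'I_s) : exists M : R, 0 <= M /\ forall xi, `|pders il.2 (psi il.1) xi| <= M.
  by have [M M0 HM] := testfun_bound il.2 (t il.1); exists M.
have [M HM] := choice H; exists (fun l => \sum_i M (i, l)) => [l|i l xi].
  by rewrite sumr_ge0// => i _; have [] := HM (i, l).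
have [_ h] := HM (i, l); apply: le_trans (h xi) _.
by rewrite (bigD1 i)//= lerDl sumr_ge0// => j _; have [] := HM (j, l).
Qed.

Lemma dil_sum {R : realType} {X : lmodType R} (B : set X) k (F : 'I_k -> X) : absconvex B ->
  (forall i, dil 1 B (F i)) -> dil k%:R B (\sum_(i < k) F i).
Proof.
move=> cB; elim: k F => [|k IH] F Hd; first by rewrite big_ord0; exact: dil0.
by rewrite big_ord_recr mulrSr; apply: dilD => //; apply: IH.
Qed.

Lemma A00_sum {R : realType} {s : nat} (I : Type) (r : seq I) (F : I -> @tfun R s) :
  (forall i, A00 (F i)) -> A00 (\sum_(i <- r) F i).
Proof.
move=> H; elim: r => [|i r IH]; first by rewrite big_nil; exact: A00_zero.
by rewrite big_cons -[F i]scale1r -[X in _ + X]scale1r; exact: A00_lin.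
Qed.

Lemma sum_fct {R : realType} {s : nat} (I : Type) (r : seq I) (F : I -> @tfun R s) xi :
  (\sum_(i <- r) F i) xi = \sum_(i <- r) F i xi.
Proof. by elim: r => [|i r IH]; rewrite ?big_nil// !big_cons -IH. Qed.

Lemma vanish_sum {R : realType} {s : nat} (I : Type) (r : seq I) (F : I -> @tfun R s) rho :
  (forall i, vanish rho (F i)) -> vanish rho (\sum_(i <- r) F i).
Proof. by move=> H xi xr; rewrite sum_fct big1// => i _; exact: H. Qed.

(** * The quantity of the estimate as a multilinear derivative *)

Section Dquant.
Context {R : realType} {s : nat}.
Local Notation X := (@tfun R s * 'rV[R]_s)%type.

Lemma pairE (f g : @tfun R s) (x y : 'rV[R]_s) (h : R) :
  ((f, x) : X) + h *: (g, y) = (f + h *: g, x + h *: y).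
Proof. by []. Qed.

Lemma pair1_sum (I : Type) (r : seq I) (F : I -> @tfun R s) :
  \sum_(i <- r) ((F i, 0) : X) = (\sum_(i <- r) F i, 0).
Proof.
elim: r => [|i r IH]; rewrite ?big_nil// !big_cons IH.
by congr (_, _); rewrite -[LHS]/(0 + 0) addr0.
Qed.

Lemma Seps_add eps (f g : @tfun R s) : Seps eps (f + g) = Seps eps f + Seps eps g.
Proof. by apply/funext => x; rewrite /Seps -[(f + g) _]/(f _ + g _) scalerDr. Qed.

Lemma Seps_scale eps (c : R) (f : @tfun R s) : Seps eps (c *: f) = c *: Seps eps f.
Proof.
by apply/funext => x; rewrite /Seps -[(c *: f) _]/(c *: f _) !scalerA mulrC.
Qed.

Lemma Seps_sum eps (I : Type) (r : seq I) (F : I -> @tfun R s) :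
  Seps eps (\sum_(i <- r) F i) = \sum_(i <- r) Seps eps (F i).
Proof.
elim: r => [|i r IH]; last by rewrite !big_cons Seps_add IH.
by rewrite !big_nil; apply/funext => x; rewrite /Seps scaler0.
Qed.

Lemma affcombE k (phi : @tfun R s) (psi : 'I_k -> tfun s) (t : 'rV[R]_k) :
  affcomb phi psi t = phi + \sum_(i < k) t ord0 i *: psi i.
Proof.
apply/funext => xi; rewrite /affcomb -[RHS]/(phi xi + (\sum_(i < k) t ord0 i *: psi i) xi).
by rewrite sum_fct.
Qed.

Lemma Seps_affcomb k eps (phi : @tfun R s) (psi : 'I_k -> tfun s) (t : 'rV[R]_k) :
  Seps eps (affcomb phi psi t) = Seps eps phi + \sum_(i < k) t ord0 i *: Seps eps (psi i).
Proof.
rewrite affcombE Seps_add Seps_sum; congr (_ + _).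
by apply: eq_bigr => i _; exact: Seps_scale.
Qed.

Variables (Om : set 'rV[R]_s) (Rd : @tfun R s -> 'rV[R]_s -> R * R).
Hypothesis E : Ed Om Rd.
Variables (rho : R) (x0 : 'rV[R]_s) (d0 : R).
Hypotheses (rho0 : 0 <= rho) (Hball : forall y, `|y - x0| < rho + d0 -> Om y).

Lemma Wf_nil (c : X) : Wf (tcoef Rd) [::] c = fun2 Rd c.
Proof. by rewrite /Wf big_seq1 /= scale1r /tcoef fact0 invr1 scale1r /= scaler0 addr0. Qed.

Lemma Vset_affcomb k (phi : @tfun R s) (psi : 'I_k -> tfun s) t y :
  A0 phi -> vanish rho phi -> (forall i, A00 (psi i)) -> (forall i, vanish rho (psi i)) ->
  `|y - x0| < d0 -> Vset rho x0 d0 (phi + \sum_(i < k) (t i : R) *: psi i, y).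
Proof.
move=> Aphi vphi Apsi vpsi yx.
have AS : A00 (\sum_(i < k) t i *: psi i).
  apply: A00_sum => i; have := A00_lin (t i) 0 (Apsi i) (Apsi i).
  by rewrite scale0r addr0.
split => //=.
  by have := A0_lin 1 Aphi AS erefl; rewrite !scale1r.
move=> xi xr; rewrite -[LHS]/(phi xi + (\sum_(i < k) t i *: psi i) xi) vphi// add0r.
apply: vanish_sum xr => i z zr; by rewrite -[LHS]/(t i *: psi i z) vpsi// scaler0.
Qed.

Lemma open_ball_lt (z : 'rV[R]_s) (r : R) : open [set y : 'rV[R]_s | `|y - z| < r].
Proof.
rewrite openE => y /= yr; apply/rV_nbhsP; exists (r - `|y - z|); first by rewrite subr_gt0.
by move=> w wy /=; have := ler_distD y w z; rewrite ltrBrDr in wy => h; exact: le_lt_trans wy.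
Qed.

(** Two affine plots in succession: the slice in [t] at fixed [y], then [y |-> (S_eps phi, y)]
    applied to the resulting form. The inner identity must hold for all [y] near [x] before it can
    be differentiated. *)
Lemma dquantE k eps (alpha : 'I_s -> nat) (phi : @tfun R s) (psi : 'I_k -> tfun s) x : 0 < eps ->
  A0 phi -> vanish rho (Seps eps phi) -> (forall i, A00 (psi i)) ->
  (forall i, vanish rho (Seps eps (psi i))) -> `|x - x0| < d0 ->
  dquant Rd eps alpha phi psi x =
  Wf (tcoef Rd) ([seq ((0, evec i) : X) | i <- mlist alpha] ++
     [seq ((Seps eps (psi i), 0) : X) | i <- enum 'I_k]) (Seps eps phi, x).
Proof.
move=> e0 Aphi vphi Apsi vpsi xx0.
have Ap : A0 (Seps eps phi) by exact: A0_Seps.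
have Aq i : A00 (Seps eps (psi i)) by exact: A00_Seps.
(* Any set [Bd] containing the finitely many directions at hand will do; its bounds leave no trace
   in the identity. *)
have [M M0 HM] := finite_bound (fun i => (Aq i).1).
have cB := Bd_absconvex rho M0 (@ler01 R).
have ET := Ed_tay E rho0 Hball M0 (@ler01 R).
have Bpsi i : Bd rho M 1 (Seps eps (psi i), 0).
  by split => //=; rewrite normr0.
have Be v : `|v| <= 1 -> Bd rho M 1 (0, v).
  move=> v1; have [h1 h2 h3 _] := cB.1; split => //.
have k1 : 0 < k.+1%:R :> R by rewrite ltr0n.
have K1 (u : X) : Bd rho M 1 u -> dil k.+1%:R (Bd rho M 1) u.
  by move=> Bu; apply: (dilS cB (k := 1)); [rewrite normr1 normr_nat ler1n|exists u; rewrite ?scale1r].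
set us := [seq ((Seps eps (psi i), 0) : X) | i <- enum 'I_k].
have usk : {in us, forall u, dil k.+1%:R (Bd rho M 1) u}.
  by move=> u /mapP[i _ ->]; exact/K1/Bpsi.
have inner y : `|y - x0| < d0 -> pders (enum 'I_k) (fun t => Rd (Seps eps (affcomb phi psi t)) y) 0 =
    Wf (tcoef Rd) us (Seps eps phi, y).
  move=> yx0; pose p (t : 'rV[R]_k) : X := (Seps eps phi + \sum_(i < k) t ord0 i *: Seps eps (psi i), y).
  pose q (t : 'rV[R]_k) : X := (\sum_(i < k) t ord0 i *: Seps eps (psi i), 0).
  have pE : (fun t => Rd (Seps eps (affcomb phi psi t)) y) = fun t => Wf (tcoef Rd) [::] (p t).
    by apply/funext => t; rewrite Wf_nil Seps_affcomb.
  have OV (z : 'rV[R]_k) : setT z -> Vset rho x0 d0 (p z) by move=> _; exact: Vset_affcomb.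
  have Hp z h v : p (z + h *: v) = p z + h *: q v.
    rewrite /p /q pairE scaler0 addr0; congr (_, _).
    rewrite -addrA; congr (_ + _); rewrite scaler_sumr -big_split; apply: eq_bigr => i _.
    by rewrite !mxE scalerDl scalerA.
  have Hq (v : 'rV[R]_k) : `|v| <= 1 -> dil k.+1%:R (Bd rho M 1) (q v).
    move=> v1; rewrite /q; have -> : (\sum_(i < k) v ord0 i *: Seps eps (psi i), 0) =
        \sum_(i < k) v ord0 i *: ((Seps eps (psi i), 0) : X).
      rewrite -pair1_sum; apply: eq_bigr => i _.
      by congr (_, _); rewrite scaler0.
    have : dil k%:R (Bd rho M 1) (\sum_(i < k) v ord0 i *: ((Seps eps (psi i), 0) : X)).
      have Hd i : dil 1 (Bd rho M 1) (v ord0 i *: ((Seps eps (psi i), 0) : X)).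
        apply: (dilS cB (k := v ord0 i)); last by exists (Seps eps (psi i), 0).
        by rewrite normr1; exact: le_trans (rV_coord_le _ _) v1.
      exact: dil_sum.
    by apply: (dilS cB); rewrite !normr_nat ler_nat.
  have n0 : {in [::], forall u : X, dil k.+1%:R (Bd rho M 1) u} by [].
  rewrite pE (pders_plot cB ET openT OV k1 Hp Hq n0)// cats0; congr (Wf _ _ _); last first.
    rewrite /p big1 ?addr0// => i _; by rewrite mxE scale0r.
  apply: eq_map => i; rewrite /q; congr (_, _).
  rewrite (bigD1 i)//= big1 ?addr0 => [|j ji]; rewrite !mxE eqxx ?eqxx ?scale1r//=.
  by rewrite (negPf ji) scale0r.
rewrite /dquant /pder.
rewrite (@pders_local _ _ _ [set y : 'rV[R]_s | `|y - x0| < d0] _ (fun y => Wf (tcoef Rd) us (Seps eps phi, y)))//; last exact: open_ball_lt.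
have Hp (z : 'rV[R]_s) h v : ((Seps eps phi, z + h *: v) : X) = (Seps eps phi, z) + h *: (0, v).
  by rewrite pairE scaler0 addr0.
have Hq (v : 'rV[R]_s) : `|v| <= 1 -> dil k.+1%:R (Bd rho M 1) (0, v).
  by move=> v1; exact/K1/Be.
have OV (z : 'rV[R]_s) : `|z - x0| < d0 -> Vset rho x0 d0 (Seps eps phi, z) by [].
by rewrite (pders_plot cB ET (@open_ball_lt x0 d0) OV k1 Hp Hq usk).
Qed.

End Dquant.

(** * Gluing test functions along eps *)

Section Cn.
Context {R : realType} {n : nat}.

(** Products are handled by induction on the order [k]; a closed formula over words would require
    the Leibniz sum over all subwords. *)
Fixpoint Cn (k : nat) {W : normedModType R} (O : set 'rV[R]_n) (f : 'rV[R]_n -> W) : Prop :=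
  (forall z, O z -> {for z, continuous f}) /\
  if k is k'.+1 then exists2 D : 'I_n -> 'rV[R]_n -> W,
    forall i z, O z -> is_derive z (evec i) f (D i z) & forall i, Cn k' O (D i)
  else True.

Lemma smooth_Cn {W : normedModType R} O (f : 'rV[R]_n -> W) k : smooth_on O f -> Cn k O f.
Proof.
move=> sf; have [D C] := smooth_onP sf.
suff : forall l, Cn k O (pders l f) by move=> /(_ [::]).
elim: k => [|k IH] l; split=> //; first by move=> z; exact: C.
  by move=> z; exact: C.
by exists (fun i => pders (i :: l) f) => // i z; exact: D.
Qed.

Lemma Cn_cont {W : normedModType R} O (f : 'rV[R]_n -> W) k : Cn k O f ->
  forall z, O z -> {for z, continuous f}.
Proof. by case: k => [|k] []. Qed.

Lemma continuous_local {W : normedModType R} O (f g : 'rV[R]_n -> W) z : open O ->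
  (forall z, O z -> f z = g z) -> O z -> {for z, continuous f} -> {for z, continuous g}.
Proof.
move=> oO fg Oz Cf; rewrite /prop_for /continuous_at -fg//.
apply: cvg_trans Cf; apply: (@near_eq_cvg _ _ (nbhs z)).
by apply: filterS (open_nbhs_nbhs (conj oO Oz)) => y /fg.
Qed.

Lemma Cn_local {W : normedModType R} O (f g : 'rV[R]_n -> W) k : open O ->
  (forall z, O z -> f z = g z) -> Cn k O f -> Cn k O g.
Proof.
move=> oO fg; case: k => [|k] [C H]; split=> //.
- by move=> z Oz; exact: (continuous_local oO fg Oz (C z Oz)).
- by move=> z Oz; exact: (continuous_local oO fg Oz (C z Oz)).
case: H => D HD HC; exists D => // i z Oz.
apply: near_eq_is_derive (HD i z Oz).
by apply: filterS (open_nbhs_nbhs (conj oO Oz)) => y /fg.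
Qed.

Lemma Cn_smooth {W : normedModType R} O (f : 'rV[R]_n -> W) : open O ->
  (forall k, Cn k O f) -> smooth_on O f.
Proof.
move=> oO H; split=> // l.
have {}H : forall k, Cn k O (pders l f).
  elim: l => [//|i l IH] k /=.
  have [_ [D HD HC]] := IH k.+1; apply: (Cn_local oO _ (HC i)) => z Oz.
  by case: (HD i z Oz) => _ <-.
move=> x Ox; split=> [i|]; last exact: (Cn_cont (H 0%N)).
by have [_ [D HD _]] := H 1%N; case: (HD i x Ox).
Qed.

Lemma CnW {W : normedModType R} O (f : 'rV[R]_n -> W) k : Cn k.+1 O f -> Cn k O f.
Proof.
elim: k f => [|k IH] f [C [D HD HC]]; split=> //.
by exists D => // i; exact: IH.
Qed.

Lemma Cn_add {W : normedModType R} O (f g : 'rV[R]_n -> W) k : Cn k O f -> Cn k O g ->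
  Cn k O (fun z => f z + g z).
Proof.
elim: k f g => [|k IH] f g Hf Hg; split=> //.
- by move=> z Oz; exact: (continuousD (Cn_cont Hf Oz) (Cn_cont Hg Oz)).
- by move=> z Oz; exact: (continuousD (Cn_cont Hf Oz) (Cn_cont Hg Oz)).
have [_ [D HD HC]] := Hf; have [_ [D' HD' HC']] := Hg.
exists (fun i z => D i z + D' i z) => [i z Oz|i]; last exact: (IH _ _ (HC i) (HC' i)).
exact: (is_deriveD (HD i z Oz) (HD' i z Oz)).
Qed.

Lemma Cn_scale {W : normedModType R} O (a : 'rV[R]_n -> R) (g : 'rV[R]_n -> W) k :
  Cn k O a -> Cn k O g -> Cn k O (fun z => a z *: g z).
Proof.
have CC (f : 'rV[R]_n -> R) (h : 'rV[R]_n -> W) (z : 'rV[R]_n) : {for z, continuous f} -> {for z, continuous h} ->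
    {for z, continuous (fun z => f z *: h z)}.
  by move=> Cf Ch; apply: (@cvgZ _ _ _ (nbhs z) _ f h); [exact: Cf|exact: Ch].
elim: k a g => [|k IH] a g Ha Hg; split=> //.
- by move=> z Oz; exact: (CC _ _ _ (Cn_cont Ha Oz) (Cn_cont Hg Oz)).
- by move=> z Oz; exact: (CC _ _ _ (Cn_cont Ha Oz) (Cn_cont Hg Oz)).
have [_ [D HD HC]] := Ha; have [_ [D' HD' HC']] := Hg.
exists (fun i z => D i z *: g z + a z *: D' i z) => [i z Oz|i].
  exact: (is_derive_scale_fun (HD i z Oz) (HD' i z Oz)).
by apply: Cn_add; [exact: (IH _ _ (HC i) (CnW Hg))|exact: (IH _ _ (CnW Ha) (HC' i))].
Qed.

Lemma smooth_scale_fun {W : normedModType R} O (a : 'rV[R]_n -> R) (g : 'rV[R]_n -> W) :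
  smooth_on O a -> smooth_on O g -> smooth_on O (fun z => a z *: g z).
Proof.
move=> sa sg; apply: Cn_smooth; first exact: sa.1.
by move=> k; apply: Cn_scale; exact: smooth_Cn.
Qed.

Lemma smooth_add {W : normedModType R} O (f g : 'rV[R]_n -> W) :
  smooth_on O f -> smooth_on O g -> smooth_on O (fun z => f z + g z).
Proof.
move=> sf sg; apply: Cn_smooth; first exact: sf.1.
by move=> k; apply: Cn_add; exact: smooth_Cn.
Qed.

Lemma smooth_coord_comp O (k : nat -> R -> R) (i : 'I_n) (l t : R) : open O ->
  (forall j x, is_derive x (1 : R) (k j) (k j.+1 x)) ->
  smooth_on O (fun z : 'rV[R]_n => k 0%N (l * z ord0 i + t)).
Proof.
move=> oO Dk.
pose F (q : seq 'I_n) (z : 'rV[R]_n) : R :=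
  if all (pred1 i) q then l ^+ size q * k (size q) (l * z ord0 i + t) else 0.
have F0 : F [::] = (fun z : 'rV[R]_n => k 0%N (l * z ord0 i + t)).
  by apply/funext => z; rewrite /F /= expr0 mul1r.
rewrite -F0; apply: smooth_family => // [q j z _|q z _].
  rewrite /F /=; case: (boolP (all _ q)) => aq; last by rewrite andbF; exact: is_derive_cst.
  have D1 := is_derive_affine (Dk (size q) (l * z ord0 i + t)).
  have D2 := is_derive_scalev (j == i)%:R D1.
  have D3 : is_derive z (evec j) (fun z : 'rV[R]_n => k (size q) (l * z ord0 i + t))
      ((j == i)%:R *: (l *: k (size q).+1 (l * z ord0 i + t))).
    apply: (@is_derive_precomp _ _ _ _ (fun r => k (size q) (l * r + t)) (fun y : 'rV[R]_n => y ord0 i) z (evec j) ((j == i)%:R *: (1 : R))) => //.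
    by move=> h; rewrite !mxE -[h *: _]/(h * ((j == i)%:R * 1)) mulr1 eqxx eq_sym.
  have D4 := is_deriveZ (l ^+ size q) D3.
  apply: (is_derive_eq D4); rewrite andbT.
  case: eqP => _; rewrite ?scale0r ?scaler0// scale1r -![_ *: _]/(_ * _) exprS; ring.
rewrite /F; case: (boolP (all _ q)) => aq; last exact: cst_continuous.
have C1 : {for z, continuous (fun y : 'rV[R]_n => y ord0 i)} by exact: coord_continuous.
have C2 : {for z ord0 i, continuous (fun r => l ^+ size q * k (size q) (l * r + t))}.
  apply: differentiable_continuous; apply/derivable1_diffP.
  by have [] := is_deriveZ (l ^+ size q) (is_derive_affine (Dk (size q) (l * z ord0 i + t))).
exact: (continuous_comp C1 C2).
Qed.

Lemma smooth_coord O (i : 'I_n) (c : R) : open O ->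
  smooth_on O (fun z : 'rV[R]_n => z ord0 i - c).
Proof.
move=> oO; pose k j (x : R) : R := if j is 0%N then x else if j is 1%N then 1 else 0.
have Dk j x : is_derive x (1 : R) (k j) (k j.+1 x).
  by case: j => [|[|j]]; [exact: is_derive_id|exact: is_derive_cst|exact: is_derive_cst].
have := smooth_coord_comp i 1 (- c) oO Dk.
by congr (smooth_on _ _); apply/funext => z; rewrite /k mul1r.
Qed.

Lemma smooth_zero {W : normedModType R} O : open O -> smooth_on O (fun _ : 'rV[R]_n => 0 : W).
Proof.
move=> oO.
have D (l : seq 'I_n) i (z : 'rV[R]_n) : O z -> is_derive z (evec i) (fun _ => 0 : W) 0.
  by move=> _; exact: is_derive_cst.
have C (l : seq 'I_n) (z : 'rV[R]_n) : O z -> {for z, continuous (fun _ : 'rV[R]_n => 0 : W)}.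
  by move=> _; exact: cst_continuous.
exact: (smooth_family (F := fun _ _ => 0) oO D C).
Qed.

Lemma smooth_sum {W : normedModType R} O N (F : nat -> 'rV[R]_n -> W) : open O ->
  (forall m, smooth_on O (F m)) -> smooth_on O (fun z => \sum_(m < N) F m z).
Proof.
move=> oO H; elim: N => [|N IH].
  by have := smooth_zero (W := W) oO; congr (smooth_on _ _); apply/funext => z; rewrite big_ord0.
by have := smooth_add IH (H N); congr (smooth_on _ _); apply/funext => z; rewrite big_ord_recr.
Qed.

Lemma smooth_onS {W : normedModType R} O O' (f : 'rV[R]_n -> W) : open O' -> O' `<=` O ->
  smooth_on O f -> smooth_on O' f.
Proof. by move=> oO' sub [_ H]; split=> // l x /sub; exact: H. Qed.

Lemma smooth_on_local {W : normedModType R} O (f : 'rV[R]_n -> W) : open O ->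
  (forall z, O z -> exists O' g, [/\ O' z, smooth_on O' g & forall y, O' y -> f y = g y]) ->
  smooth_on O f.
Proof.
move=> oO H; split=> // l x Ox; have [P [g [Px sg fg]]] := H x Ox.
have E := pders_local l sg.1 fg.
have [_ Hs] := sg; have [D C] := Hs l x Px.
have nE : \forall y \near x, pders l g y = pders l f y.
  by apply: filterS (open_nbhs_nbhs (conj sg.1 Px)) => y /E.
split=> [i|]; first exact: near_eq_derivable nE (D i).
rewrite /prop_for /continuous_at E//.
apply: cvg_trans C; apply: (@near_eq_cvg _ _ (nbhs x)).
by apply: filterS nE => y.
Qed.

End Cn.

(** * Bounded sets of test functions, words and multi-indices *)

Section Bounded.
Context {R : realType}.

(** Translates between the words used in the proofs and the multi-indices of the statement. *)
Lemma perm_mlist {n} (l : seq 'I_n) : perm_eq l (mlist (fun i => count_mem i l)).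
Proof.
apply/allP => i _ /=; apply/eqP.
rewrite /mlist count_flatten -map_comp.
rewrite (eq_map (g := fun j => if j == i then count_mem i l else 0%N)).
  by rewrite sumnE big_map big_enum /= -big_mkcond big_pred1_eq.
by move=> j /=; rewrite count_nseq /=; case: eqP => [->|_]; rewrite ?mul1n.
Qed.

(** The norm on pairs is the maximum norm; this compares it with the modulus. *)
Lemma cabs_norm (z : R * R) : `|z| <= cabs z <= 2 * `|z|.
Proof.
rewrite /cabs norm_pairE; apply/andP; split.
  rewrite ge_max -!sqrtr_sqr !ler_wsqrtr// ?lerDl ?lerDr sqr_ge0//.
rewrite -[leRHS]ger0_norm; last by rewrite mulr_ge0// le_max normr_ge0.
rewrite -sqrtr_sqr ler_wsqrtr//.
have h1 : z.1 ^+ 2 <= (Num.max `|z.1| `|z.2|) ^+ 2.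
  by rewrite -[z.1 ^+ 2]real_normK ?num_real// ler_sqr ?nnegrE ?le_max ?normr_ge0 ?lexx.
have h2 : z.2 ^+ 2 <= (Num.max `|z.1| `|z.2|) ^+ 2.
  by rewrite -[z.2 ^+ 2]real_normK ?num_real// ler_sqr ?nnegrE ?le_max ?normr_ge0 ?lexx ?orbT.
have h3 := sqr_ge0 (Num.max `|z.1| `|z.2|); rewrite exprMn; lra.
Qed.

Lemma pders_Wf {n} (O : set 'rV[R]_n) (f : 'rV[R]_n -> R * R) l z : smooth_on O f -> O z ->
  pders l f z = Wf (fun j c u => (j`!)%:R^-1 *: Dw f j u [::] c) (map evec l) z.
Proof.
move=> sf Oz.
pose d := fun j c u => (j`!)%:R^-1 *: Dw f j u [::] c.
have T x : O x -> tay unit_ball f d x by exact: smooth_tay.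
have Hp (y : 'rV[R]_n) (h : R) v : id (y + h *: v) = id y + h *: id v by [].
have Hq (v : 'rV[R]_n) : `|v| <= 1 -> dil 1 unit_ball (id v) by move=> ?; apply/dil_unit_ball.
have us0 : {in ([::] : seq 'rV[R]_n), forall u, dil 1 unit_ball u} by [].
have := @pders_plot _ _ _ _ f d O absconvex_unit_ball T _ O id id 1 sf.1 (fun _ h => h) ltr01 Hp Hq [::] us0 l z Oz.
rewrite cats0 => <-; congr (pders l _ z); apply/funext => y.
by rewrite /Wf /= big_seq1 /= /d fact0 invr1 !scale1r.
Qed.

(** Schwarz's theorem, obtained from the symmetry of [Wf]. *)
Lemma pders_perm {n} (O : set 'rV[R]_n) (f : 'rV[R]_n -> R * R) l l' z : smooth_on O f -> O z ->
  perm_eq l l' -> pders l f z = pders l' f z.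
Proof.
move=> sf Oz ll; rewrite !(pders_Wf _ sf)//.
apply: (Wf_perm absconvex_unit_ball (smooth_tay sf Oz) (k := 1)) => //; last exact: perm_map.
by move=> _ /mapP[i _ ->]; apply/dil_unit_ball => //; exact: norm_evec_le1.
Qed.

Context {s : nat}.
Implicit Types (f g : @tfun R s) (rho : R) (M : seq 'I_s -> R).

(** Boundedness in D through explicit data, indexed by words, which can be added and scaled; the
    next two lemmas relate it to [boundedD]. *)
Definition vbnd rho M : set (@tfun R s) :=
  [set f | [/\ testfun f, vanish rho f & forall l xi, `|pders l f xi| <= M l]].

Lemma boundedD_vbnd (B : set (@tfun R s)) : boundedD B ->
  exists2 rho, 0 <= rho & exists2 M, (forall l, 0 <= M l) & B `<=` vbnd rho M.
Proof.
move=> [tB [L [cL [sL HB]]]].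
have [rho rho0 hL] := compact_norm_bound cL.
have /choice [M HM] : forall l : seq 'I_s, exists M : R, forall f xi, B f -> cabs (pder (fun i => count_mem i l) f xi) <= M.
  by move=> l; exact: HB.
exists rho => //; exists (fun l => `|M l|) => // f Bf; split=> [||l xi]; first exact: tB.
  by apply/supp_vanish => xi /(sL _ Bf) /hL.
rewrite (pders_perm (tB f Bf).1 _ (perm_mlist l))//.
have /andP[h _] := cabs_norm (pder (fun i => count_mem i l) f xi).
apply: (le_trans h); apply: (le_trans (HM l f xi Bf)); exact: ler_norm.
Qed.

Lemma vbnd_boundedD (B : set (@tfun R s)) rho M : B `<=` vbnd rho M -> boundedD B.
Proof.
move=> H; split=> [f /H[]//|].
exists [set x | `|x - 0| <= rho]; split; first exact: compact_norm_ball.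
split=> [f /H[_ /supp_vanish v _] xi /v|beta]; first by rewrite /= subr0.
exists (2 * M (mlist beta)) => f xi /H[_ _ /(_ (mlist beta) xi) h].
by have /andP[_ h'] := cabs_norm (pder beta f xi); apply: (le_trans h'); rewrite ler_wpM2l.
Qed.

Lemma vbnd_lin f g (a b : R) rho M M' : vbnd rho M f -> vbnd rho M' g ->
  vbnd rho (fun l => `|a| * M l + `|b| * M' l) (a *: f + b *: g).
Proof.
move=> [tf vf Mf] [tg vg Mg]; split; first exact: testfun_lin.
  by move=> xi h; rewrite -[LHS]/(a *: f xi + b *: g xi) (vf _ h) (vg _ h) !scaler0 addr0.
move=> l xi; rewrite (smooth_lin a b tf.1 tg.1).2//.
by apply: (le_trans (ler_normD _ _)); rewrite !normrZ lerD// ler_wpM2l.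
Qed.

Lemma vbndS f rho M M' : (forall l, M l <= M' l) -> vbnd rho M f -> vbnd rho M' f.
Proof. by move=> H [? ? h]; split=> // l xi; exact: le_trans (h l xi) (H l). Qed.

Lemma pders_affine_coord {W : normedModType R} (a b : W) (i0 : 'I_s) (c : R) l x :
  pders l (fun y : 'rV[R]_s => a + (y ord0 i0 - c) *: b) x =
  match l with [::] => a + (x ord0 i0 - c) *: b | [:: i] => (i == i0)%:R *: b | _ => 0 end.
Proof.
pose F (l : seq 'I_s) (x : 'rV[R]_s) : W :=
  match l with [::] => a + (x ord0 i0 - c) *: b | [:: i] => (i == i0)%:R *: b | _ => 0 end.
apply: (@pders_family _ _ _ setT F) => //; first exact: openT.
move=> {}l i z _; case: l => [|j [|j' l]]; try exact: is_derive_cst.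
apply: is_derive_small => e e0; exists 1 => // h _.
rewrite /F !mxE eqxx eq_sym /= opprD addrACA subrr add0r -scalerBl scalerA -scalerBl.
rewrite (_ : _ - _ - _ = 0) ?scale0r ?normr0 ?mulr_ge0 ?(ltW e0)//; ring.
Qed.

End Bounded.

(** * Gluing a sequence of test functions into one family *)

Section Glue.
Context {R : realType} {s : nat}.
Variables (i0 : 'I_s) (e : nat -> R) (phi psi : nat -> @tfun R s) (x : nat -> 'rV[R]_s).
Variables (chi : nat -> R -> R).
Hypotheses (Dchi : forall n t, is_derive t (1 : R) (chi n) (chi n.+1 t))
  (chi1 : chi 0%N 0 = 1) (chi01 : forall t, 0 <= chi 0%N t <= 1)
  (chi0 : forall n t, 1 <= `|t| -> chi n t = 0).
Hypotheses (e0 : e 0%N <= 1) (epos : forall m, 0 < e m) (ehalf : forall m, e m.+1 <= e m / 2).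

Lemma e_tt m : e m <= tt m.
Proof.
elim: m => [|m IH]; first by rewrite /tt expr0.
by apply: (le_trans (ehalf m)); rewrite /tt exprSr ler_wpM2r.
Qed.

Lemma e_lt m k : (m < k)%N -> e k <= e m / 2.
Proof.
move=> mk; rewrite -(subnKC mk); elim: (k - m.+1)%N => [|j IH]; first by rewrite addn0.
rewrite addnS; apply: (le_trans (ehalf _)); apply: le_trans IH.
by rewrite ler_pdivrMr// ler_peMr ?(ltW (epos _))// ler1n.
Qed.

Definition wdw m (t : R) : R := chi 0%N (4 / e m * t + (- 4)).

Lemma wdw0 m t : `|t - e m| >= e m / 4 -> wdw m t = 0.
Proof.
move=> h; rewrite /wdw chi0//.
have -> : 4 / e m * t + (- 4) = (t - e m) * (4 / e m).
  by field; rewrite (gt_eqF (epos m)).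
rewrite normrM (ger0_norm (x := 4 / e m)) ?divr_ge0 ?(ltW (epos m))//.
by rewrite mulrA ler_pdivlMr// mul1r; lra.
Qed.

Lemma wdw1 m : wdw m (e m) = 1.
Proof. by rewrite /wdw divfK ?subrr// (gt_eqF (epos m)). Qed.

Lemma wdw_other m k t : m != k -> `|t - e m| < e m / 4 -> wdw k t = 0.
Proof.
move=> mk; rewrite ltr_norml => /andP[h1 h2]; apply: wdw0; rewrite leNgt; apply/negP.
rewrite ltr_norml => /andP[h3 h4].
case: (ltnP m k) => [/e_lt h|]; first by have := epos m; have := epos k; lra.
rewrite leq_eqVlt eq_sym (negPf mk) /= => /e_lt h.
by have := epos m; have := epos k; lra.
Qed.

(** Halving the argument of [Nwin] makes one cutoff valid for all times above [t' / 2], so the sum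
    in [glue] is locally finite. *)
Lemma wdw_late m t t' : 0 < t' -> t' < 2 * t -> (Nwin (t' / 2) <= m)%N -> wdw m t = 0.
Proof.
move=> t'0 t't; rewrite /Nwin divr_gt0// => Nm; apply: wdw0; rewrite leNgt; apply/negP.
rewrite ltr_norml => /andP[h1 h2].
have t20 : 0 < t' / 2 by rewrite divr_gt0.
have := truncnS_gt (2 / (t' / 2)); rewrite ltr_pdivrMr// => h3.
have h4 : (Num.truncn (2 / (t' / 2))).+1%:R * tt m <= 1 :> R.
  by apply: le_trans (tt_le m); rewrite ler_wpM2r ?(ltW (tt_gt0 _))// ler_nat ltnW.
have h5 : (Num.truncn (2 / (t' / 2))).+1%:R * (t' / 2) <= (Num.truncn (2 / (t' / 2))).+1%:R * ((5 / 4) * tt m) :> R.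
  by rewrite ler_wpM2l//; have := e_tt m; lra.
lra.
Qed.

(** An increment over the background [phi 0], of integral 0, so that any multiple of it may be added
    within A_0. *)
Definition incr m (y : 'rV[R]_s) : @tfun R s := phi m - phi 0%N + (y ord0 i0 - x m ord0 i0) *: psi m.
(* The windows [|t - e m| < e m / 4] are pairwise disjoint by [ehalf]: at most one summand is nonzero. *)
Definition glue (t : R) (y : 'rV[R]_s) : @tfun R s :=
  phi 0%N + \sum_(m < Nwin (t / 2)) wdw m t *: incr m y.

Lemma glue_near N t y : 0 < t -> (forall m, (N <= m)%N -> wdw m t = 0) ->
  glue t y = phi 0%N + \sum_(m < N) wdw m t *: incr m y.
Proof.
move=> t0 HN; rewrite /glue; congr (_ + _).
have H (P Q : nat) : (P <= Q)%N -> (forall m, (P <= m)%N -> wdw m t = 0) ->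
    \sum_(m < P) wdw m t *: incr m y = \sum_(m < Q) wdw m t *: incr m y.
  move=> PQ HP; rewrite -(subnKC PQ) big_split_ord /= [X in _ = _ + X]big1 ?addr0// => i _.
  by rewrite HP ?scale0r ?leq_addr.
have HQ m : (Nwin (t / 2) <= m)%N -> wdw m t = 0 by apply: wdw_late => //; lra.
by case/orP: (leq_total N (Nwin (t / 2))) => h; [rewrite -(H _ _ h)|rewrite -(H _ _ h)].
Qed.

Lemma glue_active m t y : 0 < t -> `|t - e m| < e m / 4 -> glue t y = phi 0%N + wdw m t *: incr m y.
Proof.
move=> t0 h; rewrite (glue_near (N := (Nwin (t / 2) + m).+1))//; last first.
  by move=> k hk; apply: (@wdw_late _ _ t) => //; [lra|lia].
have mN : (m < (Nwin (t / 2) + m).+1)%N by lia.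
rewrite (bigD1 (Ordinal mN))//= big1 ?addr0// => k km.
by rewrite (wdw_other _ h) ?scale0r// eq_sym; apply: contraNneq km => km; apply/eqP/val_inj.
Qed.

Lemma glue_idle t y : (forall m, ~ `|t - e m| < e m / 4) -> glue t y = phi 0%N.
Proof.
move=> H; rewrite /glue big1 ?addr0// => m _; rewrite wdw0 ?scale0r// leNgt.
by apply/negP; exact: H.
Qed.

Lemma glue_at m y : glue (e m) y = phi m + (y ord0 i0 - x m ord0 i0) *: psi m.
Proof.
rewrite (glue_active (m := m)) ?wdw1//; last by rewrite subrr normr0 divr_gt0.
by rewrite scale1r /incr addrA (addrC (phi 0%N)) subrK.
Qed.

Hypotheses (Aphi : forall m, A0 (phi m)) (Apsi : forall m, A00 (psi m)).

Lemma incr_A00 m y : A00 (incr m y).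
Proof.
by have := A00_lin 1 (y ord0 i0 - x m ord0 i0) (A0_sub (Aphi m) (Aphi 0%N)) (Apsi m); rewrite scale1r.
Qed.

Lemma glue_A0 t y : A0 (glue t y).
Proof.
have h : A00 (\sum_(m < Nwin (t / 2)) wdw m t *: incr m y).
  apply: A00_sum => m; have := A00_lin (wdw m t) 0 (incr_A00 m y) (incr_A00 m y).
  by rewrite scale0r addr0.
by have := A0_lin (a := 1) 1 (Aphi 0%N) h erefl; rewrite !scale1r.
Qed.

Lemma glue_smooth : smooth_on [set z : 'rV[R]_(1 + s + s) | 0 < z ord0 (lshift s (lshift s ord0))] (jointmap glue).
Proof.
set O := [set z | _].
have oO (c : R) : open [set z : 'rV[R]_(1 + s + s) | c < z ord0 (lshift s (lshift s ord0))].
  rewrite openE => z zc; apply/rV_nbhsP; exists (z ord0 (lshift s (lshift s ord0)) - c) => [|y hy].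
    by rewrite subr_gt0.
  have := le_lt_trans (rV_coord_le (y - z) (lshift s (lshift s ord0))) hy.
  by rewrite !mxE ltr_norml /= => /andP[h _]; lra.
apply: smooth_on_local; first exact: oO.
move=> z0 z00; set t' := z0 ord0 (lshift s (lshift s ord0)).
pose N := Nwin (t' / 2).
have t'0 : 0 < t' by [].
pose g (z : 'rV[R]_(1 + s + s)) := phi 0%N (rsubmx z) + \sum_(m < N) wdw m (z ord0 (lshift s (lshift s ord0))) *:
  ((1 *: phi m (rsubmx z) + (-1) *: phi 0%N (rsubmx z)) + (z ord0 (lshift s (rshift 1 i0)) - x m ord0 i0) *: psi m (rsubmx z)).
exists [set z : 'rV[R]_(1 + s + s) | t' / 2 < z ord0 (lshift s (lshift s ord0))], g; split.
- by rewrite /= -/t'; lra.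
- have oP := oO (t' / 2).
  have sr (f : @tfun R s) : testfun f -> smooth_on [set z : 'rV[R]_(1 + s + s) | t' / 2 < z ord0 (lshift s (lshift s ord0))] (fun z => f (rsubmx z)).
    by move=> tf; apply: (smooth_onS oP _ (@rfam_smooth _ (1 + s) s _ _ tf.1)).
  apply: smooth_add; first exact: sr (Aphi 0%N).1.
  apply: (@smooth_sum R (1 + s + s) _ _ N (fun m z => wdw m (z ord0 (lshift s (lshift s ord0))) *:
  ((1 *: phi m (rsubmx z) + (-1) *: phi 0%N (rsubmx z)) + (z ord0 (lshift s (rshift 1 i0)) - x m ord0 i0) *: psi m (rsubmx z)))) => // m.
  apply: smooth_scale_fun; first exact: smooth_coord_comp.
  apply: smooth_add; first exact: (smooth_lin _ _ (sr _ (Aphi m).1) (sr _ (Aphi 0%N).1)).1.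
  by apply: smooth_scale_fun; [exact: smooth_coord|exact: sr (Apsi m).1].
move=> z hz; rewrite /jointmap /= !mxE.
have tz : 0 < z ord0 (lshift s (lshift s ord0)) by apply: lt_trans hz; lra.
rewrite (glue_near (N := N))//; last by move=> m hm; apply: (@wdw_late _ _ t') => //; move: hz => /=; lra.
rewrite /g -[LHS]/(phi 0%N (rsubmx z) + (\sum_(m < N) _) (rsubmx z)) sum_fct; congr (_ + _).
apply: eq_bigr => m _; rewrite scale1r scaleN1r.
rewrite -[LHS]/(wdw m _ *: (phi m (rsubmx z) - phi 0%N (rsubmx z) + _ *: psi m (rsubmx z))).
by rewrite !mxE.
Qed.

Variables (Om : set 'rV[R]_s) (rho : R) (M : seq 'I_s -> R) (kk : R).
Hypotheses (M0 : forall l, 0 <= M l).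
Hypotheses (Bphi : forall m, vbnd rho M (phi m)) (Bpsi : forall m, vbnd rho M (psi m)).
Hypotheses (kk0 : 0 <= kk) (xkk : forall m, `|x m| <= kk).

(** At each time at most one window is active, hence [glue t] is affine in [y]: derivatives of order
    two and more vanish, and the others are combinations of [phi 0], [phi m] and [psi m] with
    bounded coefficients. *)
Lemma glue_Cb : Cb Om glue.
Proof.
split; [by move=> *; exact: glue_A0|split].
  exists [set z : 'rV[R]_(1 + s + s) | 0 < z ord0 (lshift s (lshift s ord0))]; split; last exact: glue_smooth.
  by move=> t y xi /andP[t0 _] _; rewrite /= !row_mxEl mxE.
move=> K cK _ alpha; have [k2 k20 Hk2] := compact_norm_bound cK.
(* The 3 counts [phi 0] and both terms of [phi m - phi 0]; [kk + k2] bounds the coefficient of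
   [psi m]. *)
pose D := kk + k2 + 3.
have D0 : 0 <= D by rewrite /D !addr_ge0.
have D1 : 1 <= D by rewrite /D -[leLHS]add0r lerD ?addr_ge0// ler1n.
have w1 m t : `|wdw m t| <= 1 by rewrite /wdw; have /andP[h h'] := chi01 (4 / e m * t + (- 4)); rewrite ger0_norm.
apply: (@vbnd_boundedD _ _ _ rho (fun l => D * M l)) => f [t [y [/andP[t0 _] [Ky ->]]]].
have vz : vbnd rho (fun l => D * M l) (0 : @tfun R s).
  have := vbnd_lin 0 0 (Bphi 0%N) (Bphi 0%N); rewrite !scale0r addr0.
  by apply: vbndS => l; rewrite normr0 !mul0r addr0 mulr_ge0.
case: (pselect (exists m, `|t - e m| < e m / 4)) => [[m hm]|no].
  have E (xi : 'rV[R]_s) : (fun y => glue t y xi) = fun y : 'rV[R]_s => (phi 0%N xi + wdw m t *: (phi m xi - phi 0%N xi)) +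
      (y ord0 i0 - x m ord0 i0) *: (wdw m t *: psi m xi).
    apply/funext => z; rewrite (glue_active _ t0 hm).
    rewrite -[LHS]/(phi 0%N xi + wdw m t *: (phi m xi - phi 0%N xi + (z ord0 i0 - x m ord0 i0) *: psi m xi)).
    by rewrite scalerDr addrA !scalerA [wdw m t * _]mulrC.
  have Ef : (fun xi => pder alpha (fun y => glue t y xi) y) = match mlist alpha with
      [::] => glue t y | [:: i] => ((i == i0)%:R * wdw m t) *: psi m + 0 *: psi m | _ => 0 end.
    apply/funext => xi; rewrite /pder E pders_affine_coord.
    case: (mlist alpha) => [|i [|j l]] //; first by rewrite -[RHS]/((fun y => glue t y xi) y) E.
    by rewrite scale0r addr0 -[RHS]/(_ *: psi m xi) scalerA.
  rewrite Ef; case: (mlist alpha) => [|i [|j l]] //.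
    rewrite (glue_active _ t0 hm) /incr.
    have H1 := vbnd_lin 1 (-1) (Bphi m) (Bphi 0%N).
    have H2 := vbnd_lin 1 (y ord0 i0 - x m ord0 i0) H1 (Bpsi m).
    have := vbnd_lin 1 (wdw m t) (Bphi 0%N) H2.
    rewrite !scale1r scaleN1r; apply: vbndS => l; rewrite normrN normr1 !mul1r.
    have h1 : `|y ord0 i0 - x m ord0 i0| <= k2 + kk.
      apply: (le_trans (ler_normB _ _)); apply: lerD.
        by apply: le_trans (rV_coord_le _ _) (Hk2 _ Ky).
      by apply: le_trans (rV_coord_le _ _) (xkk m).
    have h2 : `|y ord0 i0 - x m ord0 i0| * M l <= (k2 + kk) * M l by rewrite ler_wpM2r.
    have h3 : `|wdw m t| * (M l + M l + `|y ord0 i0 - x m ord0 i0| * M l) <= 1 * (M l + M l + (k2 + kk) * M l).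
      by rewrite ler_pM// ?addr_ge0 ?mulr_ge0// lerD2l.
    by apply: le_trans (lerD (lexx _) h3) _; rewrite /D; lra.
  have := vbnd_lin ((i == i0)%:R * wdw m t) 0 (Bpsi m) (Bpsi m); apply: vbndS => l.
  rewrite normr0 mul0r addr0 ler_wpM2r// normrM.
  have h : `|(i == i0)%:R : R| <= 1 by case: eqP; rewrite ?normr1 ?normr0.
  have h2 : `|(i == i0)%:R : R| * `|wdw m t| <= 1 * 1 by rewrite ler_pM.
  by apply: (le_trans h2); rewrite mul1r.
have E (xi : 'rV[R]_s) : (fun y => glue t y xi) = fun y : 'rV[R]_s => phi 0%N xi + (y ord0 i0 - 0) *: 0.
  by apply/funext => z; rewrite scaler0 addr0 glue_idle// => m hm; apply: no; exists m.
have Ef : (fun xi => pder alpha (fun y => glue t y xi) y) = if mlist alpha is [::] then phi 0%N else 0.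
  apply/funext => xi; rewrite /pder E pders_affine_coord.
  by case: (mlist alpha) => [|i [|j l]] //; rewrite ?scaler0 ?addr0.
rewrite Ef; case: (mlist alpha) => // ; apply: vbndS (Bphi 0%N) => l.
by rewrite ler_peMl.
Qed.

End Glue.

(** The gain over moderateness is uniformity over [B]. The dependence on [y] is affine because its
    velocity in direction [i0] turns an x-derivative into one that also sees [psi]. *)
Lemma moderate_affine {R : realType} {s : nat} (i0 : 'I_s) (Om : set 'rV[R]_s)
    (Rd : @tfun R s -> 'rV[R]_s -> R * R) (K : set 'rV[R]_s) (alpha : 'I_s -> nat) :
  moderate Om Rd -> compact K -> K `<=` Om -> exists N : nat, (0 < N)%N /\
  forall B : set (@tfun R s), boundedD B ->
  exists eps0 C : R, 0 < eps0 <= 1 /\ 0 < C /\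
  forall (eps : R) (x : 'rV[R]_s) (phi psi : @tfun R s),
    0 < eps < eps0 -> K x -> B phi -> A0 phi -> B psi -> A00 psi ->
    cabs (pder alpha (fun y => Rd (Seps eps (phi + (y ord0 i0 - x ord0 i0) *: psi)) y) x) <= C * eps ^- N.
Proof.
move=> mR cK KO; have [N [N0 HN]] := mR K cK KO alpha; exists N; split=> // B bB.
have [rho rho0 [M M0 BM]] := boundedD_vbnd bB; have [kk kk0 Hkk] := compact_norm_bound cK.
pose T : Type := (R * 'rV[R]_s * @tfun R s * @tfun R s)%type.
pose bad (C : R) (d : R) (t : T) := let: (eps, x, phi, psi) := t in
  [/\ 0 < eps < d, [/\ K x, B phi, A0 phi, B psi & A00 psi] &
   ~ cabs (pder alpha (fun y => Rd (Seps eps (phi + (y ord0 i0 - x ord0 i0) *: psi)) y) x) <= C * eps ^- N].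
have badE C d t : bad C d t -> 0 < t.1.1.1 < d by case: t => [[[? ?] ?] ?] [].
apply: contrapT => Hno.
have Hbad (p : nat * R) : exists t : T, 0 < p.2 <= 1 -> bad p.1.+1%:R p.2 t.
  (* A default value outside the admissible range makes the choice function total. *)
  case: (pselect (0 < p.2 <= 1)) => [hp|]; last by move=> h; exists (0, 0, 0, 0) => /h.
  apply: contrapT => Hn; apply: Hno; exists p.2, p.1.+1%:R; split=> //; split=> // eps x phi psi he Kx Bp Ap Bs As.
  by apply: contrapT => H; apply: Hn; exists (eps, x, phi, psi).
have [g Hg] := choice Hbad.
(* The next violation is sought below half of the previous eps, as disjoint windows require, and
   with the constant increased by one. *)
pose tr := fix tr m : T := if m is m'.+1 then g (m, (tr m').1.1.1 / 2) else g (0%N, 1).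
have Htr0 : bad 1 1 (tr 0%N) by apply: (Hg (0%N, 1)); rewrite /= ltr01 lexx.
have HtrS m : 0 < (tr m).1.1.1 <= 1 -> bad m.+2%:R ((tr m).1.1.1 / 2) (tr m.+1).
  move=> /andP[h1 h2]; apply: (Hg (m.+1, (tr m).1.1.1 / 2)); rewrite /=.
  by apply/andP; split; [rewrite divr_gt0|rewrite ler_pdivrMr//; lra].
have Htr1 m : 0 < (tr m).1.1.1 <= 1.
  elim: m => [|m IH]; first by have /andP[h1 h2] := badE _ _ _ Htr0; rewrite h1 (ltW h2).
  have /andP[h3 h4] := badE _ _ _ (HtrS m IH); have /andP[h1 h2] := IH.
  rewrite h3 (le_trans (ltW h4))// ler_pdivrMr//; lra.
have Htr m : exists d, bad m.+1%:R d (tr m).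
  by case: m => [|m]; [exists 1|exists ((tr m).1.1.1 / 2); exact: HtrS (Htr1 m)].
have Hhalf m : (tr m.+1).1.1.1 <= (tr m).1.1.1 / 2.
  by have /andP[_ /ltW] := badE _ _ _ (HtrS m (Htr1 m)).
pose e m := (tr m).1.1.1; pose xx m := (tr m).1.1.2; pose phi m := (tr m).1.2; pose psi m := (tr m).2.
have epos m : 0 < e m by have /andP[] := Htr1 m.
have e0 : e 0%N <= 1 by have /andP[] := Htr1 0%N.
have HB m : [/\ K (xx m), B (phi m), A0 (phi m), B (psi m) & A00 (psi m)] /\
   ~ cabs (pder alpha (fun y => Rd (Seps (e m) (phi m + (y ord0 i0 - xx m ord0 i0) *: psi m)) y) (xx m)) <= m.+1%:R * e m ^- N.
  have [d] := Htr m; rewrite /e /xx /phi /psi.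
  by case: (tr m) => [[[? ?] ?] ?] [].
have [chi [D c1 c2 c3]] := @bump_ex R.
have chi1 : chi 0%N 0 = 1 by rewrite c1// normr0 divr_ge0.
have Ap m : A0 (phi m) by have [[]] := HB m.
have As m : A00 (psi m) by have [[]] := HB m.
have Vp m : vbnd rho M (phi m) by apply: BM; have [[]] := HB m.
have Vs m : vbnd rho M (psi m) by apply: BM; have [[]] := HB m.
have xk m : `|xx m| <= kk by apply: Hkk; have [[]] := HB m.
have Hcb := glue_Cb i0 D c2 c3 e0 epos Hhalf Ap As Om M0 Vp Vs kk0 xk.
have [eps0 [C [eps00 [C0 H]]]] := HN _ Hcb.
(* Forces [e m < eps0], since [e m] is at most 2^(-m), and also [C < m + 1]. *)
pose m := (Num.truncn (1 / eps0) + Num.truncn C)%N.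
have em : e m < eps0.
  apply: (le_lt_trans (e_tt e0 Hhalf m)).
  have h1 := tt_le (R := R) m; have h2 := truncnS_gt (1 / eps0).
  have h3 : (Num.truncn (1 / eps0)).+1%:R <= m.+1%:R :> R by rewrite ler_nat /m; lia.
  have h4 : 1 / eps0 < m.+1%:R :> R by exact: lt_le_trans h3.
  move: h4; rewrite ltr_pdivrMr// => h4; have h5 := le_lt_trans h1 h4.
  by move: h5; rewrite ltr_pM2l.
have [[Km _ _ _ _] bm] := HB m; apply: bm.
have := H (e m) (xx m); rewrite epos em => /(_ isT Km).
under [X in pder _ X]funext => y do rewrite (glue_at i0 phi psi xx chi1 c3 e0 epos Hhalf).
move=> h; apply: (le_trans h); rewrite ler_wpM2r ?invr_ge0 ?exprn_ge0 ?(ltW (epos m))//.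
have h2 := ltW (truncnS_gt C).
by apply: (le_trans h2); rewrite ler_nat ltnS leq_addl.
Qed.

(** * Moderateness implies the estimate *)

Section FiniteUniform.
Context {R : realType} {I : finType}.

Lemma common_exponent (N : I -> nat) : exists2 n : nat, (0 < n)%N & forall i, (N i <= n)%N.
Proof.
exists (\sum_i N i).+1 => // i; rewrite (bigD1 i)//= ltnW// ltnS leq_addr//.
Qed.

Lemma common_upper (C : I -> R) : exists2 c : R, 0 < c & forall i, C i <= c.
Proof.
exists (\sum_i `|C i| + 1) => [|i].
  by rewrite ltr_wpDl// sumr_ge0.
rewrite (bigD1 i)//= -addrA; apply: (le_trans (ler_norm _)); rewrite lerDl addr_ge0// sumr_ge0//.
Qed.

Lemma common_lower (e : I -> R) : (forall i, 0 < e i) -> exists2 c : R, 0 < c <= 1 & forall i, c <= e i.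
Proof.
move=> e0; have h i : 0 <= (e i)^-1 by rewrite invr_ge0 ltW.
have S0 : 0 <= \sum_i (e i)^-1 by rewrite sumr_ge0.
exists (1 + \sum_i (e i)^-1)^-1 => [|i].
  by rewrite invr_gt0 ltr_pwDl// invf_le1 ?ltr_pwDl// lerDl.
rewrite -[leRHS]invrK lef_pV2 ?posrE ?invr_gt0 ?ltr_pwDl//.
by rewrite (bigD1 i)//= addrCA lerDl addr_ge0// sumr_ge0.
Qed.

Lemma expV_mono (eps : R) N n : 0 < eps <= 1 -> (N <= n)%N -> eps ^- N <= eps ^- n.
Proof.
move=> /andP[h1 h2] Nn; rewrite lef_pV2 ?posrE ?exprn_gt0//.
by rewrite ler_wiXn2l// ltW.
Qed.

End FiniteUniform.

(** * Reduction of mixed derivatives to derivatives in x *)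

Section Sufficient.
Context {R : realType} {s : nat}.
Local Notation X := (@tfun R s * 'rV[R]_s)%type.
Variables (Om : set 'rV[R]_s) (Rd : @tfun R s -> 'rV[R]_s -> R * R).
Hypotheses (E : Ed Om Rd) (oOm : open Om).

(** All [t] are admissible, not only small ones: supports stay in the ball of radius [rho] along the
    whole slice. *)
Lemma dquant_definedP (rho d0 : R) k eps (phi : @tfun R s) (psi : 'I_k -> @tfun R s) x :
  0 <= rho -> 0 < d0 -> (forall y, `|y - x| < rho + d0 -> Om y) -> 0 < eps ->
  A0 phi -> vanish rho (Seps eps phi) -> (forall i, A00 (psi i)) ->
  (forall i, vanish rho (Seps eps (psi i))) -> dquant_defined Om eps phi psi x.
Proof.
move=> rho0 d00 Hb eps0 Ap vp As vs; rewrite /dquant_defined.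
exists (setT, [set y | `|y - x| < d0]) => /=.
  split; first exact: filterT.
  by apply/rV_nbhsP; exists d0.
move=> [t y] [_ /= hy]; rewrite Seps_affcomb.
have V : Vset rho x d0 (Seps eps phi + \sum_(i < k) (t ord0 i : R) *: Seps eps (psi i), y).
  apply: (Vset_affcomb (psi := fun i => Seps eps (psi i))) => //; first exact: A0_Seps.
  by move=> i; exact: A00_Seps.
exact: (Vset_Uset rho0 Hb V).
Qed.

Variables (rho d0 : R) (x : 'rV[R]_s).
Hypotheses (rho0 : 0 <= rho) (d00 : 0 < d0) (Hb : forall y, `|y - x| < rho + d0 -> Om y).

(** The plot [y |-> (f + (y_i0 - x_i0) c g, y)] has velocity [(c g, e_i0)] in direction [i0] and
    [(0, e_i)] in the others. *)
Lemma affine_word (i0 : 'I_s) (f g : @tfun R s) (w : seq 'I_s) (c : R) :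
  A0 f -> vanish rho f -> A00 g -> vanish rho g ->
  Wf (tcoef Rd) [seq (((i == i0)%:R * c) *: g, evec i) : X | i <- w] (f, x) =
  pder (fun i => count_mem i w) (fun y : 'rV[R]_s => Rd (f + ((y ord0 i0 - x ord0 i0) * c) *: g) y) x.
Proof.
move=> Af vf Ag vg.
have [M M0 HM] := @finite_bound R s bool (fun b => if b then f else g) (fun b => if b as b return testfun (if b then f else g) then Af.1 else Ag.1).
pose B : set X := Bd rho M 1.
have cB : absconvex B by exact: Bd_absconvex.
pose O := [set y : 'rV[R]_s | `|y - x| < d0].
have oO : open O by exact: open_ball_lt.
have T a : Vset rho x d0 a -> tay B (fun2 Rd) (tcoef Rd) a by exact: (Ed_tay E rho0 Hb M0 ler01).
pose p (y : 'rV[R]_s) : X := (f + ((y ord0 i0 - x ord0 i0) * c) *: g, y).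
pose q (y : 'rV[R]_s) : X := ((y ord0 i0 * c) *: g, y).
have OV z : O z -> Vset rho x d0 (p z).
  move=> Oz; split=> //=.
    by have := A0_lin (a := 1) ((z ord0 i0 - x ord0 i0) * c) Af Ag erefl; rewrite scale1r.
  by move=> xi h; rewrite -[LHS]/(f xi + _ *: g xi) (vf _ h) (vg _ h) scaler0 addr0.
have Hp z h v : p (z + h *: v) = p z + h *: q v.
  rewrite /p /q pairE; congr (_, _); rewrite -addrA; congr (_ + _).
  by rewrite scalerA -scalerDl; congr (_ *: _); rewrite !mxE; ring.
have Bg : Bd rho M 1 ((g, 0) : X).
  by split=> //=; [move=> l xi; exact: (HM false)|rewrite normr0].
have Be v : `|v| <= 1 -> Bd rho M 1 ((0, v) : X).
  by move=> v1; split=> //=; [exact: A00_zero|move=> l xi; rewrite pders_zero normr0].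
have qE v : q v = (v ord0 i0 * c) *: ((g, 0) : X) + (0, v).
  by rewrite /q -[RHS]/(_ *: g + 0, _ *: 0 + v) addr0 scaler0 add0r.
have Hq v : `|v| <= 1 -> dil (`|c| + 1) B (q v).
  move=> v1; rewrite qE; apply: dilD => //; last by exists (0, v); [exact: Be|rewrite scale1r].
  have D1 : dil 1 B (g, 0) by exists (g, 0) => //; rewrite scale1r.
  have := dilZ (v ord0 i0 * c) D1; apply: dilS => //; rewrite mulr1 normr_id normrM.
  by rewrite ler_piMl//; apply: le_trans (rV_coord_le _ _) v1.
have K0 : 0 < `|c| + 1 by rewrite ltr_wpDl.
have us0 : {in ([::] : seq X), forall u, dil (`|c| + 1) B u} by [].
have Ox : O x by rewrite /O /= subrr normr0.
have EF : (fun y : 'rV[R]_s => Rd (f + ((y ord0 i0 - x ord0 i0) * c) *: g) y) = fun y => Wf (tcoef Rd) [::] (p y).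
  by apply/funext => y; rewrite Wf_nil.
have sp : smooth_on O (fun y => Wf (tcoef Rd) [::] (p y)) by exact: (smooth_plot cB T oO OV K0 Hp Hq us0).
rewrite EF /pder -(pders_perm sp Ox (perm_mlist w)) (pders_plot cB T oO OV K0 Hp Hq us0)// cats0.
have -> : p x = (f, x) by rewrite /p subrr mul0r scale0r addr0.
congr (Wf _ _ _); apply: eq_map => i /=.
by rewrite /q /evec !mxE eqxx eq_sym.
Qed.

Variables (i0 : 'I_s) (eps : R) (f : @tfun R s) (Q : R) (n : nat).
Variables (k : nat) (psi : 'I_k -> @tfun R s).
Hypotheses (Af : A0 f) (vf : vanish rho f).
Hypotheses (As : forall j, A00 (psi j)) (vs : forall j, vanish rho (psi j)).
Hypothesis HQ : forall (js : seq 'I_k) (c : R) (w : n.-tuple 'I_s), (size js <= n)%N -> 0 <= c <= 1 ->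
  `|pder (fun i => count_mem i w) (fun y : 'rV[R]_s => Rd (f + ((y ord0 i0 - x ord0 i0) * c) *: \sum_(j <- js) psi j) y) x| <= Q.

(** The spatial part is a sum of basis vectors in which [i0] occurs. Sharing [g] equally among the
    occurrences of [i0], by the factor [c], writes the direction as a sum of velocities from
    [affine_word]; multilinearity then leaves at most (n+1)^n words. *)
Lemma pure_bound (js : seq 'I_k) (ls : seq 'I_s) : (size js <= n)%N -> (size ls <= n)%N ->
  `|tcoef Rd n (f, x) (\sum_(j <- js) psi j, evec i0 + \sum_(i <- ls) evec i)| <= n.+1%:R ^+ n * Q.
Proof.
move=> sj sl; set g := \sum_(j <- js) psi j.
have Ag : A00 g by exact: A00_sum.
have vg : vanish rho g by exact: vanish_sum.
pose L := i0 :: ls; pose v : 'rV[R]_s := \sum_(i <- L) evec i.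
have vE : evec i0 + \sum_(i <- ls) evec i = v by rewrite /v big_cons.
pose c : R := (v ord0 i0)^-1.
have v0 : v ord0 i0 = (count_mem i0 L)%:R.
  rewrite /v summxE -sum1_count natr_sum [RHS]big_mkcond /=; apply: eq_bigr => i _.
  by rewrite /evec mxE /= eq_sym; case: eqP.
have v1 : 1 <= v ord0 i0 by rewrite v0 ler1n /= eqxx.
have v00 : v ord0 i0 != 0 by rewrite gt_eqF// (lt_le_trans ltr01).
have c01 : 0 <= c <= 1 by rewrite /c invr_ge0 (le_trans ler01 v1) invf_le1 ?(lt_le_trans ltr01).
pose q i : X := (((i == i0)%:R * c) *: g, evec i).
have uE : (g, v) = \sum_(w <- [seq q i | i <- L]) w.
  rewrite big_map.
  have H (l : seq 'I_s) : \sum_(i <- l) q i = (\sum_(i <- l) ((i == i0)%:R * c) *: g, \sum_(i <- l) evec i).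
    by elim: l => [|i l IH]; rewrite ?big_nil// !big_cons IH.
  rewrite H; congr (_, _).
  rewrite -scaler_suml -mulr_suml (_ : \sum_(i <- L) _ = v ord0 i0) ?divff ?scale1r//.
  by rewrite v0 -sum1_count natr_sum [RHS]big_mkcond /=; apply: eq_bigr => i _; case: eqP.
have [M M0 HM] := @finite_bound R s unit (fun _ => g) (fun _ => Ag.1).
pose B : set X := Bd rho M 1.
have cB : absconvex B by exact: Bd_absconvex.
have T a : Vset rho x d0 a -> tay B (fun2 Rd) (tcoef Rd) a by exact: (Ed_tay E rho0 Hb M0 ler01).
have Ig : inspan B ((g, 0) : X).
  exists 1 => //; exists (g, 0); rewrite ?scale1r//; split=> //=; last by rewrite normr0.
  by move=> l xi; exact: (HM Datatypes.tt).
have Ie i : inspan B ((0, evec i) : X).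
  exists 1 => //; exists (0, evec i); rewrite ?scale1r//; split=> //=; [exact: A00_zero| |exact: norm_evec_le1].
  by move=> l xi; rewrite pders_zero normr0.
have Iq i : inspan B (q i).
  have -> : q i = ((i == i0)%:R * c) *: ((g, 0) : X) + (0, evec i).
    by rewrite /q -[RHS]/(_ *: g + 0, _ *: 0 + evec i) addr0 scaler0 add0r.
  by apply: inspanD => //; exact: inspanZ.
have Ilist (l : seq 'I_s) : {in [seq q i | i <- l], forall u, inspan B u} by move=> _ /mapP[i _ ->].
have Iu : inspan B (g, v) by rewrite uE; have := inspan_sum cB L Iq; rewrite big_map.
have [K K0 uK] := Iu.
have Va : Vset rho x d0 (f, x) by split=> //=; rewrite subrr normr0.
have [r1 r10 Hr1] : exists2 r1 : R, 0 < r1 & forall r, `|r| < r1 -> Vset rho x d0 ((f, x) + r *: (g, v)).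
  exists (d0 / (`|v| + 1)) => [|r hr]; first by rewrite divr_gt0// ltr_wpDl.
  rewrite pairE; split=> /=.
  - by have := A0_lin (a := 1) r Af Ag erefl; rewrite scale1r.
  - by move=> xi h; rewrite -[LHS]/(f xi + _ *: g xi) (vf h) (vg _ h) scaler0 addr0.
  - rewrite addrC addKr normrZ; move: hr; rewrite ltr_pdivlMr ?ltr_wpDl//; apply: le_lt_trans.
    by rewrite ler_wpM2l// lerDl.
have f0 c' : fun2 Rd c' = tcoef Rd 0 c' 0 by rewrite /tcoef fact0 invr1 scale1r /= scaler0 addr0.
rewrite vE /tcoef (derive1n_Wf cB K0 uK (fun r hr => T _ (Hr1 r hr)) _ f0) ?normr0// scale0r addr0.
have sz : size L = (size ls).+1 by [].
have bnd : `|Wf (tcoef Rd) (nseq n (g, v)) (f, x)| <= n.+1%:R ^+ n * Q.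
  have -> : nseq n (g, v) = [::] ++ [seq \sum_(w <- l) w | l <- nseq n [seq q i | i <- L]].
    by rewrite /= map_nseq -uE.
  apply: le_trans (Wf_sum_bound cB (T _ Va) (Q := Q) _ _ _) _ => //.
  - by move=> l /nseqP[-> _].
  - move=> t ht; have [w ->] : exists w : n.-tuple 'I_s, t = [seq q i | i <- w].
      have : {in [seq q i | i <- L], forall b, exists i, b = q i} by move=> _ /mapP[i _ ->]; exists i.
      elim: {+}n {+}[seq q i | i <- L] t ht => [|m IH] LL [|b t] //=; first by exists [tuple].
      by move=> /andP[bL /IH{}IH] HL; have [i ->] := HL b bL; have [w ->] := IH HL; exists [tuple of i :: w].
    rewrite /= (@affine_word i0 f g w c)//; exact: HQ.
  have -> : (\prod_(l <- nseq n [seq q i | i <- L]) size l = (size ls).+1 ^ n)%N.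
    by elim: {+}n => [|m IH]; rewrite ?big_nil//= big_cons IH /= size_map expnS.
  have Q0 : 0 <= Q.
    have [w _] : exists w : n.-tuple 'I_s, True by exists [tuple of nseq n i0].
    by apply: le_trans (HQ (js := js) (c := c) w sj c01).
  by rewrite natrX ler_wpM2r// lerXn2r ?nnegrE// ler_nat.
rewrite normrZ ger0_norm ?invr_ge0//; apply: le_trans bnd; rewrite ler_piMl//.
by rewrite invf_le1 ?ltr0n ?fact_gt0// ler1n fact_gt0.
Qed.

End Sufficient.

Lemma vbnd_zero {R : realType} {s : nat} rho (M : seq 'I_s -> R) : (forall l, 0 <= M l) -> vbnd rho M 0.
Proof.
move=> M0; split; [exact: (@A00_zero R s).1|by []|by move=> l xi; rewrite pders_zero normr0].
Qed.

Lemma vbnd_sum {R : realType} {s : nat} (I : Type) (r : seq I) (F : I -> @tfun R s) rho M :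
  (forall i, vbnd rho M (F i)) -> (forall l, 0 <= M l) ->
  vbnd rho (fun l => (size r)%:R * M l) (\sum_(i <- r) F i).
Proof.
move=> HF M0; elim: r => [|i r IH].
  by rewrite big_nil; apply: vbnd_zero => l; rewrite mul0r.
rewrite big_cons; have := vbnd_lin 1 1 (HF i) IH; rewrite !scale1r.
by apply: vbndS => l; rewrite normr1 !mul1r /= -[in leRHS]add1n natrD mulrDl mul1r.
Qed.

Lemma small_support {R : realType} {s : nat} (r rB : R) : 0 < r -> 0 <= rB ->
  exists2 e : R, 0 < e & forall eps (f : @tfun R s), 0 < eps < e -> vanish rB f -> vanish r (Seps eps f).
Proof.
move=> r0 rB0; have d : 0 < rB + 1 by rewrite ltr_wpDl.
exists (r / (rB + 1)) => [|eps f /andP[e0 h] vf]; first by rewrite divr_gt0.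
apply: vanishS (vanish_Seps e0 vf); move: h; rewrite ltr_pdivlMr// => /ltW; apply: le_trans.
by rewrite ler_wpM2l ?(ltW e0)// lerDl.
Qed.

Lemma moderate_char_pos {R : realType} {s : nat} (Om : set 'rV[R]_s) Rd (i0 : 'I_s) :
  open Om -> Ed Om Rd -> moderate Om Rd -> moderate_char Om Rd.
Proof.
move=> oOm E mR K cK KO alpha k.
(* The total order of differentiation, written as the length of a list shaped like the arguments of
   [Wf]. *)
pose n := size ([seq ((0, evec i) : @tfun R s * 'rV[R]_s) | i <- mlist alpha] ++
  [seq ((0, 0) : @tfun R s * 'rV[R]_s) | i <- enum 'I_k]).
have /choice[N HN] := fun w : n.-tuple 'I_s => moderate_affine i0 (fun i => count_mem i w) mR cK KO.
have [NN NN0 HNN] := common_exponent N; exists NN; split=> // B bB.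
have [rB rB0 [M M0 BM]] := boundedD_vbnd bB.
(* Large enough for [phi] and for the sums of at most [n] of the [psi], scaled by [c <= 1], that
   polarisation produces. *)
pose B2 : set (@tfun R s) := vbnd rB (fun l => n.+1%:R * M l).
have bB2 : boundedD B2 by apply: (@vbnd_boundedD _ _ _ rB (fun l => n.+1%:R * M l)).
have Hec0 (w : n.-tuple 'I_s) : exists ec : R * R, [/\ 0 < ec.1, 0 < ec.2 &
  forall (eps : R) (x : 'rV[R]_s) (phi psi : @tfun R s),
    0 < eps < ec.1 -> K x -> B2 phi -> A0 phi -> B2 psi -> A00 psi ->
    cabs (pder (fun i => count_mem i w) (fun y => Rd (Seps eps (phi + (y ord0 i0 - x ord0 i0) *: psi)) y) x) <= ec.2 * eps ^- N w].
  have [_ /(_ _ bB2)[eps0 [C [/andP[h1 _] [C0 H]]]]] := HN w.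
  by exists (eps0, C).
have [ec Hec] := choice Hec0.
have e'0 w : 0 < (ec w).1 by have [] := Hec w.
have [e0 /andP[e00 e01] He0] := common_lower e'0.
have [C C0 HC] := common_upper (fun w => (ec w).2).
have [r r0 Hr] := compact_thick oOm cK KO.
pose rho := r / 2; have rho0 : 0 < rho by rewrite divr_gt0.
have Hb x : K x -> forall y, `|y - x| < rho + rho -> Om y.
  by move=> Kx y; rewrite -splitr; exact: Hr.
have [e2 e20 He2] := @small_support R s _ _ rho0 rB0.
exists (Num.min e0 e2), (2 * ((2 ^ n)%:R * (n.+1%:R ^+ n * C))).
split; first by rewrite lt_min e00 e20 ge_min e01.
split; first by rewrite !mulr_gt0// ?exprn_gt0// ltr0n expn_gt0.
move=> eps x phi psi /andP[eps0]; rewrite lt_min => /andP[ee0 ee2] Kx Bphi Aphi Hpsi.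
have Apsi i : A00 (psi i) by have [] := Hpsi i.
have eps2 : 0 < eps < e2 by rewrite eps0.
have [_ vphi _] := BM _ Bphi.
have vS : vanish rho (Seps eps phi) by exact: He2.
have vpsi i : vanish rho (Seps eps (psi i)).
  by apply: He2 => //; have [Bi _] := Hpsi i; have [] := BM _ Bi.
split; first exact: (dquant_definedP (ltW rho0) rho0 (Hb x Kx)).
rewrite (dquantE E (ltW rho0) (Hb x Kx))// ?subrr ?normr0//.
set us := _ ++ _; have szn : size us = n by rewrite /us /n !size_cat !size_map.
have [M' M'0 HM'] := @finite_bound R s 'I_k (fun i => Seps eps (psi i)) (fun i => testfun_Seps eps0 (Apsi i).1).
pose BB : set (@tfun R s * 'rV[R]_s) := Bd rho M' 1.
have cB : absconvex BB by exact: Bd_absconvex.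
have Ie i : inspan BB ((0, evec i) : @tfun R s * 'rV[R]_s).
  exists 1 => //; exists (0, evec i); rewrite ?scale1r//; split=> //=; [exact: A00_zero| |exact: norm_evec_le1].
  by move=> l xi; rewrite pders_zero normr0.
have Is i : inspan BB ((Seps eps (psi i), 0) : @tfun R s * 'rV[R]_s).
  exists 1 => //; exists (Seps eps (psi i), 0); rewrite ?scale1r//; split=> //=; last by rewrite normr0.
  exact: A00_Seps.
have usin u : u \in us -> (exists i, u = (0, evec i)) \/ exists i, u = (Seps eps (psi i), 0).
  by rewrite mem_cat => /orP[] /mapP[i _ ->]; [left|right]; exists i.
have uspan : {in (0, evec i0) :: us, forall u, inspan BB u}.
  by move=> u; rewrite inE => /orP[/eqP ->|/usin[] [i ->]].
have [q q0 Hq] := inspan_common cB uspan.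
have Va : Vset rho x rho (Seps eps phi, x) by split=> //=; [exact: A0_Seps|rewrite subrr normr0].
have T := Ed_tay E (ltW rho0) (Hb x Kx) M'0 ler01 Va.
have Hq' : {in us, forall u, dil q BB u} by move=> u uu; apply: Hq; rewrite inE uu orbT.
rewrite (Wf_polar cB T q0 (w0 := (0, evec i0)) Hq'); last by apply: Hq; rewrite inE eqxx.
have /andP[_ h] := cabs_norm (\sum_(e <- nodes us) e.1 *: tcoef Rd (size us) (Seps eps phi, x) ((0, evec i0) + e.2)).
apply: (le_trans h); rewrite -[leRHS]mulrA ler_wpM2l//.
rewrite [leRHS](_ : _ = (size (nodes us))%:R * (n.+1%:R ^+ n * (C * eps ^- NN))); last first.
  by rewrite size_nodes szn !mulrA.
apply: norm_sum_seq => e ein.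
(* Nodes are subsums of [us]; separating test functions from basis vectors puts them in the form
   that [pure_bound] accepts. *)
have [js [ls [sj sl ->]]] : exists js ls, [/\ (size js <= size us)%N, (size ls <= size us)%N &
    e.2 = (\sum_(j <- js) Seps eps (psi j), \sum_(i <- ls) evec i)].
  apply: (@nodes_ind _ _ (fun m w => exists js ls, [/\ (size js <= m)%N, (size ls <= m)%N &
    w = (\sum_(j <- js) Seps eps (psi j), \sum_(i <- ls) evec i)]) us) ein.
  - by exists [::], [::]; rewrite !big_nil.
  - by move=> m w [js [ls [h1 h2 ->]]]; exists js, ls; split=> //; rewrite leqW.
  - move=> m w u uu [js [ls [h1 h2 ->]]]; have [[i ->]|[i ->]] := usin u uu.
      exists js, (i :: ls); split=> //; first by rewrite leqW.
      by rewrite big_cons -[LHS]/(_ + 0, _ + evec i) addr0 addrC.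
    exists (i :: js), ls; split=> //; first by rewrite leqW.
    by rewrite big_cons -[LHS]/(_ + Seps eps (psi i), _ + 0) addr0 addrC.
rewrite normrZ (nodes_norm ein) mul1r.
rewrite (_ : _ + _ = (\sum_(j <- js) Seps eps (psi j), evec i0 + \sum_(i <- ls) evec i)); last first.
  by rewrite -[LHS]/(0 + _, _ + _) add0r.
rewrite szn.
apply: (pure_bound E (ltW rho0) rho0 (Hb x Kx) (psi := fun j => Seps eps (psi j))) => //; rewrite -?szn//.
- exact: A0_Seps.
- by move=> j; exact: A00_Seps.
move=> js' c w sj' /andP[c0 c1].
have Ef : (fun y : 'rV[R]_s => Rd (Seps eps phi + ((y ord0 i0 - x ord0 i0) * c) *: \sum_(j <- js') Seps eps (psi j)) y) =
    (fun y : 'rV[R]_s => Rd (Seps eps (phi + (y ord0 i0 - x ord0 i0) *: (c *: \sum_(j <- js') psi j))) y).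
  by apply/funext => y; rewrite Seps_add Seps_scale Seps_scale Seps_sum scalerA.
rewrite Ef.
pose w' : n.-tuple 'I_s := tcast szn w.
have Ew : (w' : seq 'I_s) = w by rewrite /w' val_tcast.
have [_ ec20 H] := Hec w'.
have AS : A00 (\sum_(j <- js') psi j) by exact: A00_sum.
have := H eps x phi (c *: \sum_(j <- js') psi j); rewrite Ew eps0 (lt_le_trans ee0 (He0 w')) => /(_ isT Kx).
have B2phi : B2 phi.
  by apply: vbndS (BM _ Bphi) => l; rewrite ler_peMl// ler1n.
have B2psi : B2 (c *: \sum_(j <- js') psi j).
  have V : vbnd rB (fun l => (size js')%:R * M l) (\sum_(j <- js') psi j).
    by apply: vbnd_sum => // i; apply: BM; have [] := Hpsi i.
  have := vbnd_lin c 0 V V; rewrite scale0r addr0; apply: vbndS => l.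
  rewrite normr0 mul0r addr0 (ger0_norm c0); apply: (@le_trans _ _ (1 * ((size js')%:R * M l))).
    by rewrite ler_wpM2r// mulr_ge0.
  by rewrite mul1r ler_wpM2r// ler_nat -szn ltnW.
have A00psi : A00 (c *: \sum_(j <- js') psi j) by have := A00_lin c 0 AS AS; rewrite scale0r addr0.
move=> /(_ B2phi Aphi B2psi A00psi) h1.
have /andP[h2 _] := cabs_norm (pder (fun i => count_mem i w) (fun y : 'rV[R]_s => Rd (Seps eps (phi + (y ord0 i0 - x ord0 i0) *: (c *: \sum_(j <- js') psi j))) y) x).
apply: (le_trans h2); apply: (le_trans h1).
have e1 : 0 < eps <= 1 by rewrite eps0 (le_trans (ltW ee0)).
apply: ler_pM; rewrite ?invr_ge0 ?exprn_ge0 ?(ltW eps0) ?(ltW ec20)//.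
exact: expV_mono.
Qed.

Lemma pders_cst {R : realType} {n} {W : normedModType R} (l : seq 'I_n) (c : W) x :
  pders l (fun _ : 'rV[R]_n => c) x = if l is [::] then c else 0.
Proof.
pose F (l : seq 'I_n) (x : 'rV[R]_n) : W := if l is [::] then c else 0.
apply: (@pders_family _ _ _ setT F) => //; first exact: openT.
Qed.

(** R^0 is a point and the integral over no variables is evaluation, so A_0 has a single element.
    The quantity is then the constant [c] for [k = 0] and 0 otherwise. *)
Lemma moderate_char_dim0 {R : realType} (Om : set 'rV[R]_0) Rd : open Om -> moderate_char Om Rd.
Proof.
move=> oOm K cK KO alpha k; exists 1%N; split=> // B bB.
have [rB rB0 [M M0 BM]] := boundedD_vbnd bB.
have [r r0 Hr] := compact_thick oOm cK KO.
pose rho := r / 2; have rho0 : 0 < rho by rewrite divr_gt0.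
have Hb x : K x -> forall y, `|y - x| < rho + rho -> Om y.
  by move=> Kx y; rewrite -splitr; exact: Hr.
have [e2 e20 He2] := @small_support R 0 _ _ rho0 rB0.
pose c := Rd (fun _ => (1, 0)) 0.
exists (Num.min 1 e2), (cabs c + 1).
have cc0 (z : R * R) : 0 <= cabs z by rewrite /cabs sqrtr_ge0.
split; first by rewrite lt_min ltr01 e20 ge_min lexx.
split; first by rewrite ltr_wpDl.
move=> eps x phi psi /andP[eps0]; rewrite lt_min => /andP[ee0 ee2] Kx Bphi Aphi Hpsi.
have Apsi i : A00 (psi i) by have [] := Hpsi i.
have eps2 : 0 < eps < e2 by rewrite eps0.
have [_ vphi _] := BM _ Bphi.
have vS : vanish rho (Seps eps phi) by exact: He2.
have vpsi i : vanish rho (Seps eps (psi i)).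
  by apply: He2 => //; have [Bi _] := Hpsi i; have [] := BM _ Bi.
split; first exact: (dquant_definedP (ltW rho0) rho0 (Hb x Kx)).
have rV0 (y : 'rV[R]_0) : y = 0 by apply/rowP; case.
have A0E (f : @tfun R 0) : A0 f -> f = fun _ => (1, 0).
  case=> _ h; apply/funext => y; rewrite (rV0 y); move: h; rewrite /cint /intRs.
  have -> : enum 'I_0 = [::] by apply: size0nil; rewrite size_enum_ord.
  by rewrite /= -surjective_pairing.
have -> : dquant Rd eps alpha phi psi x = if enum 'I_k is [::] then c else 0.
  rewrite /dquant /pder.
  have -> : mlist alpha = [::] by rewrite /mlist (_ : enum 'I_0 = [::])//; apply: size0nil; rewrite size_enum_ord.
  rewrite /= (_ : (fun t => _) = (fun _ : 'rV[R]_k => c)) ?pders_cst//.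
  apply/funext => t; rewrite /c (rV0 x).
  have [A _ _] : Vset rho x rho (Seps eps phi + \sum_(i < k) (t ord0 i : R) *: Seps eps (psi i), x).
    apply: (Vset_affcomb (psi := fun i => Seps eps (psi i))) => //.
    - exact: A0_Seps.
    - by move=> i; exact: A00_Seps.
    - by rewrite subrr normr0.
  by rewrite -(A0E _ A) -Seps_affcomb.
have h1 : cabs (if enum 'I_k is [::] then c else 0) <= cabs c + 1.
  case: (enum _) => [|? ?]; first by rewrite lerDl.
  by rewrite /cabs /= expr0n addr0 sqrtr0 -/(cabs c) addr_ge0.
apply: (le_trans h1); rewrite ler_peMr ?addr_ge0// expr1 invf_ge1//.
by rewrite ltW.
Qed.

Lemma moderate_moderate_char {R : realType} {s : nat} (Om : set 'rV[R]_s) Rd :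
  open Om -> Ed Om Rd -> moderate Om Rd -> moderate_char Om Rd.
Proof.
case: s Om Rd => [|s] Om Rd oOm E mR; first exact: moderate_char_dim0.
exact: (moderate_char_pos ord0).
Qed.

(** * Chain rule along smooth families *)

Section ChainRule.
Context {R : realType} {X : lmodType R} {s : nat}.
Variables (B : set X) (f : X -> R * R) (d : nat -> X -> X -> R * R) (V : set X).
Hypotheses (cB : absconvex B) (T : forall a, V a -> tay B f d a).
Hypothesis Vo : forall a, V a -> exists2 r : R, 0 < r & forall c, around B a r c -> V c.
Variables (O : set 'rV[R]_s) (L : nat) (P : seq 'I_s -> 'rV[R]_s -> X).
Hypotheses (oO : open O) (OV : forall z, O z -> V (P [::] z)).
(** Differentiability of the family in quantitative form: in the absence of a topology on [X], the
    remainder is [h ^+ 2] times an element of a multiple of [B]. *)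
Hypothesis HP : forall l i z, (size l < L)%N -> O z -> exists k r : R,
  [/\ 0 < k, 0 < r, dil k B (P (i :: l) z) & forall h : R, `|h| <= r ->
    exists2 rho, dil k B rho & P l (z + h *: evec i) = P l z + h *: P (i :: l) z + h ^+ 2 *: rho].

(* Faa di Bruno: a list of words is a set partition of the directions taken so far,
   and a new direction opens a block or enters an existing one. *)
Fixpoint dT (i : 'I_s) (t : seq (seq 'I_s)) : seq (seq (seq 'I_s)) :=
  match t with
  | [::] => [:: [:: [:: i]]]
  | l :: t' => [seq l :: u | u <- dT i t'] ++ [:: (i :: l) :: t']
  end.

Definition wordok n (t : seq (seq 'I_s)) := all (fun l => (0 < size l <= n)%N) t.

Lemma dT_ok n i t : wordok n t -> all (wordok n.+1) (dT i t).
Proof.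
elim: t => [|l t IH] //= /andP[/andP[l0 ln] tn].
have tn1 : wordok n.+1 t.
  by apply: sub_all tn => u /andP[-> h]; rewrite leqW.
rewrite all_cat all_map /= ltnS ln tn1 /= andbT.
by apply: sub_all (IH tn) => u hu; rewrite /= l0 leqW.
Qed.

Lemma P_span l z : (0 < size l <= L)%N -> O z -> inspan B (P l z).
Proof.
case: l => [//|i l] /andP[_ lL] Oz.
by have [k [r [k0 _ h _]]] := HP i lL Oz; exists k.
Qed.

Lemma Ps_span t z pre : wordok L t -> O z -> {in pre, forall u, inspan B u} ->
  {in [seq P l z | l <- t] ++ pre, forall u, inspan B u}.
Proof.
move=> /allP ht Oz hp u; rewrite mem_cat => /orP[/mapP[l /ht hl ->]|/hp//].
exact: P_span.
Qed.

Lemma O_small z i : O z -> exists2 r : R, 0 < r & forall h : R, `|h| <= r -> O (z + h *: evec i).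
Proof.
move=> Oz; have /rV_nbhsP[r r0 H] := open_nbhs_nbhs (conj oO Oz).
exists (r / 2) => [|h hr]; first by rewrite divr_gt0.
apply: H; rewrite addrC addKr normrZ.
apply: (@le_lt_trans _ _ (`|h| * 1)); first by rewrite ler_wpM2l// norm_evec_le1.
rewrite mulr1; lra.
Qed.

Lemma P_dil l i z : (0 < size l < L)%N -> O z -> exists k r : R, [/\ 0 < k, 0 < r &
  forall h : R, `|h| <= r -> dil k B (P l (z + h *: evec i))].
Proof.
move=> /andP[l0 lL] Oz; have [k [r [k0 r0 hk H]]] := HP i lL Oz.
have [k1 k10 hk1] : inspan B (P l z) by apply: P_span => //; rewrite l0 ltnW.
exists (k1 + k + k), (Num.min r 1); split; [by rewrite !addr_gt0|by rewrite lt_min r0 ltr01|].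
move=> h; rewrite le_min => /andP[hr h1]; have [rho hrho ->] := H h hr.
apply: dilD; rewrite ?addr_ge0 ?(ltW k0) ?(ltW k10)//.
  apply: dilD; rewrite ?(ltW k0) ?(ltW k10)//.
  apply: (dilS cB) (dilZ h hk); rewrite normrM ler_piMl//.
apply: (dilS cB) (dilZ (h ^+ 2) hrho); rewrite normrM ler_piMl// normrX expr_le1//.
Qed.

Lemma Ps_dil t i z (k0 : R) : all (fun l => (0 < size l < L)%N) t -> O z -> 0 < k0 ->
  exists k r : R, [/\ k0 <= k, 0 < r &
  forall (h : R), `|h| <= r -> forall l, l \in t -> dil k B (P l (z + h *: evec i))].
Proof.
move=> ht Oz k00; elim: t ht => [|l t IH] /=; first by exists k0, 1.
move=> /andP[hl /IH[k [r [kk r0 H]]]].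
have [k1 [r1 [k10 r10 H1]]] := P_dil i hl Oz.
have k0' : 0 < k by exact: lt_le_trans kk.
exists (k + k1), (Num.min r r1); split; [by rewrite ler_wpDr// ltW|by rewrite lt_min r0|].
move=> h; rewrite le_min => /andP[hr hr1] u; rewrite inE => /orP[/eqP ->|ut].
  apply: (dilS cB) (H1 h hr1); rewrite !ger0_norm ?addr_ge0 ?(ltW k10) ?(ltW k0')//.
  by rewrite lerDr ltW.
apply: (dilS cB) (H h hr u ut); rewrite !ger0_norm ?addr_ge0 ?(ltW k10) ?(ltW k0')//.
by rewrite lerDl ltW.
Qed.

(** Along the tangent [Wf_der] applies; the gap [h ^+ 2 *: rho] to the actual point is crossed by
    the mean value inequality with the local bound on [Wf], at a cost O(h^2). *)
Lemma chain_base i z pre : (0 < L)%N -> O z -> {in pre, forall u, inspan B u} ->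
  is_derive z (evec i) (fun y => Wf d pre (P [::] y)) (Wf d (P [:: i] z :: pre) (P [::] z)).
Proof.
move=> L0 Oz hpre; set c := P [::] z; set u := P [:: i] z.
have Vc := OV Oz; have [k [r [k0 r0 hk H]]] := HP i (L0 : (size [::] < L)%N) Oz.
have [k1 k10 hk1] := inspan_common cB hpre.
pose K := k + k1; have K0 : 0 < K by rewrite addr_gt0.
have kK w : dil k B w -> dil K B w.
  by apply: (dilS cB); rewrite !ger0_norm ?addr_ge0 ?(ltW k0) ?(ltW k10)// lerDl ltW.
have k1K w : dil k1 B w -> dil K B w.
  by apply: (dilS cB); rewrite !ger0_norm ?addr_ge0 ?(ltW k0) ?(ltW k10)// lerDr ltW.
have preK : {in pre, forall u, dil K B u} by move=> w /hk1 /k1K.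
have uK : dil K B u by exact: kK.
have [r1 r10 [C C0 H1]] := Wf_bound cB (T Vc) K0 (size pre).+1.
have [r2 r20 H2] := Vo Vc.
apply: is_derive_small => e e0.
have e20 : 0 < e / 2 by rewrite divr_gt0.
have [r3 r30 H3] := Wf_der cB (T Vc) K0 uK preK e20.
have C1 : 0 < C + 1 by rewrite ltr_wpDl.
pose r4 := Num.min (r1 / (2 * K)) (r2 / (2 * K)).
exists (Num.min (Num.min (Num.min r 1) r3) (Num.min r4 (e / (2 * (C + 1))))) => [|h].
  by rewrite /r4 !lt_min r0 ltr01 r30 !divr_gt0 ?mulr_gt0.
rewrite /r4 !le_min -!andbA => /and5P[hr h1 hr3 hr4 /andP[hr4' he]].
have [rho hrho ->] := H h hr; rewrite -/c -/u.
have ar q : `|q| <= `|h ^+ 2| -> around B c (2 * K * `|h|) (c + h *: u + q *: rho).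
  move=> hq; have a1 : around B c (0 + `|h| * K) (c + h *: u).
    by apply: (around_shift cB (k := K)); rewrite ?(ltW K0)//; exact: around0.
  have a2 : around B c (0 + `|h| * K + `|h| * K) (c + h *: u + q *: rho).
    apply: (around_shift cB (k := K)) a1 (kK _ hrho); rewrite ?add0r ?mulr_ge0 ?(ltW K0)//.
    rewrite ler_wpM2r ?(ltW K0)//; apply: (le_trans hq).
    by rewrite expr2 normrM ler_piMl.
  by apply: (aroundS cB) a2; rewrite ?addr_ge0 ?mulr_ge0 ?(ltW K0)//; lra.
have K2 : 0 < 2 * K by rewrite mulr_gt0.
have hK1 : 2 * K * `|h| <= r1 by rewrite mulrC -ler_pdivlMr.
have hK2 : 2 * K * `|h| <= r2 by rewrite mulrC -ler_pdivlMr.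
have Kh0 : 0 <= 2 * K * `|h| by rewrite mulr_ge0 ?(ltW K2).
have D q : `|q| <= `|h ^+ 2| -> is_derive q (1 : R) (fun q => Wf d pre (c + h *: u + q *: rho)) (Wf d (rho :: pre) (c + h *: u + q *: rho)).
  move=> hq; have Vq : V (c + h *: u + q *: rho) by apply: H2; exact: (aroundS cB Kh0 hK2 (ar q hq)).
  apply: is_derive_small => e' e'0.
  have [r' r'0 H'] := Wf_der cB (T Vq) K0 (kK _ hrho) preK e'0.
  exists r' => // h' hh'; have := H' h' hh'.
  by rewrite -[h' *: (1 : R)]/(h' * 1) mulr1 scalerDl addrA.
have bd q : `|q| <= `|h ^+ 2| -> `|Wf d (rho :: pre) (c + h *: u + q *: rho)| <= C.
  move=> hq; apply: H1 => //; first exact: (aroundS cB Kh0 hK1 (ar q hq)).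
  by move=> w; rewrite inE => /orP[/eqP ->|/preK//]; exact: kK.
have := mean_value_pair D bd; rewrite scale0r addr0 => m1.
have m2 := H3 h hr3.
have m3 := ler_normD (Wf d pre (c + h *: u + h ^+ 2 *: rho) - Wf d pre (c + h *: u)) (Wf d pre (c + h *: u) - Wf d pre c - h *: Wf d (u :: pre) c).
rewrite (_ : _ - _ + _ = Wf d pre (c + h *: u + h ^+ 2 *: rho) - Wf d pre c - h *: Wf d (u :: pre) c) in m3; last first.
  by rewrite !addrA subrK.
apply: (le_trans m3); apply: (le_trans (lerD m1 m2)).
have h5 : C * `|h ^+ 2| <= e / 2 * `|h|.
  rewrite normrX expr2 mulrA ler_wpM2r//.
  move: he; rewrite ler_pdivlMr ?mulr_gt0// => he.
  have h0 := normr_ge0 h; nra.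
lra.
Qed.

(** The head argument [P l y] is expanded to second order inside its slot. With the head frozen at
    [z] the rest falls under the induction hypothesis, which is why arbitrary fixed arguments [pre]
    are carried; the linear term gives [P (i :: l) z] and the quadratic one is O(h^2). *)
Lemma chain_rule i z t pre : (0 < L)%N -> O z -> all (fun l => (0 < size l < L)%N) t ->
  {in pre, forall u, inspan B u} ->
  is_derive z (evec i) (fun y => Wf d ([seq P l y | l <- t] ++ pre) (P [::] y))
    (\sum_(u <- dT i t) Wf d ([seq P l z | l <- u] ++ pre) (P [::] z)).
Proof.
move=> L0 Oz; elim: t pre => [|l t IH] pre; first by move=> _ hp; rewrite /= big_seq1; exact: chain_base.
move=> /= /andP[hl ht] hpre.
have okt : wordok L t by apply: sub_all ht => w /andP[-> /ltnW].
have okl : (0 < size l <= L)%N by have /andP[-> /ltnW] := hl.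
have hl' : (0 < size (i :: l) <= L)%N by have /andP[_] := hl.
have cc x (l1 l2 : seq X) : perm_eq (x :: l1 ++ l2) (l1 ++ x :: l2).
  by rewrite -cat1s -[x :: l2]cat1s; apply/permPl; exact: perm_catCA.
have hp1 : {in P l z :: pre, forall u, inspan B u}.
  by move=> u; rewrite inE => /orP[/eqP ->|/hpre//]; exact: P_span.
have hp2 : {in P (i :: l) z :: pre, forall u, inspan B u}.
  by move=> u; rewrite inE => /orP[/eqP ->|/hpre//]; exact: P_span.
have D1 := is_derive_smallP (IH _ ht hp1); have D2 := is_derive_smallP (IH _ ht hp2).
set S1 := \sum_(u <- _) _ in D1; set S2 := \sum_(u <- _) _ in D2.
pose F u y := Wf d ([seq P l y | l <- t] ++ u :: pre) (P [::] y).
rewrite big_cat big_map big_seq1 /=.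
have -> : \sum_(j <- dT i t) Wf d (P l z :: [seq P l0 z | l0 <- j] ++ pre) (P [::] z) = S1.
  rewrite /S1 big_seq_cond [RHS]big_seq_cond; apply: eq_bigr => u /andP[ut _].
  apply: (Wf_permS cB (T (OV Oz))) => // w; rewrite inE => /orP[/eqP ->|]; first exact: P_span.
  apply: Ps_span => //.
  have : all (wordok L) (dT i t).
    case: (L) L0 ht => [//|n] _ ht; apply: dT_ok; apply: sub_all ht => v /andP[-> h]; exact: h.
  by move=> /allP/(_ _ ut).
have headE u y : O y -> inspan B u -> Wf d (u :: [seq P l0 y | l0 <- t] ++ pre) (P [::] y) = F u y.
  move=> Oy su; apply: (Wf_permS cB (T (OV Oy))) => // w; rewrite inE => /orP[/eqP ->//|].
  exact: Ps_span.
rewrite headE//; last exact: P_span.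
have [k [r [k0 r0 hk H]]] := HP i (proj2 (andP hl) : (size l < L)%N) Oz.
have [k1 k10 hk1] := inspan_common cB hpre.
have kk1 : 0 < k + k1 by rewrite addr_gt0.
have [K [r1 [kK r10 Hdil]]] := Ps_dil i ht Oz kk1.
have K0 : 0 < K by exact: lt_le_trans kK.
have [r2 r20 [C C0 HC]] := Wf_bound cB (T (OV Oz)) K0 (size t + size pre).+1.
have [r3 r30 HO] := O_small i Oz.
have [k4 [r4 [k40 r40 hk4 H4]]] := HP i (L0 : (size [::] < L)%N) Oz.
apply: is_derive_small => e e0.
have e40 : 0 < e / 4 by rewrite divr_gt0.
have [r5 r50 H5] := D1 _ e40; have [r6 r60 H6] := D2 _ ltr01.
pose Q := `|S2| + 1 + C; have Q0 : 0 < Q by rewrite /Q ltr_wpDr// ltr_wpDl.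
pose ra := Num.min (Num.min r r1) (Num.min r3 (Num.min r4 (Num.min r5 r6))).
pose rb := Num.min (Num.min 1 (r2 / (2 * k4))) (e / (2 * Q)).
exists (Num.min ra rb) => [|h].
  by rewrite /ra /rb !lt_min r0 r10 r30 r40 r50 r60 ltr01 !divr_gt0 ?mulr_gt0.
rewrite /ra /rb !le_min -!andbA => /and5P[hr hr1 hr3 hr4 /and5P[hr5 hr6 h1 hr2 he]].
have [rho hrho Erho] := H h hr; have Oy := HO h hr3.
set y := z + h *: evec i in Oy Erho *.
have srho : inspan B rho by exists k.
have EF : Wf d (P l y :: [seq P l0 y | l0 <- t] ++ pre) (P [::] y) =
    F (P l z) y + h *: F (P (i :: l) z) y + h ^+ 2 *: F rho y.
  have sp1 := P_span okl Oz; have sp2 := P_span hl' Oz.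
  have spt := Ps_span okt Oy hpre; have TT := T (OV Oy).
  rewrite Erho (Wf_addS cB TT _ _ spt); [|exact: inspanD (inspanZ cB _ _)|exact: inspanZ].
  rewrite (Wf_addS cB TT _ _ spt)//; last exact: inspanZ.
  by rewrite !(Wf_scaleS cB TT _ _ spt)// !headE.
rewrite EF headE//; last exact: P_span.
have F3 : `|F rho y| <= C.
  apply: HC.
  - have [rho' hrho' E'] := H4 h hr4; rewrite -/y in E'; rewrite E'.
    have a1 : around B (P [::] z) (0 + `|h| * k4) (P [::] z + h *: P [:: i] z).
      by apply: (around_shift cB (k := k4)); rewrite ?(ltW k40)//; exact: around0.
    have a2 : around B (P [::] z) (0 + `|h| * k4 + `|h| * k4) (P [::] z + h *: P [:: i] z + h ^+ 2 *: rho').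
      apply: (around_shift cB (k := k4)) a1 hrho'; rewrite ?add0r ?mulr_ge0 ?(ltW k40)//.
      by rewrite ler_wpM2r ?(ltW k40)// normrX expr2 ler_piMl.
    apply: (aroundS cB) a2; rewrite ?addr_ge0 ?mulr_ge0 ?(ltW k40)//.
    by move: hr2; rewrite ler_pdivlMr ?mulr_gt0//; lra.
  - by rewrite size_cat size_map /= addnS.
  - have kle (q : R) w : 0 <= q -> q <= k + k1 -> dil q B w -> dil K B w.
      by move=> q0 qk; apply: (dilS cB); rewrite !ger0_norm ?(ltW K0)//; exact: le_trans kK.
    move=> w; rewrite mem_cat inE => /or3P[/mapP[l0 l0t ->]|/eqP ->|wp].
    + exact: Hdil.
    + by apply: kle hrho; rewrite ?lerDl ltW.
    + by apply: kle (hk1 _ wp); rewrite ?lerDr ltW.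
have G1 := H5 h hr5; have G2 := H6 h hr6; rewrite -/y -/(F _ _) -/(F _ _) in G1 G2.
have G2' : `|F (P (i :: l) z) y - F (P (i :: l) z) z| <= (`|S2| + 1) * `|h|.
  have := ler_normD (F (P (i :: l) z) y - F (P (i :: l) z) z - h *: S2) (h *: S2).
  by rewrite subrK => G; apply: (le_trans G); rewrite normrZ; lra.
have -> : F (P l z) y + h *: F (P (i :: l) z) y + h ^+ 2 *: F rho y - F (P l z) z - h *: (S1 + F (P (i :: l) z) z) =
    (F (P l z) y - F (P l z) z - h *: S1) + h *: (F (P (i :: l) z) y - F (P (i :: l) z) z) + h ^+ 2 *: F rho y.
  rewrite scalerDr scalerBr [X in X - _]addrAC [LHS]addrAC; congr (_ + _).
  by rewrite [X in X - _]addrAC opprD addrACA.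
apply: (le_trans (ler_normD _ _)); apply: (le_trans (lerD (ler_normD _ _) (lexx _))).
rewrite !normrZ.
have hh := normr_ge0 h.
have g2 : `|h| * `|F (P (i :: l) z) y - F (P (i :: l) z) z| <= `|h| * ((`|S2| + 1) * `|h|) by rewrite ler_wpM2l.
have g3 : `|h| * `|h| * `|F rho y| <= `|h| * `|h| * C by rewrite ler_wpM2l// mulr_ge0.
have g4 : `|h| * (Q * `|h|) <= `|h| * (e / 2).
  by rewrite ler_wpM2l//; move: he; rewrite ler_pdivlMr ?mulr_gt0//; lra.
apply: (le_trans (lerD (lerD G1 g2) g3)).
have -> : e / 4 * `|h| + `|h| * ((`|S2| + 1) * `|h|) + `|h| * `|h| * C = e / 4 * `|h| + `|h| * (Q * `|h|).
  by rewrite /Q; ring.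
have := mulr_ge0 (ltW e0) hh; lra.
Qed.

Fixpoint dTs (l : seq 'I_s) : seq (seq (seq 'I_s)) :=
  if l is i :: l' then flatten [seq dT i t | t <- dTs l'] else [:: [::]].

Lemma dTs_ok l : all (wordok (size l)) (dTs l).
Proof.
elim: l => [//|i l IH] /=; apply/allP => u /flattenP[ts /mapP[t tl ->] ut].
exact: (allP (dT_ok i (allP IH _ tl)) _ ut).
Qed.

Lemma pders_chain l z : (size l <= L)%N -> O z ->
  pders l (fun y => Wf d [::] (P [::] y)) z =
  \sum_(t <- dTs l) Wf d [seq P w z | w <- t] (P [::] z).
Proof.
elim: l z => [|i l IH] z lL Oz; first by rewrite big_seq1.
have lL' : (size l <= L)%N by exact: ltnW.
have Dt (t : seq (seq 'I_s)) : t \in dTs l -> is_derive z (evec i) (fun y => Wf d [seq P w y | w <- t] (P [::] y))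
    (\sum_(u <- dT i t) Wf d [seq P w z | w <- u] (P [::] z)).
  move=> tl; have ok := allP (dTs_ok l) _ tl.
  have h0 : {in ([::] : seq X), forall u, inspan B u} by [].
  have := @chain_rule i z t [::] (leq_ltn_trans (leq0n _) lL) Oz _ h0.
  under [X in is_derive _ _ X _]funext => y do rewrite cats0.
  under [X in is_derive _ _ _ X]eq_bigr => u _ do rewrite cats0.
  by apply; apply: sub_all ok => w /andP[-> h]; exact: leq_ltn_trans h lL.
have DS (ts : seq (seq (seq 'I_s))) : {subset ts <= dTs l} -> is_derive z (evec i) (fun y => \sum_(t <- ts) Wf d [seq P w y | w <- t] (P [::] y))
    (\sum_(t <- flatten [seq dT i t | t <- ts]) Wf d [seq P w z | w <- t] (P [::] z)).
  elim: ts => [|t ts IHt] sub.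
    rewrite /= big_nil; under [X in is_derive _ _ X _]funext => y do rewrite big_nil.
    exact: is_derive_cst.
  rewrite /= big_cat /=; under [X in is_derive _ _ X _]funext => y do rewrite big_cons.
  apply: is_deriveD; first by apply: Dt; apply: sub; rewrite inE eqxx.
  by apply: IHt => u uts; apply: sub; rewrite inE uts orbT.
have D := DS _ (fun _ h => h).
suff : is_derive z (evec i) (pders l (fun y => Wf d [::] (P [::] y))) (\sum_(t <- dTs (i :: l)) Wf d [seq P w z | w <- t] (P [::] z)).
  by case.
apply: near_eq_is_derive D.
by apply: filterS (open_nbhs_nbhs (conj oO Oz)) => y Oy; rewrite -IH.
Qed.

End ChainRule.

Section Embedding.
Context {R : realType} {W : normedModType R}.

(** Meant for the slices of the joint domain on which [y] or [xi] alone varies. *)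
Lemma smooth_embed n m (O : set 'rV[R]_m) (g : 'rV[R]_m -> W) (E : 'rV[R]_n -> 'rV[R]_m)
    (sg : 'I_n -> 'I_m) :
  (forall z (h : R) i, E (z + h *: evec i) = E z + h *: evec (sg i)) ->
  (forall y z, `|E y - E z| <= `|y - z|) -> smooth_on O g ->
  smooth_on (E @^-1` O) (fun z => g (E z)) /\
  forall l z, O (E z) -> pders l (fun z => g (E z)) z = pders (map sg l) g (E z).
Proof.
move=> HE HL sm; have [D C] := smooth_onP sm.
have cE z (P : set 'rV[R]_m) : nbhs (E z) P -> nbhs z (E @^-1` P).
  move=> /rV_nbhsP[r r0 H]; apply/rV_nbhsP; exists r => // y yz.
  by apply: H; exact: le_lt_trans (HL y z) yz.
have oE : open (E @^-1` O).
  by rewrite openE => z Oz; apply: cE; exact: (open_nbhs_nbhs (conj sm.1 Oz)).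
pose F (l : seq 'I_n) z := pders (map sg l) g (E z).
have DF l i z : (E @^-1` O) z -> is_derive z (evec i) (F l) (F (i :: l) z).
  move=> Oz; apply: (@is_derive_precomp _ _ _ _ (pders (map sg l) g) E z (evec i) (evec (sg i))).
    by move=> h; exact: HE.
  exact: D.
split; last by move=> l z Oz; exact: (pders_family oE DF).
apply: (smooth_family (F := F) oE DF) => l z Oz; rewrite /F => P /(C _ _ Oz).
exact: cE.
Qed.

Lemma pders_cat n (m l : seq 'I_n) (f : 'rV[R]_n -> W) : pders m (pders l f) = pders (m ++ l) f.
Proof. by elim: m => [|i m IH] //=; rewrite IH. Qed.

Lemma smooth_pders n (O : set 'rV[R]_n) (f : 'rV[R]_n -> W) l : smooth_on O f -> smooth_on O (pders l f).
Proof. by move=> [oO H]; split=> // m x Ox; rewrite pders_cat; exact: H. Qed.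

End Embedding.

(** * Derivatives in x of a family of test functions *)

Section Family.
Context {R : realType} {s : nat}.
Variables (Om : set 'rV[R]_s) (phi : R -> 'rV[R]_s -> @tfun R s).
Hypotheses (oOm : open Om) (Cphi : Cb Om phi).

Definition pt (eps : R) (y xi : 'rV[R]_s) : 'rV[R]_(1 + s + s) :=
  row_mx (row_mx (const_mx eps : 'rV[R]_1) y) xi.
Definition sx (i : 'I_s) : 'I_(1 + s + s) := lshift s (rshift 1 i).
Definition sxi (i : 'I_s) : 'I_(1 + s + s) := rshift (1 + s) i.
Definition Phi (eps : R) (l : seq 'I_s) (y : 'rV[R]_s) : @tfun R s :=
  fun xi => pders l (fun y => phi eps y xi) y.

Lemma jointmap_pt eps y xi : jointmap phi (pt eps y xi) = phi eps y xi.
Proof. by rewrite /jointmap /pt row_mxKl !row_mxKr row_mxEl mxE. Qed.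

Lemma pt_y eps xi (z : 'rV[R]_s) (h : R) i :
  pt eps (z + h *: evec i) xi = pt eps z xi + h *: evec (sx i).
Proof.
apply/rowP => j; rewrite /pt /sx /evec !mxE; case: fintype.splitP => j' Ej.
  rewrite !mxE; case: fintype.splitP => j'' Ej'; rewrite !mxE eqxx /=.
    case: eqP => [e|_]; last by rewrite mulr0 addr0.
    by have := congr1 (@nat_of_ord _) e; rewrite Ej Ej' /= => e'; have := ltn_ord j''; rewrite e'.
  congr (_ + h * _); congr (_%:R); congr (nat_of_bool _).
  by rewrite -!val_eqE /= Ej Ej' eqn_add2l.
rewrite eqxx /=; case: eqP => [e|_]; last by rewrite mulr0 addr0.
have := congr1 (@nat_of_ord _) e; rewrite Ej /= => e'.
by have := ltn_ord (rshift 1 i); rewrite /= -e' ltnNge -addnA leq_addr.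
Qed.

Lemma pt_xi eps y (z : 'rV[R]_s) (h : R) i :
  pt eps y (z + h *: evec i) = pt eps y z + h *: evec (sxi i).
Proof.
apply/rowP => j; rewrite /pt /sxi /evec !mxE; case: fintype.splitP => j' Ej.
  rewrite eqxx /=; case: eqP => [e|_]; last by rewrite mulr0 addr0.
  have := congr1 (@nat_of_ord _) e; rewrite Ej /= => e'.
  by have := ltn_ord j'; rewrite e' ltnNge leq_addr.
by rewrite !mxE eqxx /= -!val_eqE /= Ej eqn_add2l.
Qed.

Lemma pt_lip_y eps xi y z : `|pt eps y xi - pt eps z xi| <= `|y - z|.
Proof.
apply: rV_norm_le => // j; rewrite /pt !mxE; case: fintype.splitP => j' _; last by rewrite subrr normr0.
rewrite !mxE; case: fintype.splitP => j'' _; first by rewrite !mxE subrr normr0.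
by have := rV_coord_le (y - z) j''; rewrite !mxE.
Qed.

Lemma pt_lip_xi eps y x z : `|pt eps y x - pt eps y z| <= `|x - z|.
Proof.
apply: rV_norm_le => // j; rewrite /pt !mxE; case: fintype.splitP => j' _; first by rewrite subrr normr0.
by have := rV_coord_le (x - z) j'; rewrite !mxE.
Qed.

Section FixEps.
Variable eps : R.
Hypothesis eps01 : 0 < eps <= 1.

Lemma Phi_slice : exists2 W : set 'rV[R]_(1 + s + s), smooth_on W (jointmap phi) &
  forall y xi, Om y -> W (pt eps y xi).
Proof.
have [_ [[W [H1 H2]] _]] := Cphi; exists W => // y xi Oy; exact: H1.
Qed.

Lemma Phi_count l y xi : Om y -> Phi eps l y xi = pder (fun i => count_mem i l) (fun y => phi eps y xi) y.
Proof.
move=> Oy; have [W sW HW] := Phi_slice.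
have [S _] := smooth_embed (pt_y eps xi) (pt_lip_y eps xi) sW.
have E : (fun z => jointmap phi (pt eps z xi)) = (fun y => phi eps y xi).
  by apply/funext => z; rewrite jointmap_pt.
rewrite E in S; rewrite /Phi /pder (pders_perm S _ (perm_mlist l))//.
exact: HW.
Qed.

Lemma Phi_joint m l y xi : Om y ->
  pders m (Phi eps l y) xi = pders (map sxi m ++ map sx l) (jointmap phi) (pt eps y xi).
Proof.
move=> Oy; have [W sW HW] := Phi_slice.
have E : Phi eps l y = fun xi => pders (map sx l) (jointmap phi) (pt eps y xi).
  apply/funext => z; have [_ H] := smooth_embed (pt_y eps z) (pt_lip_y eps z) sW.
  have := H l y (HW y z Oy); rewrite /Phi => <-.
  by congr (pders l _ y); apply/funext => y'; rewrite jointmap_pt.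
have [_ H] := smooth_embed (pt_xi eps y) (pt_lip_xi eps y) (smooth_pders (map sx l) sW).
by rewrite E H ?pders_cat//; exact: HW.
Qed.

(** Derivatives in [y] and in [xi] are partials of one smooth joint map, hence commute. *)
Lemma Phi_derive m l i y xi : Om y ->
  is_derive y (evec i) (fun y => pders m (Phi eps l y) xi) (pders m (Phi eps (i :: l) y) xi).
Proof.
move=> Oy; have [W sW HW] := Phi_slice.
pose J := pders (map sxi m ++ map sx l) (jointmap phi).
have [D _] := smooth_onP (smooth_pders (map sxi m ++ map sx l) sW).
have D1 := @is_derive_precomp _ _ _ _ J (fun y => pt eps y xi) y (evec i) (evec (sx i)) _ (fun h => pt_y eps xi y h i) (D [::] (sx i) _ (HW y xi Oy)).
have E : pders m (Phi eps (i :: l) y) xi = pders [:: sx i] J (pt eps y xi).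
  rewrite Phi_joint// /J pders_cat; apply: (pders_perm sW (HW y xi Oy)).
  by rewrite /= -cat1s -[sx i :: _ ++ _]cat1s; apply/permPl; exact: perm_catCA.
rewrite E; apply: near_eq_is_derive D1.
by apply: filterS (open_nbhs_nbhs (conj oOm Oy)) => y' Oy'; rewrite Phi_joint.
Qed.

End FixEps.

(** [Cb] bounds each derivative separately; there are finitely many words of length at most [n], so
    common data exist. *)
Lemma Phi_vbnd n (K : set 'rV[R]_s) : compact K -> K `<=` Om ->
  exists2 r : R, 0 <= r & exists2 M : seq 'I_s -> R, (forall m, 0 <= M m) &
  forall eps y l, 0 < eps <= 1 -> K y -> (size l <= n)%N -> vbnd r M (Phi eps l y).
Proof.
move=> cK KO.
have H1 (l : seq 'I_s) : exists rM : R * (seq 'I_s -> R), [/\ 0 <= rM.1, forall m, 0 <= rM.2 m &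
    forall eps y, 0 < eps <= 1 -> K y -> vbnd rM.1 rM.2 (Phi eps l y)].
  have [_ [_ HC]] := Cphi.
  have [r r0 [M M0 HB]] := boundedD_vbnd (HC K cK KO (fun i => count_mem i l)).
  exists (r, M); split=> // eps y e01 Ky; apply: HB; exists eps, y; split=> //; split=> //.
  by apply/funext => xi; rewrite Phi_count//; exact: KO.
elim: n => [|n [r r0 [M M0 IH]]].
  have [[r M] [/= r0 M0 H]] := H1 [::]; exists r => //; exists M => // eps y l e01 Ky.
  by rewrite leqn0 => /nilP ->; exact: H.
have [rM HrM] := choice (fun w : n.+1.-tuple 'I_s => H1 w).
have [r1 r10 Hr1] := common_upper (fun w => (rM w).1).
exists (r + r1); first by rewrite addr_ge0// ltW.
exists (fun m => M m + \sum_w (rM w).2 m) => [m|eps y l e01 Ky].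
  by rewrite addr_ge0// sumr_ge0// => w _; have [_ ->] := HrM w.
have S0 m : 0 <= \sum_w (rM w).2 m by rewrite sumr_ge0// => w _; have [_ ->] := HrM w.
rewrite leq_eqVlt ltnS => /orP[sl|sl]; last first.
  have [t v h] := IH eps y l e01 Ky sl; split=> //.
    by apply: vanishS v; rewrite lerDl ltW.
  by move=> m xi; apply: (le_trans (h m xi)); rewrite lerDl.
pose w : n.+1.-tuple 'I_s := Tuple sl.
have [_ M0w /(_ eps y e01 Ky)[t v h]] := HrM w; split=> //.
  by apply: vanishS v; apply: (le_trans (Hr1 w)); rewrite lerDr.
move=> m xi; apply: (le_trans (h m xi)); rewrite (bigD1 w)//= addrCA lerDl addr_ge0// sumr_ge0// => w' _.
by have [_ ->] := HrM w'.
Qed.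

Lemma Phi_remainder (eps : R) l i z (h : R) m xi C : 0 < eps <= 1 ->
  (forall r : R, `|r| <= `|h| -> Om (z + r *: evec i)) ->
  (forall r : R, `|r| <= `|h| -> `|pders m (Phi eps (i :: i :: l) (z + r *: evec i)) xi| <= C) ->
  `|pders m (Phi eps l (z + h *: evec i)) xi - pders m (Phi eps l z) xi -
    h *: pders m (Phi eps (i :: l) z) xi| <= C * `|h| ^+ 2.
Proof.
move=> e01 HO HC.
have := @taylor_bound R 1 (fun j r => pders m (Phi eps (nseq j i ++ l) (z + r *: evec i)) xi) h C _ HC.
rewrite !big_ord_recl big_ord0 /= -[bump 0 0]/1%N -[1`!]/1%N -[0`!]/1%N addr0 expr0 expr1 scale0r !addr0 invr1 !scale1r opprD addrA.
apply=> j r hr; apply: (@is_derive_line _ _ _ (fun y => pders m (Phi eps (nseq j i ++ l) y) xi) z (evec i) r).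
exact: (Phi_derive e01 m (nseq j i ++ l) i xi (HO r hr)).
Qed.

Lemma ball_line (z : 'rV[R]_s) (r : R) i (h : R) : `|h| <= r -> `|(z + h *: evec i) - z| <= r.
Proof.
move=> hr; rewrite addrC addKr normrZ; apply: le_trans hr.
by rewrite ler_piMr// norm_evec_le1.
Qed.

(** Instead of differentiating under the integral, the remainder [g] of first order is integrated.
    It is O(h^2) on a fixed ball, while the integrals of the two values of [Phi eps l] cancel and
    leave [- h] times the integral in question. *)
Lemma Phi_cint eps l z : 0 < eps <= 1 -> Om z -> testfun (Phi eps l z) /\
  cint (Phi eps l z) = if l is [::] then (1, 0) else 0.
Proof.
move=> e01; elim: l z => [|i l IH] z Oz.
  by have [/(_ eps z e01 Oz)[]] := Cphi.
have /rV_nbhsP[r r0 Hr] := open_nbhs_nbhs (conj oOm Oz).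
pose K := [set y : 'rV[R]_s | `|y - z| <= r / 2].
have KO : K `<=` Om by move=> y hy; apply: Hr; apply: (le_lt_trans hy); lra.
have r20 : 0 < r / 2 by rewrite divr_gt0.
have Kz : K z by rewrite /K /= subrr normr0 ltW.
have [rB rB0 [M M0 HB]] := Phi_vbnd (size l).+2 (@compact_norm_ball _ _ z (r / 2)) KO.
have [ti _ _] := HB eps z (i :: l) e01 Kz (leqnSn _); split=> //.
apply: norm_le_eps0 => e e0; pose C := (2 * rB) ^+ s * M [::].
have C0 : 0 <= C by rewrite mulr_ge0 ?exprn_ge0 ?mulr_ge0.
pose h := Num.min (r / 2) (e / (C + 1)).
have C1 : 0 < C + 1 by rewrite ltr_wpDl.
have h0 : 0 < h by rewrite lt_min r20 divr_gt0.
have hr : `|h| <= r / 2 by rewrite gtr0_norm// ge_min lexx.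
have HK (q : R) : `|q| <= `|h| -> K (z + q *: evec i) by move=> hq; apply: ball_line; exact: le_trans hr.
have Oh : Om (z + h *: evec i) by apply: KO; exact: HK.
have [th ch] := IH _ Oh; have [tz cz] := IH _ Oz.
pose g : @tfun R s := 1 *: (1 *: Phi eps l (z + h *: evec i) + (-1) *: Phi eps l z) + (- h) *: Phi eps (i :: l) z.
have td := testfun_lin 1 (-1) th tz.
have tg : testfun g := testfun_lin 1 (- h) td ti.
have cg : cint g = (- h) *: cint (Phi eps (i :: l) z).
  by rewrite /g cint_lin// cint_lin// ch cz scale1r scale1r scaleN1r subrr add0r.
have Kh : K (z + h *: evec i) by exact: HK.
have [_ v1 _] := HB eps _ l e01 Kh (leqW (leqnSn _)).
have [_ v2 _] := HB eps _ l e01 Kz (leqW (leqnSn _)).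
have [_ v3 _] := HB eps _ (i :: l) e01 Kz (leqnSn _).
have vg : vanish rB g.
  move=> xi hx; rewrite -[LHS]/(1 *: (1 *: Phi eps l (z + h *: evec i) xi + (-1) *: Phi eps l z xi) + (- h) *: Phi eps (i :: l) z xi).
  by rewrite v1// v2// v3// !scaler0 !addr0 scaler0.
have bg xi : `|g xi| <= M [::] * `|h| ^+ 2.
  rewrite -[g xi]/(1 *: (1 *: Phi eps l (z + h *: evec i) xi + (-1) *: Phi eps l z xi) + (- h) *: Phi eps (i :: l) z xi).
  rewrite !scale1r scaleN1r scaleNr.
  apply: (@Phi_remainder eps l i z h [::] xi) => // q hq; first by apply: KO; exact: HK.
  by have [_ _ ->] := HB eps _ (i :: i :: l) e01 (HK q hq) (leqnn _).
have := cint_bound rB0 tg vg bg; rewrite cg normrZ normrN mulrA -/C => B.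
have h1 : `|cint (Phi eps (i :: l) z)| <= C * `|h|.
  have hn : 0 < `|h| by rewrite normr_gt0 gt_eqF.
  by rewrite -(ler_pM2l hn); apply: (le_trans B); rewrite expr2 mulrA [C * _]mulrC -mulrA mulrC.
apply: (le_trans h1); rewrite gtr0_norm//.
have h2 : h <= e / (C + 1) by rewrite ge_min lexx orbT.
by move: h2; rewrite ler_pdivlMr// => h2; nra.
Qed.

End Family.

(** * The estimate implies moderateness *)

Lemma dT_size {s} (i : 'I_s) t u : u \in dT i t -> (size u <= (size t).+1)%N.
Proof.
elim: t u => [|l t IH] u /=; first by rewrite inE => /eqP ->.
by rewrite mem_cat inE => /orP[/mapP[v /IH h ->]|/eqP -> //=].
Qed.

Lemma dTs_size {s} (l : seq 'I_s) t : t \in dTs l -> (size t <= size l)%N.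
Proof.
elim: l t => [|i l IH] t /=; first by rewrite inE => /eqP ->.
by move=> /flattenP[_ /mapP[u /IH h ->] /dT_size ht]; exact: leq_trans ht _.
Qed.

Section Necessary.
Context {R : realType} {s : nat}.
Local Notation X := (@tfun R s * 'rV[R]_s)%type.
Variables (Om : set 'rV[R]_s) (Rd : @tfun R s -> 'rV[R]_s -> R * R).
Hypotheses (E : Ed Om Rd) (oOm : open Om).
Variables (phi : R -> 'rV[R]_s -> @tfun R s) (eps : R).
Hypotheses (Cphi : Cb Om phi) (eps01 : 0 < eps <= 1).
Variables (rho d0 r : R) (M : seq 'I_s -> R) (x : 'rV[R]_s) (n : nat).
Hypotheses (rho0 : 0 <= rho) (d00 : 0 < d0) (r0 : 0 <= r) (M0 : forall m, 0 <= M m).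
Hypotheses (Hb : forall y, `|y - x| < rho + d0 -> Om y) (Hb2 : forall y, `|y - x| <= 2 * d0 -> Om y).
Hypothesis HM : forall y l, `|y - x| <= 2 * d0 -> (size l <= n.+1)%N -> vbnd r M (Phi phi eps l y).
Hypothesis er : eps * r <= rho.

Definition dx (l : seq 'I_s) (y : 'rV[R]_s) : 'rV[R]_s :=
  match l with [::] => y | [:: i] => evec i | _ => 0 end.
(** The derivatives of the plot [y |-> (S_eps phi(eps, y), y)]; its spatial part is the identity, so
    [dx] vanishes on longer words. *)
Definition Pw (l : seq 'I_s) (y : 'rV[R]_s) : X := (Seps eps (Phi phi eps l y), dx l y).

Let eps0 : 0 < eps. Proof. by case/andP: eps01. Qed.
(** The bounds [M] after [S_eps]. They blow up as eps tends to 0, but shape only the set in which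
    expansions are taken. *)
Definition MB (m : seq 'I_s) : R := eps ^- s * eps^-1 ^+ size m * M m.
Let MB0 m : 0 <= MB m.
Proof. by rewrite mulr_ge0// mulr_ge0 ?invr_ge0 ?exprn_ge0 ?invr_ge0 ?(ltW eps0). Qed.
Let B : set X := Bd rho MB 1.
Let cB : absconvex B. Proof. exact: Bd_absconvex. Qed.

Lemma Seps_vbnd g : vbnd r M g -> vanish rho (Seps eps g) /\ forall l xi, `|pders l (Seps eps g) xi| <= MB l.
Proof.
move=> [tg vg hg]; split; first exact: vanishS er (vanish_Seps eps0 vg).
move=> l xi; rewrite pders_Seps// normrZ ger0_norm ?mulr_ge0 ?invr_ge0 ?exprn_ge0 ?invr_ge0 ?(ltW eps0)//.
by rewrite ler_wpM2l// mulr_ge0 ?invr_ge0 ?exprn_ge0 ?invr_ge0 ?(ltW eps0).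
Qed.

Lemma Phi_A00 l y : l != [::] -> Om y -> A00 (Phi phi eps l y).
Proof. by case: l => // i l _ Oy; exact: (Phi_cint oOm Cphi (i :: l) eps01 Oy). Qed.

Lemma dil_Pw l y : l != [::] -> `|y - x| <= 2 * d0 -> (size l <= n.+1)%N -> dil 1 B (Pw l y).
Proof.
move=> l0 hy sl; exists (Pw l y); last by rewrite scale1r.
have [v b] := Seps_vbnd (HM hy sl); split=> //=.
  by apply: A00_Seps => //; apply: Phi_A00 => //; exact: Hb2.
by case: l {sl v b} l0 => [//|i [|j l]] _ /=; [exact: norm_evec_le1|rewrite normr0].
Qed.

Lemma dil_evec i : dil 1 B ((0, evec i) : X).
Proof.
exists (0, evec i); last by rewrite scale1r.
split=> //=; [exact: A00_zero| |exact: norm_evec_le1].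
by move=> l xi; rewrite pders_zero normr0.
Qed.

Let O := [set y : 'rV[R]_s | `|y - x| < d0].

Lemma O_near z : O z -> `|z - x| <= 2 * d0.
Proof. by move=> Oz; apply: (le_trans (ltW Oz)); rewrite ler_peMl ?ler1n ?(ltW d00). Qed.

(** The remainder is controlled by the derivative for [i :: i :: l], which is why [HM] reaches words
    of length [n + 1]. *)
Lemma Pw_expansion l i z : (size l < n)%N -> O z -> exists k r : R,
  [/\ 0 < k, 0 < r, dil k B (Pw (i :: l) z) & forall h : R, `|h| <= r ->
    exists2 rho, dil k B rho & Pw l (z + h *: evec i) = Pw l z + h *: Pw (i :: l) z + h ^+ 2 *: rho].
Proof.
move=> ln Oz; exists 1, d0; split=> //.
  by apply: dil_Pw; [|exact: O_near|exact: leqW].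
move=> h hd.
have near q : `|q| <= `|h| -> `|z + q *: evec i - x| <= 2 * d0.
  move=> hq; have -> : z + q *: evec i - x = (z + q *: evec i - z) + (z - x) by rewrite addrA subrK.
  apply: (le_trans (ler_normD _ _)).
  by apply: (le_trans (lerD (ball_line z i (le_trans hq hd)) (ltW Oz))); rewrite mulr2n mulrDl mul1r.
have nz := O_near Oz.
have nh : `|z + h *: evec i - x| <= 2 * d0 by exact: near.
have Edx : dx l (z + h *: evec i) = dx l z + h *: dx (i :: l) z.
  by case: l {ln} => [|j [|j' l]] //=; rewrite scaler0 addr0.
pose g : @tfun R s := 1 *: (1 *: Phi phi eps l (z + h *: evec i) + (-1) *: Phi phi eps l z) + (- h) *: Phi phi eps (i :: l) z.
have gE : g = Phi phi eps l (z + h *: evec i) - Phi phi eps l z - h *: Phi phi eps (i :: l) z.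
  by rewrite /g !scale1r scaleN1r scaleNr.
have sl1 : (size l <= n.+1)%N by rewrite leqW// ltnW.
have [t1 v1 _] := HM nh sl1; have [t2 v2 _] := HM nz sl1.
have [t3 v3 _] := HM nz (leqW ln : (size (i :: l) <= n.+1)%N).
have td := testfun_lin 1 (-1) t1 t2.
have tg : testfun g := testfun_lin 1 (- h) td t3.
have vg : vanish r g.
  move=> xi hx; rewrite -[LHS]/(1 *: (1 *: Phi phi eps l (z + h *: evec i) xi + (-1) *: Phi phi eps l z xi) + (- h) *: Phi phi eps (i :: l) z xi).
  by rewrite v1// v2// v3// !scaler0 !addr0 scaler0.
have [_ c1] := Phi_cint oOm Cphi l eps01 (Hb2 nh).
have [_ c2] := Phi_cint oOm Cphi l eps01 (Hb2 nz).
have [_ c3] := Phi_cint oOm Cphi (i :: l) eps01 (Hb2 nz).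
have cg : cint g = 0.
  by rewrite /g cint_lin// cint_lin// c1 c2 c3 scaler0 addr0 scale1r scale1r scaleN1r subrr.
have bg m xi : `|pders m g xi| <= M m * `|h| ^+ 2.
  rewrite /g (smooth_lin 1 (- h) td.1 t3.1).2// (smooth_lin 1 (-1) t1.1 t2.1).2//.
  rewrite !scale1r scaleN1r scaleNr.
  apply: (@Phi_remainder _ _ Om phi oOm Cphi) => // q hq; first by apply: Hb2; exact: near.
  by have [_ _ ->] := HM (near q hq) (ln : (size (i :: i :: l) <= n.+1)%N).
have Eg : Phi phi eps l (z + h *: evec i) = Phi phi eps l z + h *: Phi phi eps (i :: l) z + g.
  by rewrite gE -[X in _ = _ + X]addrA -opprD [RHS]addrC subrK.
(* By [bg] the quotient obeys the bounds [M]. At [h = 0] the inverse is 0, and so is [g] by its own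
   bound. *)
clearbody g; exists (Seps eps ((h ^+ 2)^-1 *: g), 0); last first.
  rewrite /Pw pairE pairE scaler0 addr0 Edx {1}Eg; congr (_, _).
  rewrite !Seps_add !Seps_scale; congr (_ + _).
  have [h0|h0] := eqVneq h 0; last first.
    have a0 : h ^+ 2 != 0 by rewrite expf_eq0.
    by rewrite scalerA (divff a0) scale1r.
  suff -> : g = 0 by rewrite -[0 : @tfun R s](scale0r (0 : @tfun R s)) Seps_scale !scale0r !scaler0.
  apply/funext => xi; apply/eqP; rewrite -normr_le0.
  by have := bg [::] xi; rewrite h0 normr0 expr0n mulr0.
exists (Seps eps ((h ^+ 2)^-1 *: g), 0); last by rewrite scale1r.
have G : vbnd r M ((h ^+ 2)^-1 *: g).
  have tg' := testfun_lin (h ^+ 2)^-1 0 tg tg; rewrite scale0r addr0 in tg'.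
  split=> //; first by move=> xi hx; rewrite -[LHS]/((h ^+ 2)^-1 *: g xi) vg// scaler0.
  move=> m xi; have := (smooth_lin (h ^+ 2)^-1 0 tg.1 tg.1).2 m xi I.
  rewrite scale0r addr0 => e; move: e.
  rewrite (_ : (fun x0 => _) = (h ^+ 2)^-1 *: g); last by apply/funext => q; rewrite scale0r addr0.
  move=> ->; rewrite normrZ normfV normrX.
  case: (eqVneq h 0) => [->|h0]; first by rewrite normr0 expr0n invr0 mul0r.
  by rewrite mulrC ler_pdivrMr ?exprn_gt0 ?normr_gt0.
have [v b] := Seps_vbnd G; split=> //=; last by rewrite normr0.
apply: A00_Seps => //; have := @A00_lin R s g g (h ^+ 2)^-1 0 (conj tg cg) (conj tg cg).
by rewrite scale0r addr0.
Qed.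

Lemma Vset_Pw z : O z -> Vset rho x d0 (Pw [::] z).
Proof.
move=> Oz; have nz := O_near Oz.
have [v _] := Seps_vbnd (HM nz (leq0n _ : (size [::] <= n.+1)%N)).
split=> //=; apply: A0_Seps => //.
by have [/(_ eps z eps01 (Hb2 nz))] := Cphi.
Qed.

Lemma pders_expansion w : (size w <= n)%N ->
  pders w (fun y => Rd (Seps eps (phi eps y)) y) x =
  \sum_(t <- dTs w) Wf (tcoef Rd) [seq Pw l x | l <- t] (Pw [::] x).
Proof.
move=> wn; have oO : open O by exact: open_ball_lt.
have T a : Vset rho x d0 a -> tay B (fun2 Rd) (tcoef Rd) a by exact: (Ed_tay E rho0 Hb MB0 ler01).
have Vo a : Vset rho x d0 a -> exists2 r : R, 0 < r & forall c, around B a r c -> Vset rho x d0 c.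
  move=> Va; have [r' r'0 H] := Vset_open MB ler01 (ler01 : 0 <= (1 : R)) Va.
  exists r' => // c hc; apply: (H r'); first by rewrite ltW//=.
  by move: hc; rewrite /B mulr1; congr (around (Bd _ _ _) _ _ _); apply/funext => l; rewrite mul1r.
have Ox : O x by rewrite /O /= subrr normr0.
rewrite -(pders_chain cB T Vo oO Vset_Pw Pw_expansion wn Ox).
by congr (pders w _ x); apply/funext => y; rewrite Wf_nil.
Qed.

(** Separates the two kinds of direction occurring in [dquant]; only words of one letter have a
    spatial part. *)
Definition parts (l : seq 'I_s) : seq X :=
  match l with [:: i] => [:: (Seps eps (Phi phi eps l x), 0); (0, evec i)]
  | _ => [:: (Seps eps (Phi phi eps l x), 0)] end.

Lemma Pw_parts l : l != [::] -> Pw l x = \sum_(v <- parts l) v.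
Proof.
case: l => [//|i [|j l]] _; rewrite /parts !big_cons big_nil addr0//.
by rewrite -[RHS]/(_ + 0, 0 + _) addr0 add0r.
Qed.

(** Brings the chosen directions into the order of [dquantE], the spatial ones in front. *)
Lemma choices_parts t u : choices [seq parts l | l <- t] u -> exists ms ls,
  [/\ (size ms <= size t)%N, (size ls <= size t)%N, {subset ls <= t} &
   perm_eq u ([seq ((0, evec i) : X) | i <- ms] ++ [seq ((Seps eps (Phi phi eps l x), 0) : X) | l <- ls])].
Proof.
elim: t u => [|l t IH] [|v u] //=; first by exists [::], [::].
case/andP => vl /IH[ms [ls [h1 h2 sub pe]]].
have : v = (Seps eps (Phi phi eps l x), 0) \/ exists i, v = (0, evec i).
  move: vl; rewrite /parts; case: (l) => [|i [|j l']]; rewrite !inE.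
  - by move=> /eqP; left.
  - by case/orP => /eqP ->; [left|right; exists i].
  - by move=> /eqP; left.
case=> [->|[i ->]].
  exists ms, (l :: ls); split=> //; first exact: leqW.
    by move=> q; rewrite !inE => /orP[->//|/sub ->]; rewrite orbT.
  rewrite /= -cat1s -[_ :: [seq _ | _ <- ls]]cat1s perm_sym perm_catCA /= perm_cons perm_sym.
  exact: pe.
exists (i :: ms), ls; split=> //; first exact: leqW.
  by move=> q /sub; rewrite inE => ->; rewrite orbT.
by rewrite /= perm_cons.
Qed.

Variable Q : R.
Hypothesis HQ : forall ms (ls : seq (seq 'I_s)), (size ms <= n)%N -> (size ls <= n)%N ->
  (forall l, l \in ls -> (0 < size l <= n)%N) ->
  `|dquant Rd eps (fun i => count_mem i ms) (phi eps x) (fun j : 'I_(size ls) => Phi phi eps (nth [::] ls j) x) x| <= Q.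

(** Each argument has at most two parts, so at most 2^n choices arise, each of them a [dquant] up to
    the order of its arguments. *)
Lemma term_bound t : wordok n t -> (size t <= n)%N ->
  `|Wf (tcoef Rd) [seq Pw l x | l <- t] (Pw [::] x)| <= (2 ^ n)%:R * Q.
Proof.
move=> ok tn.
have xx : `|x - x| <= 2 * d0 by rewrite subrr normr0 mulr_ge0// ltW.
have Ox : O x by rewrite /O /= subrr normr0.
have T : tay B (fun2 Rd) (tcoef Rd) (Pw [::] x) by apply: (Ed_tay E rho0 Hb MB0 ler01); exact: Vset_Pw.
have okl l : l \in t -> (l != [::]) && (size l <= n)%N.
  by move=> /(allP ok); case: l.
have SP l : l \in t -> inspan B ((Seps eps (Phi phi eps l x), 0) : X).
  move=> /okl/andP[l0 ln]; exists 1 => //; exists (Seps eps (Phi phi eps l x), 0); last by rewrite scale1r.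
  have [v b] := Seps_vbnd (HM xx (leqW ln)); split=> //=; last by rewrite normr0.
  by apply: A00_Seps => //; apply: Phi_A00 => //; exact: Hb2.
have SE i : inspan B ((0, evec i) : X) by exists 1 => //; exact: dil_evec.
have -> : [seq Pw l x | l <- t] = [::] ++ [seq \sum_(v <- L) v | L <- [seq parts l | l <- t]].
  rewrite /= -map_comp; apply/eq_in_map => l /okl/andP[l0 _] /=; exact: Pw_parts.
have Q0 : 0 <= Q.
  by apply: le_trans (HQ (ms := [::]) (ls := [::]) _ _ _).
apply: le_trans (Wf_sum_bound cB T (Q := Q) _ _ _) _ => //.
- move=> _ /mapP[l lt ->] u; have := SP l lt; rewrite /parts.
  case: (l) => [|i [|j l']] H; rewrite !inE; first by move=> /eqP ->.
    by case/orP => /eqP ->.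
  by move=> /eqP ->.
- move=> u /choices_parts[ms [ls [h1 h2 sub pe]]].
  rewrite /= (Wf_permS cB T _ pe); last first.
    move=> v; rewrite (perm_mem pe) mem_cat => /orP[] /mapP[q hq ->] //.
    by apply: SP; exact: sub.
  pose psi (j : 'I_(size ls)) := Phi phi eps (nth [::] ls j) x.
  have lsn j : nth [::] ls (nat_of_ord (j : 'I_(size ls))) \in t by apply: sub; exact: mem_nth.
  have := HQ (leq_trans h1 tn) (leq_trans h2 tn) (fun l hl => allP ok l (sub l hl)).
  have A1 : A0 (phi eps x) by have [/(_ eps x eps01 (Hb2 xx))] := Cphi.
  have [_ V1 _] := Vset_Pw Ox.
  have A2 j : A00 (psi j) by have /andP[l0 _] := okl _ (lsn j); apply: Phi_A00 => //; exact: Hb2.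
  have V2 j : vanish rho (Seps eps (psi j)).
    by have /andP[_ ln] := okl _ (lsn j); have [] := Seps_vbnd (HM xx (leqW ln)).
  have xd : `|x - x| < d0 by rewrite subrr normr0.
  rewrite (dquantE E rho0 Hb _ eps0 A1 V1 A2 V2 xd).
  rewrite (_ : [seq ((Seps eps (Phi phi eps (nth [::] ls (nat_of_ord i)) x), 0) : X) | i <- enum 'I_(size ls)] = [seq ((Seps eps (Phi phi eps l x), 0) : X) | l <- ls]); last first.
    rewrite -[in RHS](mkseq_nth [::] ls) /mkseq -val_enum_ord -!map_comp.
    by apply: eq_map.
  apply: le_trans; rewrite le_eqVlt; apply/orP; left; apply/eqP; congr (`| _ |).
  apply: (Wf_permS cB T); last by rewrite perm_cat2r; apply: perm_map; exact: perm_mlist.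
  move=> v; rewrite mem_cat => /orP[] /mapP[q hq ->] //.
  by apply: SP; exact: sub.
rewrite ler_wpM2r// ler_nat big_map.
apply: (@leq_trans (2 ^ size t)%N); last by rewrite leq_exp2l.
elim: (t) => [|l t' IH]; first by rewrite big_nil.
rewrite big_cons expnS leq_mul//.
by rewrite /parts; case: l => [|i [|j l]].
Qed.

Lemma pders_bound w : (size w <= n)%N ->
  `|pders w (fun y => Rd (Seps eps (phi eps y)) y) x| <= (size (dTs w))%:R * ((2 ^ n)%:R * Q).
Proof.
move=> wn; rewrite pders_expansion//; apply: norm_sum_seq => t tw.
have ok := allP (dTs_ok w) _ tw; apply: term_bound; last exact: leq_trans (dTs_size tw) wn.
by apply: sub_all ok => l /andP[-> h]; exact: leq_trans h wn.
Qed.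

End Necessary.

Lemma moderate_char_moderate {R : realType} {s : nat} (Om : set 'rV[R]_s) Rd :
  open Om -> Ed Om Rd -> moderate_char Om Rd -> moderate Om Rd.
Proof.
move=> oOm E hch K cK KO alpha; pose w := mlist alpha; pose n := size w.
(* Only multi-indices with entries at most [n], and at most [n] directions, can occur; a finite type
   of pairs makes a common exponent available before the family is given. *)
have /choice[N HN] := fun p : {ffun 'I_s -> 'I_n.+1} * 'I_n.+1 => hch K cK KO (fun i => p.1 i) p.2.
have [NN NN0 HNN] := common_exponent N; exists NN; split=> // phi Cphi.
have [r1 r10 Hr1] := compact_thick oOm cK KO.
(* With [rho = r1 / 4] below, both [2 * d0] and [rho + d0] stay under the distance [r1] granted by
   [compact_thick]. *)
pose d0 := r1 / 8; have d00 : 0 < d0 by rewrite divr_gt0.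
(* Differentiating at [x] involves the family at neighbouring points, so its bounds are taken on a
   compact neighbourhood of [K]. *)
pose K2 := [set y : 'rV[R]_s | exists2 x, K x & `|y - x| <= 2 * d0].
have cK2 : compact K2.
  have -> : K2 = [set p.1 + p.2 | p in K `*` [set y : 'rV[R]_s | `|y - 0| <= 2 * d0]].
    apply/seteqP; split=> [y [x Kx hy]|_ [[x z] [/= Kx hz] <-]].
      by exists (x, y - x) => /=; [split=> //=; rewrite subr0|rewrite addrC subrK].
    by exists x => //; rewrite addrC addKr; move: hz; rewrite subr0.
  apply: continuous_compact; last by apply: compact_setX => //; exact: compact_norm_ball.
  by apply: continuous_subspaceT => p; apply: (@cvgD _ _ _ (nbhs p) _ fst snd); [exact: cvg_fst|exact: cvg_snd].
have K2O : K2 `<=` Om.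
  by move=> y [x Kx hy]; apply: (Hr1 x) => //; apply: (le_lt_trans hy); rewrite /d0; lra.
have [r r0 [M M0 HM]] := Phi_vbnd Cphi n.+1 cK2 K2O.
pose B : set (@tfun R s) := vbnd r M.
have bB : boundedD B by exact: (@vbnd_boundedD _ _ _ r M).
have Hec0 (p : {ffun 'I_s -> 'I_n.+1} * 'I_n.+1) : exists ec : R * R, [/\ 0 < ec.1, 0 < ec.2 &
  forall (eps : R) (x : 'rV[R]_s) (phi : @tfun R s) (psi : 'I_(snd p) -> tfun s),
    0 < eps < ec.1 -> K x -> B phi -> A0 phi ->
    (forall i, B (psi i) /\ A00 (psi i)) ->
    cabs (dquant Rd eps (fun i => p.1 i) phi psi x) <= ec.2 * eps ^- N p].
  have [_ /(_ _ bB)[e0 [C [/andP[h1 _] [C0 H]]]]] := HN p.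
  by exists (e0, C); split=> // eps x f psi h Kx Bf Af Hp; have [] := H eps x f psi h Kx Bf Af Hp.
have [ec Hec] := choice Hec0.
have e'0 p : 0 < (ec p).1 by have [] := Hec p.
have [e0 /andP[e00 e01] He0] := common_lower e'0.
have [C C0 HC] := common_upper (fun p => (ec p).2).
pose rho := r1 / 4; have rho0 : 0 < rho by rewrite divr_gt0.
have r10' : 0 < r + 1 by rewrite ltr_wpDl.
exists (Num.min e0 (rho / (r + 1))), (2 * (((size (dTs w))%:R + 1) * ((2 ^ n)%:R * C))).
split; first by rewrite lt_min e00 divr_gt0.
have S1 : 0 < (size (dTs w))%:R + 1 :> R by rewrite ltr_wpDl.
have n2 : 0 < (2 ^ n)%:R :> R by rewrite ltr0n expn_gt0.
split; first by rewrite !mulr_gt0.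
move=> eps x /andP[eps0]; rewrite lt_min => /andP[ee0 eer] Kx.
have eps01 : 0 < eps <= 1 by rewrite eps0 (le_trans (ltW ee0)).
have er : eps * r <= rho.
  by move: eer; rewrite ltr_pdivlMr// => h; apply: le_trans (ltW h); rewrite ler_wpM2l ?(ltW eps0)// lerDl.
have Hb y : `|y - x| < rho + d0 -> Om y.
  by move=> hy; apply: (Hr1 x) => //; apply: (lt_trans hy); rewrite /rho /d0; lra.
have Hb2 y : `|y - x| <= 2 * d0 -> Om y by move=> hy; apply: K2O; exists x.
have HM' y l : `|y - x| <= 2 * d0 -> (size l <= n.+1)%N -> vbnd r M (Phi phi eps l y).
  by move=> hy; apply: HM => //; exists x.
have xx : `|x - x| <= 2 * d0 by rewrite subrr normr0 mulr_ge0// ltW.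
have HQ ms (ls : seq (seq 'I_s)) : (size ms <= n)%N -> (size ls <= n)%N ->
  (forall l, l \in ls -> (0 < size l <= n)%N) ->
  `|dquant Rd eps (fun i => count_mem i ms) (phi eps x) (fun j : 'I_(size ls) => Phi phi eps (nth [::] ls j) x) x| <= C * eps ^- NN.
  move=> hm hl Hl.
  (* [inord] is faithful here because every count is at most [size ms], hence at most [n]. *)
  pose p : {ffun 'I_s -> 'I_n.+1} * 'I_n.+1 := ([ffun i => inord (count_mem i ms)], Ordinal (hl : (size ls < n.+1)%N)).
  have [_ ec20 H] := Hec p.
  have Ea : (fun i => count_mem i ms) = (fun i => nat_of_ord (p.1 i)).
    by apply/funext => i; rewrite /= ffunE inordK// ltnS (leq_trans (count_size _ _)).
  have := H eps x (phi eps x) (fun j : 'I_(size ls) => Phi phi eps (nth [::] ls j) x).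
  rewrite eps0 (lt_le_trans ee0 (He0 p)) => /(_ isT Kx).
  have B1 : B (phi eps x) by exact: (HM' x [::] xx).
  have A1 : A0 (phi eps x) by have [/(_ eps x eps01 (Hb2 _ xx))] := Cphi.
  have B2 (j : 'I_(size ls)) : B (Phi phi eps (nth [::] ls j) x) /\ A00 (Phi phi eps (nth [::] ls j) x).
    have /andP[l0 ln] := Hl _ (mem_nth [::] (ltn_ord j)).
    split; first by apply: HM' => //; exact: leqW.
    by apply: (Phi_A00 oOm Cphi eps01); [rewrite -size_eq0 -lt0n|exact: Hb2].
  move=> /(_ B1 A1 B2); rewrite -Ea => h.
  have /andP[h2 _] := cabs_norm (dquant Rd eps (fun i => count_mem i ms) (phi eps x) (fun j : 'I_(size ls) => Phi phi eps (nth [::] ls j) x) x).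
  apply: (le_trans h2); apply: (le_trans h).
  apply: ler_pM; rewrite ?invr_ge0 ?exprn_ge0 ?(ltW eps0) ?(ltW ec20)//.
  exact: expV_mono.
have := pders_bound E oOm Cphi eps01 (ltW rho0) d00 M0 Hb Hb2 HM' er HQ (leqnn (size w)).
have /andP[_ h] := cabs_norm (pder alpha (fun y => Rd (Seps eps (phi eps y)) y) x).
move=> h2; apply: (le_trans h); rewrite -[leRHS]mulrA ler_wpM2l//.
apply: (le_trans h2); rewrite -!mulrA ler_wpM2r ?lerDl//.
by rewrite !mulr_ge0 ?invr_ge0 ?exprn_ge0 ?(ltW eps0) ?(ltW C0).
Qed.

Theorem mainTheorem1 (R : realType) (s : nat) (Om : set 'rV[R]_s)
  (Rd : tfun s -> 'rV[R]_s -> R * R) :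
  open Om -> Ed Om Rd -> (moderate Om Rd <-> moderate_char Om Rd).
Proof.
move=> oOm E; split; first exact: moderate_moderate_char.
exact: moderate_char_moderate.
Qed.
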